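(* Fix $0<\delta<1$. There exist constants $0<\nu_0\le 1$, $c>0$ and $C>1$ such that the following holds. Let $0<\nu<\nu_0$, let $\theta_{in}\in L^2(\mathbb{T}_\delta^2)$, and let $\theta=\theta(t,x,y)$ be the solution on $\mathbb{T}_\delta^2$ of $$\partial_t\theta+\cos y\,\partial_x\theta+\nu(-\Delta)^{\frac12}\theta=0,\qquad \theta|_{t=0}=\theta_{in}.$$ Then for all $t\ge 0$, $$\|\theta_{\neq}(t)\|_{L^2(\mathbb{T}_\delta^2)}\le C e^{-c\nu^{2/3}t}\,\|\theta_{in}\|_{L^2(\mathbb{T}_\delta^2)},$$ where $\theta_{\neq}(t,x,y)=\theta(t,x,y)-\frac{1}{2\pi\delta}\int_{\mathbb{T}_{2\pi\delta}}\theta(t,x,y)\,dx$.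
   Context: $\mathbb{T}_\delta^2=\{(x,y): x\in\mathbb{T}_{2\pi\delta},\ y\in\mathbb{T}_{2\pi}\}$, where $\mathbb{T}_{L}=\mathbb{R}/L\mathbb{Z}$; thus the Fourier wave numbers are $\alpha\in\delta^{-1}\mathbb{Z}$ in $x$ and $\beta\in\mathbb{Z}$ in $y$. The operator $(-\Delta)^{\frac12}$ is the Fourier multiplier with symbol $(\alpha^2+\beta^2)^{\frac12}$. *)

(* Defs.v *)
From mathcomp Require Import all_boot all_order all_algebra.
From mathcomp Require Import all_classical all_reals all_analysis.
From mathcomp Require Import complex.
Import Order.TTheory GRing.Theory Num.Theory.
Import numFieldNormedType.Exports.

Set Implicit Arguments.
Unset Strict Implicit.
Unset Printing Implicit Defensive.

Local Open Scope classical_set_scope.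
Local Open Scope ring_scope.
Local Open Scope complex_scope.

(* Functions on the torus (R / 2 pi delta Z) x (R / 2 pi Z) are functions on
   R x R with these two periods; integrals are taken over one closed
   fundamental cell.  Functions are complex-valued, which includes the
   real-valued case. *)

Section Torus.
Context {R : realType}.
Variable delta : R.
Implicit Types (f : R * R -> R[i]) (u : int -> int -> R[i]).

Definition cell_x : set R := `[0, 2 * pi * delta].
Definition cell_y : set R := `[0, 2 * pi].
Definition cell : set (R * R) := cell_x `*` cell_y.

Local Notation plane := (measurableTypeR R * measurableTypeR R)%type.

Definition mu : {measure set plane -> \bar R} :=
  (@lebesgue_measure R \x @lebesgue_measure R)%E.

Definition Cintegral d (T : measurableType d)
    (m : {measure set T -> \bar R}) (D : set T) (g : T -> R[i]) : R[i] :=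
  (\int[m]_(z in D) complex.Re (g z)) +i* (\int[m]_(z in D) complex.Im (g z)).

Definition L2norm f : \bar R :=
  'N[mu]_(2%:E)[EFin \o ((fun z => Normc.normc (f z)) \_ cell)]%E.

Definition torus_periodic f : Prop := forall x y,
  f (x + 2 * pi * delta, y) = f (x, y) /\ f (x, y + 2 * pi) = f (x, y).

Definition inL2 f : Prop :=
  [/\ torus_periodic f,
      measurable_fun [set: plane] (fun z => complex.Re (f z)),
      measurable_fun [set: plane] (fun z => complex.Im (f z)) &
      (L2norm f < +oo)%E].

(* The mode (m, n) has wave numbers alpha = m / delta and beta = n. *)
Definition alpha (m : int) : R := m%:~R / delta.
Definition beta (n : int) : R := n%:~R.

Definition cis (a : R) : R[i] := cos a +i* sin a.

Definition fourier f (m n : int) : R[i] :=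
  ((2 * pi * delta) * (2 * pi))^-1%:C *
  Cintegral mu cell (fun z => f z * cis (- (alpha m * z.1 + beta n * z.2))).

(* Fourier multipliers act on periodic distributions, which are represented
   by their families of Fourier coefficients u. *)
Definition dx u (m n : int) : R[i] := (0 +i* alpha m) * u m n.

Definition half_laplacian u (m n : int) : R[i] :=
  (Num.sqrt (alpha m ^+ 2 + beta n ^+ 2))%:C * u m n.

(* Since cos y does not depend on x, the advection term cos y * dx f is the
   distribution dx (cos y * f), which is defined for every f in L2. *)
Definition advection f : int -> int -> R[i] :=
  dx (fourier (fun z => (cos z.2)%:C * f z)).

Definition is_Cderive (t : R) (g : R -> R[i]) (l : R[i]) : Prop :=
  is_derive t 1 (fun s => complex.Re (g s)) (complex.Re l) /\
  is_derive t 1 (fun s => complex.Im (g s)) (complex.Im l).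

(* theta is a weak solution in C([0, +oo[; L2): the equation holds in the
   sense of distributions on the torus, i.e. tested against every Fourier
   mode.  Only the values of theta at times t >= 0 matter. *)
Definition solution (nu : R) (theta_in : R * R -> R[i])
    (theta : R -> R * R -> R[i]) : Prop :=
  [/\ forall t : R, 0 <= t -> inL2 (theta t),
      forall t : R, 0 <= t ->
        L2norm (fun z => theta s z - theta t z)
          @[s --> within `[0, +oo[ (nbhs t)] --> 0%E,
      {ae mu, forall z, cell z -> theta 0 z = theta_in z} &
      forall t : R, 0 < t -> forall m n : int,
        is_Cderive t (fun s => fourier (theta s) m n)
          (- (advection (theta t) m n
              + nu%:C * half_laplacian (fourier (theta t)) m n))].

Definition neq_part f (z : R * R) : R[i] :=
  f z - (2 * pi * delta)^-1%:C *
        Cintegral (@lebesgue_measure R) cell_x (fun x => f (x, z.2)).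

End Torus.

(* Main.v *)
Require Import Defs.
From mathcomp Require Import all_boot all_order all_algebra.
From mathcomp Require Import ring lra zify.
From mathcomp Require Import all_classical all_reals all_analysis measurable_realfun.
From mathcomp Require Import complex.
Import Order.TTheory GRing.Theory Num.Theory.
Import numFieldNormedType.Exports.
Set Implicit Arguments.
Unset Strict Implicit.
Unset Printing Implicit Defensive.
Local Open Scope classical_set_scope.
Local Open Scope ring_scope.

(**
In the Fourier variables (m, n) the equation decouples in the x-frequency m.
For a fixed m <> 0, with a = m / delta, the coefficients u(t, n) of the
solution in y satisfy
  u' = - i a avg u - nu la u,    la n = sqrt (a ^ 2 + n ^ 2),
where avg, the average of the two neighbours, is multiplication by cos y.
Here |a| >= 1, because delta < 1.  The mean m = 0 is exactly what neq_part
removes, so by Plancherel it suffices to prove, with constants independent of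
m, that the sum over n of |u(t, n)|^2 decays like exp (- c nu^(2/3) t).

For one frequency, a translation of y by a quarter period turns cos y into
sin y and makes the system real; rescaling time by |a| then gives
  w' = - cdiff w - kap la w,    kap = nu / |a| = mu ^ 6,
where cdiff, the central difference, is multiplication by - i sin y.  The
decay rate mu ^ 4 = kap^(2/3) is reached as follows.

- Hypocoercivity.  Transport by sin y creates y-derivatives at the speed
  cos y, so the functional
    Phi = sum of  w ^ 2 - J w (avg w) + s ^ 4 (avg w) ^ 2
  is used.  Half a derivative of dissipation cannot pay for a true derivative
  in the cross term, hence J is the multiplier s ^ 3 k n / (1 + k s |n|),
  k = mu ^ 3, which is linear at low frequencies and saturates at the higher
  ones, where the dissipation itself suffices ([sat_cdiff]).  Letting the
  weight s grow linearly from 0 to 1 / mu during the time 32 / mu ^ 4, one gets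
    |w|^2 + mu^(-4) |avg w|^2 <= C |w(0)|^2
  without any regularity of w(0) ([growing_phase]); with J = 0 this bound
  persists during a further time 1 / mu ^ 4 ([plateau_phase]).
- Uncertainty principle.  Now cos y w is small, so the mass of w sits near the
  zeros of cos y, within a distance of order mu ^ 2, and therefore at
  frequencies |n| of order at least mu^(-2) ([local_mass]).  There the
  dissipation rate kap |n| is at least of order mu ^ 4, and |w|^2 loses a fixed
  factor during the plateau ([contraction]).  Iterating gives the exponential
  decay ([seq_decay], [mode_decay]).

The summations by parts are done for finitely supported sequences.  The cut-off
of a bounded solution at frequency r solves the same system up to an error of
size 1 / r, which disappears as r tends to infinity ([cutoff_limit]).

The link with functions is Plancherel's identity on the torus, obtained from
the completeness of the real orthonormal family cos + sin on the circle
([parseval_L2]) applied in x and then in y ([plane_parseval_le]): Bessel's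
inequality is used at time 0, and its converse at time t for the fluctuation.
*)

(** * Symmetric sums over the integers *)

Section Zsum.
Context {R : realType}.
Implicit Types (f g w : int -> R) (K : nat).

(** Symmetric truncation keeps n and - n together, so that sums of odd functions
vanish exactly and no convergence of a bilateral series is involved. *)
Definition zsum K f : R := \sum_(i < K.*2.+1) f (i%:Z - K%:Z).

Lemma zsumD K f g : zsum K (fun n => f n + g n) = zsum K f + zsum K g.
Proof. by rewrite /zsum big_split. Qed.
Lemma zsumZ K a f : zsum K (fun n => a * f n) = a * zsum K f.
Proof. by rewrite /zsum mulr_sumr. Qed.
Lemma zsumN K f : zsum K (fun n => - f n) = - zsum K f.
Proof. by rewrite /zsum sumrN. Qed.
Lemma eq_zsum K f g : f =1 g -> zsum K f = zsum K g.
Proof. by move=> fg; apply: eq_bigr => i _. Qed.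
Lemma ler_zsum K f g : (forall n, f n <= g n) -> zsum K f <= zsum K g.
Proof. by move=> fg; apply: ler_sum => i _. Qed.
Lemma zsum_ge0 K f : (forall n, 0 <= f n) -> 0 <= zsum K f.
Proof. by move=> f0; apply: sumr_ge0 => i _. Qed.

Lemma zsum_telescope K f :
  zsum K (fun n => f (n + 1) - f n) = f (K%:Z + 1) - f (- K%:Z).
Proof.
rewrite /zsum.
have -> : \sum_(i < K.*2.+1) (f (i%:Z - K%:Z + 1) - f (i%:Z - K%:Z)) =
    \sum_(i < K.*2.+1) (f (i.+1%:Z - K%:Z) - f (i%:Z - K%:Z)).
  by apply: eq_bigr => i _; congr (f _ - _); lia.
rewrite -(big_mkord predT (fun i => f (i.+1%:Z - K%:Z) - f (i%:Z - K%:Z))).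
rewrite (telescope_sumr (fun i => f (i%:Z - K%:Z))) //; congr (f _ - f _); [lia | by rewrite sub0r].
Qed.

Definition supp K f := forall n : int, (K <= `|n|)%N -> f n = 0.

Lemma zsum_shiftD K f : supp K f -> zsum K (fun n => f (n + 1)) = zsum K f.
Proof.
move=> fK; apply/eqP; rewrite -subr_eq0 -zsumN -zsumD zsum_telescope.
by rewrite !fK ?subrr //; lia.
Qed.

Lemma zsum_shiftB K f : supp K f -> zsum K (fun n => f (n - 1)) = zsum K f.
Proof.
move=> fK; have := zsum_telescope K (fun n => f (n - 1)).
rewrite zsumD zsumN (@eq_zsum _ _ f); last by move=> n; rewrite addrK.
rewrite !fK ?subrr; [|lia..] => /eqP; rewrite subr_eq0 => /eqP ->; lra.
Qed.

(** If f is the sequence of Fourier coefficients of a function of y, then [avg f]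
is that of its product by cos y and [cdiff f] that of its product by
- i sin y. *)
Definition avg f (n : int) : R := (f (n + 1) + f (n - 1)) / 2.
Definition cdiff f (n : int) : R := (f (n + 1) - f (n - 1)) / 2.

Lemma supp_avg K f : supp K f -> supp K.+1 (avg f).
Proof. by move=> fK n nK; rewrite /avg !fK; [lra|lia..]. Qed.

Lemma supp_sqr K f : supp K f -> supp K (fun n => f n ^+ 2).
Proof. by move=> fK n /fK ->; rewrite expr0n. Qed.

Lemma suppS K f : supp K f -> supp K.+1 f.
Proof. by move=> fK n nK; apply: fK; lia. Qed.

(** Multiplication by - i sin y is antisymmetric for the real pairing. *)
Lemma zsum_cdiff_antisym K f g : supp K g ->
  zsum K (fun n => f n * cdiff g n) = - zsum K (fun n => cdiff f n * g n).
Proof.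
move=> gK; apply/eqP; rewrite -subr_eq0 opprK -zsumD.
have := zsum_telescope K (fun n => 2^-1 * (f n * g (n - 1) + f (n - 1) * g n)).
rewrite !gK; [|lia..] => /= E; rewrite (@eq_zsum _ _ (fun n =>
  2^-1 * (f (n + 1) * g (n + 1 - 1) + f (n + 1 - 1) * g (n + 1)) -
  2^-1 * (f n * g (n - 1) + f (n - 1) * g n))).
  by rewrite E; apply/eqP; lra.
by move=> n; rewrite addrK /cdiff; field.
Qed.

Lemma zsum_cdiff_self K f : supp K f -> zsum K (fun n => f n * cdiff f n) = 0.
Proof.
move=> fK; have := zsum_cdiff_antisym f fK.
rewrite (@eq_zsum _ (fun n => f n * cdiff f n) (fun n => cdiff f n * f n)).
  by move=> ?; lra.
by move=> n; rewrite mulrC.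
Qed.

(** Both [avg] and [cdiff] are bounded by 1, as cos y and sin y are. *)
Lemma zsum_half_shifts_le K f h : supp K f ->
  (forall n, h n ^+ 2 <= (f (n + 1) ^+ 2 + f (n - 1) ^+ 2) / 2) ->
  zsum K (fun n => h n ^+ 2) <= zsum K (fun n => f n ^+ 2).
Proof.
move=> fK hf; apply: le_trans (ler_zsum _ hf) _.
rewrite (@eq_zsum _ _ (fun n => 2^-1 * (f (n + 1) ^+ 2) + 2^-1 * (f (n - 1) ^+ 2)));
  last by move=> n; lra.
rewrite zsumD !zsumZ (@zsum_shiftD _ (fun n => f n ^+ 2)); last exact: supp_sqr.
rewrite (@zsum_shiftB _ (fun n => f n ^+ 2)); last exact: supp_sqr.
lra.
Qed.

Lemma zsum_avg_le K f : supp K f ->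
  zsum K (fun n => avg f n ^+ 2) <= zsum K (fun n => f n ^+ 2).
Proof.
move=> fK; apply: zsum_half_shifts_le fK _ => n; rewrite /avg.
have := sqr_ge0 (f (n + 1) - f (n - 1)); nra.
Qed.

Lemma zsum_cdiff_le K f : supp K f ->
  zsum K (fun n => cdiff f n ^+ 2) <= zsum K (fun n => f n ^+ 2).
Proof.
move=> fK; apply: zsum_half_shifts_le fK _ => n; rewrite /cdiff.
have := sqr_ge0 (f (n + 1) + f (n - 1)); nra.
Qed.

Lemma zsumS K f : zsum K.+1 f = f (- K.+1%:Z) + zsum K f + f K.+1%:Z.
Proof.
rewrite /zsum doubleS big_ord_recl big_ord_recr /= addrA.
congr (f _ + _ + f _); [lia| |rewrite /bump /=; lia].
by apply: eq_bigr => i _; congr f; rewrite /bump /=; lia.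
Qed.

Lemma zsum_shiftD_le K f : (forall n, 0 <= f n) ->
  zsum K (fun n => f (n + 1)) <= zsum K.+1 f.
Proof.
move=> f0; have := zsum_telescope K f; rewrite zsumD zsumN zsumS.
have := f0 (- K.+1%:Z); have := f0 (- K%:Z).
rewrite (_ : K.+1%:Z = K%:Z + 1); last by lia.
lra.
Qed.

Lemma zsum_shiftB_le K f : (forall n, 0 <= f n) ->
  zsum K (fun n => f (n - 1)) <= zsum K.+1 f.
Proof.
move=> f0; have := zsum_telescope K (fun n => f (n - 1)); rewrite zsumD zsumN zsumS.
rewrite (_ : zsum K (fun n => f (n + 1 - 1)) = zsum K f); last first.
  by apply: eq_zsum => n; rewrite addrK.
have := f0 K.+1%:Z; have := f0 (K%:Z + 1 - 1).
rewrite (_ : - K.+1%:Z = - K%:Z - 1); last by lia.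
lra.
Qed.

Lemma zsum_le K1 K2 f : (forall n, 0 <= f n) -> (K1 <= K2)%N -> zsum K1 f <= zsum K2 f.
Proof.
move=> f0 /subnK <-; elim: (K2 - K1)%N => [//|k IH].
rewrite addSn zsumS; apply: le_trans IH _.
by have := f0 (- (k + K1).+1%:Z); have := f0 (k + K1).+1%:Z; lra.
Qed.

Lemma ler_zsum_in K f g : (forall n, (`|n| <= K)%N -> f n <= g n) -> zsum K f <= zsum K g.
Proof. by move=> fg; apply: ler_sum => i _; apply: fg; have := ltn_ord i; lia. Qed.

Lemma zsum0 f : zsum 0 f = f 0.
Proof. by rewrite /zsum big_ord_recl big_ord0 /= addr0. Qed.

Lemma zsum_opp K f : zsum K (fun n => f (- n)) = zsum K f.
Proof.
elim: K => [|K IH]; first by rewrite !zsum0 oppr0.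
by rewrite !zsumS IH opprK; ring.
Qed.

Lemma zsum_odd K f : (forall n, f (- n) = - f n) -> zsum K f = 0.
Proof.
move=> h; have := zsum_opp K f; rewrite (eq_zsum _ h) zsumN; lra.
Qed.

Lemma le_zsum_term (f : int -> R) n : (forall k, 0 <= f k) -> f n <= zsum `|n|%N f.
Proof.
move=> f0; case E : `|n|%N => [|k].
  by move/eqP: E; rewrite absz_eq0 => /eqP ->; rewrite zsum0 lexx.
have z0 := zsum_ge0 k f0; rewrite zsumS.
have [->|->] : n = k.+1%:Z \/ n = - k.+1%:Z by lia.
  by rewrite lerDr addr_ge0.
by rewrite -addrA lerDl addr_ge0.
Qed.

End Zsum.

(** * A saturated frequency multiplier and its algebraic inequality *)

Section Saturation.
Context {R : realType}.
Implicit Types (b : R) (n : int).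

(** The symbol of a derivative, saturated at frequencies of order 1 / b. *)
Definition sat b n : R := n%:~R / (1 + b * `|n%:~R|).

Lemma satN b n : sat b (- n) = - sat b n.
Proof. by rewrite /sat rmorphN normrN mulNr. Qed.

Lemma sat_den_gt0 b n : 0 <= b -> 0 < 1 + b * `|n%:~R|.
Proof. by move=> b0; rewrite ltr_wpDr // mulr_ge0. Qed.

Lemma sat_norm b n : 0 <= b -> b * `|sat b n| <= 1.
Proof.
move=> b0; have d0 := sat_den_gt0 n b0.
rewrite /sat normrM normfV (gtr0_norm d0) mulrA ler_pdivrMr //; lra.
Qed.

Lemma int_cases (P : int -> Prop) :
  (forall n, P (- n) -> P n) -> P 0 -> (forall n : int, 1 <= n -> P n) -> forall n, P n.
Proof.
move=> PN P0 P1 n; have [n0|n0|->] := ltgtP n 0; last exact: P0.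
- by apply: PN; apply: P1; lia.
- by apply: P1; lia.
Qed.

Lemma sat_ge0E b n : (0 <= n)%R -> sat b n = n%:~R / (1 + b * n%:~R).
Proof. by move=> n0; rewrite /sat ger0_norm // ler0z. Qed.

Lemma sat_cdiff_pos b (x : R) : 0 <= b -> b <= 1 -> 1 <= x ->
  1 / 4 <= ((x + 1) / (1 + b * (x + 1)) - (x - 1) / (1 + b * (x - 1))) / 2 + b * x.
Proof.
move=> b0 b1 x1; have bx : 0 <= b * (x - 1) by rewrite mulr_ge0 ?subr_ge0.
set A := 1 + b * (x + 1); set B := 1 + b * (x - 1).
have A0 : 0 < A by rewrite /A; nra.
have B0 : 0 < B by rewrite /B; lra.
have -> : ((x + 1) / A - (x - 1) / B) / 2 = (A * B)^-1.
  have E : A - B = 2 * b by rewrite /A /B; ring.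
  have [An0 Bn0] : A != 0 /\ B != 0 by rewrite !gt_eqF.
  have E1 : (x + 1) * B - (x - 1) * A = 2 by rewrite /A /B; ring.
  have -> : (x + 1) / A - (x - 1) / B = ((x + 1) * B - (x - 1) * A) / (A * B).
    by field; rewrite An0 Bn0.
  by rewrite E1; field; rewrite An0 Bn0.
have AB : A * B <= (1 + b * x) ^+ 2 by rewrite /A /B; nra.
have [z4|z4] := leP (1 / 4) (b * x).
  have : 0 <= (A * B)^-1 by rewrite invr_ge0 mulr_ge0 // ltW.
  lra.
have : 1 / 4 <= (A * B)^-1; last by nra.
rewrite ler_pdivrMr // lter_pdivlMl ?mulr_gt0 //; nra.
Qed.

(** To leading order the commutator of [sat] with sin y has symbol [cdiff (sat b)],
with the factor cos y.  It is bounded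
below where sat is still close to linear; at the frequencies where it has
saturated, the dissipation b |n| takes over. *)
Lemma sat_cdiff b n : 0 <= b -> b <= 1 -> 1 / 4 <= cdiff (sat b) n + b * `|n%:~R|.
Proof.
move=> b0 b1; elim/int_cases: n => [n|//|n n1].
- rewrite rmorphN normrN /cdiff => h.
  have e1 : - n + 1 = - (n - 1) by rewrite opprB addrC.
  have e2 : - n - 1 = - (n + 1) by rewrite opprD.
  by move: h; rewrite e1 e2 !satN opprK [- _ + _]addrC.
- rewrite /cdiff add0r sub0r satN /sat normr0 mulr0 addr0 normr1 mulr1 opprK div1r.
  have : 1 / 4 <= (1 + b)^-1 by rewrite ler_pdivrMr // lter_pdivlMl; lra.
  lra.
- have n1' : 1 <= n%:~R :> R by rewrite ler1z.
  rewrite ger0_norm ?ler0z; last lia.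
  rewrite /cdiff !sat_ge0E ?rmorphD ?rmorphB ?rmorph1; [|lia..].
  exact: sat_cdiff_pos.
Qed.

(** The second difference is what remains of the commutator after the leading
term has been extracted; it is of the size of the curvature of sat, at most 2 b. *)
Lemma sat_diff2 b n : 0 <= b -> b <= 1 ->
  `|sat b (n + 1) - 2 * sat b n + sat b (n - 1)| <= 2 * b.
Proof.
move=> b0 b1; elim/int_cases: n => [n|//|n n1].
- have e1 : - n + 1 = - (n - 1) by rewrite opprB addrC.
  have e2 : - n - 1 = - (n + 1) by rewrite opprD.
  rewrite e1 e2 !satN; apply: le_trans; rewrite -normrN le_eqVlt.
  by apply/orP; left; apply/eqP; congr (`|_|); ring.
- by rewrite add0r sub0r satN {2}/sat mul0r mulr0 subr0 subrr normr0 mulr_ge0.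
- have n1' : 1 <= n%:~R :> R by rewrite ler1z.
  rewrite !sat_ge0E ?rmorphD ?rmorphB ?rmorph1; [|lia..].
  set x := n%:~R : R in n1' *.
  have bx : 0 <= b * (x - 1) by rewrite mulr_ge0 ?subr_ge0.
  set A := 1 + b * (x + 1); set B := 1 + b * (x - 1); set C := 1 + b * x.
  have A0 : 1 <= A by rewrite /A; nra.
  have B0 : 1 <= B by rewrite /B; lra.
  have C0 : 1 <= C by rewrite /C; nra.
  have E : (x + 1) / A - 2 * (x / C) + (x - 1) / B = - (2 * b / (A * B * C)).
    have [An0 Bn0 Cn0] : [/\ A != 0, B != 0 & C != 0].
      by rewrite !gt_eqF //; apply: lt_le_trans ltr01 _.
    have E1 : (x + 1) * B * C - 2 * x * A * B + (x - 1) * A * C = - (2 * b).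
      by rewrite /A /B /C; ring.
    have -> : - (2 * b / (A * B * C)) = (- (2 * b)) / (A * B * C) by rewrite mulNr.
    by rewrite -E1; field; rewrite An0 Bn0 Cn0.
  have ABC : 1 <= A * B * C by rewrite !mulr_ege1.
  rewrite E normrN ger0_norm.
    by rewrite ler_pdivrMr; [nra|apply: lt_le_trans ABC].
  by rewrite divr_ge0 //; [lra|apply: le_trans ABC].
Qed.

End Saturation.

Section Hypocoercivity.
Context {R : realType}.

Lemma ler_mul_amgm (p r j x y : R) : 0 <= p -> 0 <= r -> j ^+ 2 <= p * r ->
  - (j * x * y) <= (p * x ^+ 2 + r * y ^+ 2) / 2.
Proof.
move=> p0 r0 jpr; have [p_gt0|p_le0] := ltP 0 p.
  have : 0 <= p * (p * x ^+ 2 + r * y ^+ 2 + 2 * j * x * y).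
    have -> : p * (p * x ^+ 2 + r * y ^+ 2 + 2 * j * x * y) =
      (p * x + j * y) ^+ 2 + (p * r - j ^+ 2) * y ^+ 2 by ring.
    by rewrite addr_ge0 ?sqr_ge0 // mulr_ge0 ?sqr_ge0 // subr_ge0.
  rewrite pmulr_rge0 //; lra.
have p00 : p = 0 by apply/eqP; rewrite eq_le p_le0.
have /eqP -> : j == 0.
  by rewrite -sqrf_eq0 eq_le sqr_ge0 andbT (le_trans jpr) // p00 mul0r.
by rewrite !mul0r oppr0 p00 mul0r add0r divr_ge0 // mulr_ge0 ?sqr_ge0.
Qed.

Lemma ler_mul_eps (eps c x y : R) : 0 < eps ->
  c * x * y <= (eps * (c ^+ 2 * x ^+ 2) + eps^-1 * y ^+ 2) / 2.
Proof.
move=> e0; have ei0 : 0 <= eps^-1 by rewrite invr_ge0 ltW.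
have := @ler_mul_amgm eps eps^-1 (- 1) (c * x) y (ltW e0) ei0.
rewrite divff ?gt_eqF // => /(_ _); rewrite exprMn; lra.
Qed.

(** The time derivative of one term of the functional.  The letters stand for
x = w n, y = avg w n, d = cdiff w n, r the commutator of la with avg,
(e, f) the source and its average, q = cdiff J n and J2 the second difference
of J; s' and Jt are time derivatives.  The hypothesis |J| <= s ^ 2 makes all
dissipative cross terms subordinate to the two squares, and rho is the share of
the gain left for the motion of J in time. *)
Lemma hypo_pointwise (kap s s' la m J Jt q J2 rho eps x y d r e f : R) :
  0 <= kap -> 0 <= s -> 0 <= m -> m <= la -> `|J| <= s ^+ 2 -> 0 <= rho ->
  Jt ^+ 2 <= kap * m * rho -> `|J2| <= 2 * kap * s ^+ 4 -> 0 < eps ->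
  4 * s ^+ 3 * s' + rho / 2 <= q + kap * s ^+ 4 * m ->
  2 * x * (- kap * la * x + e) - Jt * x * y - J * y * (- kap * la * x + e)
   - J * x * (- kap * (la * y + r) + f) + 4 * s ^+ 3 * s' * y ^+ 2
   + 2 * s ^+ 4 * y * (- kap * (la * y + r) + f) - q * y ^+ 2 - J2 / 2 * d * y
  <= kap * s ^+ 2 * (x ^+ 2 / 2 + 3 / 2 * r ^+ 2 + d ^+ 2 / 2
                     + 3 / 2 * (s ^+ 4 * y ^+ 2))
    + 2 * (1 + s ^+ 4) * (eps * (x ^+ 2 + y ^+ 2) + eps^-1 * (e ^+ 2 + f ^+ 2)).
Proof.
move=> k0 s0 m0 mla Js rho0 Jtr J2s e0 absorb.
have la0 : 0 <= la by apply: le_trans mla.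
have ei0 : 0 < eps^-1 by rewrite invr_gt0.
have s20 : 0 <= s ^+ 2 by rewrite sqr_ge0.
have s4E : s ^+ 4 = s ^+ 2 * s ^+ 2 by rewrite -exprD.
have J2le : J ^+ 2 <= s ^+ 4.
  by rewrite s4E -expr2 -(real_normK (num_real J)) ler_sqr ?nnegrE.
have ha : 2 * kap * J * la * x * y <= kap * la * (x ^+ 2 + s ^+ 4 * y ^+ 2).
  have h : 2 * J * x * y <= x ^+ 2 + s ^+ 4 * y ^+ 2.
    have := @ler_mul_amgm 1 (s ^+ 4) (- J) x y ler01 _ _.
    rewrite sqrrN mul1r exprn_ge0 // => /(_ isT J2le); lra.
  have : kap * la * (2 * J * x * y) <= kap * la * (x ^+ 2 + s ^+ 4 * y ^+ 2).
    by rewrite ler_wpM2l // mulr_ge0.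
  lra.
have hb : kap * (J * x * r) <= kap * (s ^+ 2 * (x ^+ 2 + r ^+ 2) / 2).
  rewrite ler_wpM2l //.
  have := @ler_mul_amgm (s ^+ 2) (s ^+ 2) (- J) x r s20 s20.
  rewrite sqrrN -s4E => /(_ J2le); lra.
have hc : - (2 * kap * s ^+ 4 * y * r) <= kap * (s ^+ 2 * (s ^+ 4 * y ^+ 2 + r ^+ 2)).
  have h : - (2 * s ^+ 2 * y * r) <= s ^+ 4 * y ^+ 2 + r ^+ 2.
    by have := sqr_ge0 (s ^+ 2 * y + r); rewrite s4E; lra.
  have : kap * s ^+ 2 * - (2 * s ^+ 2 * y * r)
         <= kap * s ^+ 2 * (s ^+ 4 * y ^+ 2 + r ^+ 2) by rewrite ler_wpM2l ?mulr_ge0.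
  by rewrite s4E; lra.
have hd : - (Jt * x * y) <= (kap * m * x ^+ 2 + rho * y ^+ 2) / 2.
  by apply: ler_mul_amgm => //; rewrite mulr_ge0.
have he : - (J2 / 2 * d * y) <= kap * s ^+ 2 * (d ^+ 2 + s ^+ 4 * y ^+ 2) / 2.
  have := @ler_mul_amgm (kap * s ^+ 2) (kap * s ^+ 2 * s ^+ 4) (J2 / 2) d y _ _ _.
  rewrite !mulr_ge0 ?exprn_ge0 // => h.
  suff /(h isT isT) : (J2 / 2) ^+ 2 <= kap * s ^+ 2 * (kap * s ^+ 2 * s ^+ 4) by lra.
  have -> : kap * s ^+ 2 * (kap * s ^+ 2 * s ^+ 4) = (kap * s ^+ 4) ^+ 2 by ring.
  rewrite -(real_normK (num_real (J2 / 2))) ler_sqr ?nnegrE ?mulr_ge0 ?exprn_ge0 //.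
  by rewrite normrM (ger0_norm (_ : 0 <= 2^-1)) //; lra.
have f1 := ler_mul_eps 1 x e e0; have f2 := ler_mul_eps (- J) y e e0.
have f3 := ler_mul_eps (- J) x f e0.
have hs : 2 * x * e - J * y * e - J * x * f + 2 * s ^+ 4 * y * f <=
  2 * (1 + s ^+ 4) * (eps * (x ^+ 2 + y ^+ 2) + eps^-1 * (e ^+ 2 + f ^+ 2)).
  have s40 : 0 <= s ^+ 4 by rewrite exprn_ge0.
  have e0' := ltW e0; have ei0' := ltW ei0.
  have Jx : eps * (J ^+ 2 * x ^+ 2) <= eps * (s ^+ 4 * x ^+ 2).
    by apply: ler_wpM2l; [exact: ltW|apply: ler_wpM2r; rewrite ?sqr_ge0].
  have Jy : eps * (J ^+ 2 * y ^+ 2) <= eps * (s ^+ 4 * y ^+ 2).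
    by apply: ler_wpM2l; [exact: ltW|apply: ler_wpM2r; rewrite ?sqr_ge0].
  have f4' := ler_wpM2l s40 (ler_mul_eps 1 y f e0).
  have p1 := mulr_ge0 e0' (sqr_ge0 x); have p2 := mulr_ge0 e0' (sqr_ge0 y).
  have p3 := mulr_ge0 ei0' (sqr_ge0 e); have p4 := mulr_ge0 ei0' (sqr_ge0 f).
  have q1 := mulr_ge0 s40 p1; have q2 := mulr_ge0 s40 p2.
  have q3 := mulr_ge0 s40 p3; have q4 := mulr_ge0 s40 p4.
  rewrite sqrrN in f2 f3; lra.
have habs : 4 * s ^+ 3 * s' * y ^+ 2 + rho / 2 * y ^+ 2
            <= q * y ^+ 2 + kap * s ^+ 4 * m * y ^+ 2.
  have := ler_wpM2r (sqr_ge0 y) absorb; lra.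
have hm1 : kap * m * x ^+ 2 <= kap * la * x ^+ 2.
  by rewrite ler_wpM2r ?sqr_ge0 // ler_wpM2l.
have hm2 : kap * s ^+ 4 * m * y ^+ 2 <= kap * s ^+ 4 * la * y ^+ 2.
  by rewrite ler_wpM2r ?sqr_ge0 // ler_wpM2l // mulr_ge0 // exprn_ge0.
have hm3 : 0 <= kap * la * x ^+ 2.
  by apply: mulr_ge0; rewrite ?sqr_ge0 // mulr_ge0.
lra.
Qed.

End Hypocoercivity.

(** * Dissipation of the hypocoercive functional at a fixed time *)

Section Static.
Context {R : realType}.
Variables (K : nat) (kap : R) (la : int -> R) (w e : int -> R).
Hypotheses (kap0 : 0 <= kap) (la_ge : forall n, `|n%:~R| <= la n)
  (la_lip : forall n, `|la (n + 1) - la n| <= 1).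
Hypotheses (wK : supp K w) (eK : supp K.+1 e).

(** The system with transport sin y, damping kap la and source e. *)
Definition rhs (n : int) : R := - cdiff w n - kap * la n * w n + e n.

(** The commutator of multiplication by cos y with the multiplier la; it is bounded
because la is 1-Lipschitz, which is why half a derivative of dissipation
commutes with cos y up to a term of order 0. *)
Definition comm (n : int) : R :=
  ((la (n + 1) - la n) * w (n + 1) + (la (n - 1) - la n) * w (n - 1)) / 2.

Lemma avg_rhs n : avg rhs n =
  - cdiff (avg w) n - kap * (la n * avg w n + comm n) + avg e n.
Proof. by rewrite /avg /rhs /comm /cdiff /avg addrK subrK; field. Qed.

Let L := K.+1.
Local Notation nsq f := (zsum L (fun n => f n ^+ 2)).

Lemma comm_le : nsq comm <= nsq w.
Proof.
apply: zsum_half_shifts_le; first exact: suppS.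
move=> n; rewrite /comm; set p := la (n + 1) - la n; set q := la (n - 1) - la n.
have p1 : p ^+ 2 <= 1.
  by rewrite -(real_normK (num_real p)) exprn_ile1 // la_lip.
have q1 : q ^+ 2 <= 1.
  rewrite -(real_normK (num_real q)) exprn_ile1 // /q distrC.
  by have := la_lip (n - 1); rewrite subrK.
set x := w _; set y := w _.
have -> : ((p * x + q * y) / 2) ^+ 2 = (p * x + q * y) ^+ 2 / 4 by field.
have := sqr_ge0 (p * x - q * y).
have : p ^+ 2 * x ^+ 2 <= 1 * x ^+ 2 by rewrite ler_wpM2r ?sqr_ge0.
have : q ^+ 2 * y ^+ 2 <= 1 * y ^+ 2 by rewrite ler_wpM2r ?sqr_ge0.
rewrite !mul1r -!exprMn; nra.
Qed.

(** The source of coercivity: transport makes the cross term produce the square of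
the average, weighted by the slope of J. *)
Lemma hypo_transport (J : int -> R) :
  zsum L (fun n => J n * cdiff w n * avg w n + J n * w n * cdiff (avg w) n) =
  - zsum L (fun n => cdiff J n * avg w n ^+ 2
     + (J (n + 1) - 2 * J n + J (n - 1)) / 2 * cdiff w n * avg w n).
Proof.
rewrite zsumD.
rewrite (@zsum_cdiff_antisym _ _ (fun n => J n * w n)); last exact: supp_avg.
rewrite -zsumN -zsumD -zsumN; apply: eq_zsum => n.
by rewrite /avg /cdiff; field.
Qed.

(** Once the gain of the transport and the damping have absorbed what they can, every
remaining term is a multiple of the energies of w and of its average, at the rate
kap s ^ 2. *)
Lemma hypo_static (s s' rho eps : R) (J Jt : int -> R) :
  0 <= s -> 0 <= rho -> 0 < eps ->
  (forall n, `|J n| <= s ^+ 2) ->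
  (forall n, Jt n ^+ 2 <= kap * `|n%:~R| * rho) ->
  (forall n, `|J (n + 1) - 2 * J n + J (n - 1)| <= 2 * kap * s ^+ 4) ->
  (forall n, 4 * s ^+ 3 * s' + rho / 2 <= cdiff J n + kap * s ^+ 4 * `|n%:~R|) ->
  nsq e <= eps ^+ 2 ->
  zsum L (fun n => 2 * w n * rhs n - Jt n * w n * avg w n - J n * rhs n * avg w n
    - J n * w n * avg rhs n + 4 * s ^+ 3 * s' * avg w n ^+ 2
    + 2 * s ^+ 4 * avg w n * avg rhs n)
  <= 3 * kap * s ^+ 2 * (nsq w + s ^+ 4 * nsq (avg w))
     + 4 * eps * (1 + s ^+ 4) * (nsq w + 1).
Proof.
move=> s0 rho0 eps0 Js Jtr J2s absorb e_eps.
(* E is the summand of the left-hand side once the pure transport terms are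
   removed; these sum to 0 by antisymmetry. *)
pose E n := 2 * w n * (- kap * la n * w n + e n) - Jt n * w n * avg w n
   - J n * avg w n * (- kap * la n * w n + e n)
   - J n * w n * (- kap * (la n * avg w n + comm n) + avg e n)
   + 4 * s ^+ 3 * s' * avg w n ^+ 2
   + 2 * s ^+ 4 * avg w n * (- kap * (la n * avg w n + comm n) + avg e n)
   - cdiff J n * avg w n ^+ 2
   - (J (n + 1) - 2 * J n + J (n - 1)) / 2 * cdiff w n * avg w n.
rewrite [leLHS](_ : _ = zsum L E); last first.
  have t1 := zsum_cdiff_self (suppS wK).
  have t2 := zsum_cdiff_self (supp_avg wK).
  have t3 := hypo_transport J.
  transitivity (zsum L E - 2 * zsum L (fun n => w n * cdiff w n)
    - 2 * s ^+ 4 * zsum L (fun n => avg w n * cdiff (avg w) n)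
    + (zsum L (fun n => J n * cdiff w n * avg w n + J n * w n * cdiff (avg w) n)
       + zsum L (fun n => cdiff J n * avg w n ^+ 2
     + (J (n + 1) - 2 * J n + J (n - 1)) / 2 * cdiff w n * avg w n))).
    rewrite -!zsumZ -!zsumN -!zsumD; apply: eq_zsum => n.
    rewrite avg_rhs /E /rhs; ring.
  by rewrite t1 t2 t3 addNr !mulr0 !subr0 addr0.
pose F n := kap * s ^+ 2 * (w n ^+ 2 / 2 + 3 / 2 * comm n ^+ 2 + cdiff w n ^+ 2 / 2
                     + 3 / 2 * (s ^+ 4 * avg w n ^+ 2))
    + 2 * (1 + s ^+ 4) * (eps * (w n ^+ 2 + avg w n ^+ 2)
                          + eps^-1 * (e n ^+ 2 + avg e n ^+ 2)).
apply: (@le_trans _ _ (zsum L F)).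
  by apply: ler_zsum => n; apply: (hypo_pointwise (m := `|n%:~R|) (rho := rho)).
have -> : zsum L F = kap * s ^+ 2 * (nsq w / 2 + 3 / 2 * nsq comm + nsq (cdiff w) / 2
    + 3 / 2 * (s ^+ 4 * nsq (avg w)))
    + 2 * (1 + s ^+ 4) * (eps * (nsq w + nsq (avg w))
                          + eps^-1 * (nsq e + nsq (avg e))).
  rewrite ![_ / 2 in RHS]mulrC -!(zsumZ, zsumD); apply: eq_zsum => n.
  by rewrite /F; field; rewrite gt_eqF.
have h1 := comm_le; have h2 := zsum_cdiff_le (suppS wK).
have h3 := zsum_avg_le (suppS wK); have h4 := zsum_avg_le eK.
have w0 : 0 <= nsq w by apply: zsum_ge0 => n; exact: sqr_ge0.
have y0 : 0 <= nsq (avg w) by apply: zsum_ge0 => n; exact: sqr_ge0.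
have s40 : 0 <= s ^+ 4 by rewrite exprn_ge0.
set W := nsq w in h1 h2 h3 w0 *; set Y := nsq (avg w) in h3 y0 *.
have sY : 0 <= s ^+ 4 * Y by rewrite mulr_ge0.
apply: lerD.
  have -> : 3 * kap * s ^+ 2 * (W + s ^+ 4 * Y) =
    kap * s ^+ 2 * (3 * (W + s ^+ 4 * Y)) by ring.
  by rewrite ler_wpM2l ?mulr_ge0 ?sqr_ge0 //; rewrite -/L in h1 h2 *; lra.
have -> : 4 * eps * (1 + s ^+ 4) * (W + 1) = 2 * (1 + s ^+ 4) * (2 * eps * (W + 1)) by ring.
rewrite ler_wpM2l; [|lra|].
  by [].
have hE : eps^-1 * (nsq e + nsq (avg e)) <= 2 * eps.
  have -> : 2 * eps = eps^-1 * (2 * eps ^+ 2) by field; rewrite gt_eqF.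
  by rewrite ler_pM2l ?invr_gt0 //; rewrite -/L in h4 *; lra.
have hW : eps * (W + Y) <= eps * (2 * W) by rewrite ler_pM2l //; lra.
lra.
Qed.

End Static.

(** * Gronwall inequality and the time derivative of the functional *)

Section Calculus.
Context {R : realType}.
Implicit Types (f g : R -> R) (x a b : R).

Lemma derD f g x a b : is_derive x 1 f a -> is_derive x 1 g b ->
  is_derive x 1 (fun t => f t + g t) (a + b).
Proof. exact: is_deriveD. Qed.

Lemma derN f x a : is_derive x 1 f a -> is_derive x 1 (fun t => - f t) (- a).
Proof. exact: is_deriveN. Qed.

Lemma derM f g x a b : is_derive x 1 f a -> is_derive x 1 g b ->
  is_derive x 1 (fun t => f t * g t) (a * g x + f x * b).
Proof.
move=> fa gb; apply: is_derive_eq (is_deriveM fa gb) _.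
by rewrite addrC mulrC.
Qed.

Lemma contD f g x : {for x, continuous f} -> {for x, continuous g} ->
  {for x, continuous (fun t => f t + g t)}.
Proof. exact: continuousD. Qed.

Lemma contN f x : {for x, continuous f} -> {for x, continuous (fun t => - f t)}.
Proof. exact: continuousN. Qed.

Lemma contM f g x : {for x, continuous f} -> {for x, continuous g} ->
  {for x, continuous (fun t => f t * g t)}.
Proof. exact: continuousM. Qed.

Lemma derX2 f x a : is_derive x 1 f a ->
  is_derive x 1 (fun t => f t ^+ 2) (2 * f x * a).
Proof. by move=> h; apply: (is_derive_eq (derM h h)); ring. Qed.

Lemma contX2 f x : {for x, continuous f} -> {for x, continuous (fun t => f t ^+ 2)}.
Proof. by move=> h; exact: (contM h h). Qed.

Lemma cont_der f x a : is_derive x 1 f a -> {for x, continuous f}.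
Proof.
by case=> df _; apply: differentiable_continuous; apply/derivable1_diffP.
Qed.

Lemma der_zsum K (F : R -> int -> R) x (dF : int -> R) :
  (forall n, is_derive x 1 (F^~ n) (dF n)) ->
  is_derive x 1 (fun t => zsum K (F t)) (zsum K dF).
Proof.
move=> FdF; rewrite /zsum.
rewrite (_ : (fun t => _) = \sum_(i < K.*2.+1) (F^~ (i%:Z - K%:Z))).
  by apply: is_derive_sum => i; exact: FdF.
by apply/funext => t; rewrite fct_sumE.
Qed.

Lemma cvg_zsum K (F : R -> int -> R) x :
  (forall n, {for x, continuous (F^~ n)}) ->
  {for x, continuous (fun t => zsum K (F t))}.
Proof.
move=> FdF; rewrite /zsum.
rewrite (_ : (fun t => _) = \sum_(i < K.*2.+1) (F^~ (i%:Z - K%:Z))).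
  elim/big_ind : _ => [|f g fc gc|i _]; last exact: FdF.
    exact: cst_continuous.
  exact: continuousD.
by apply/funext => t; rewrite fct_sumE.
Qed.

(** The second term of the bound is crude on purpose: for every sign of A it is a
multiple of B, and only its vanishing with B matters. *)
Lemma gronwall f (df : R -> R) a b (A B : R) : a <= b -> 0 <= B ->
  (forall x, a <= x <= b -> {for x, continuous f}) ->
  (forall x, a < x < b -> is_derive x 1 f (df x) /\ df x <= A * f x + B) ->
  f b <= expR (A * (b - a)) * f a + expR (2 * `|A| * (b - a)) * (b - a) * B.
Proof.
move=> ab B0 fc fd.
pose E t := expR (- A * (t - a)).
pose D := expR (`|A| * (b - a)) * B.
(* The function to which the mean value theorem applies: E is the integrating
   factor and D bounds the contribution of B. *)
pose g t := E t * f t + - (D * (t - a)).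
have dE x : is_derive x 1 E (- A * E x).
  have h : is_derive x 1 (fun t : R => - A * (t - a)) (- A).
    have := derM (is_derive_cst (- A) x 1) (derD (is_derive_id x 1) (is_derive_cst (- a) x 1)).
    by move/is_derive_eq; apply; rewrite mul0r add0r addr0 mulr1.
  have := @is_derive1_comp R expR (fun t : R => - A * (t - a)) x _ _ (is_derive_expR _) h.
  by move/is_derive_eq; apply; rewrite mulrC.
have dg x : a < x < b -> is_derive x 1 g (- A * E x * f x + E x * df x - D).
  move=> xab; have [fdx _] := fd x xab.
  have := derD (derM (dE x) fdx) (derN (derM (is_derive_cst D x 1)
     (derD (is_derive_id x 1) (is_derive_cst (- a) x 1)))).
  by move/is_derive_eq; apply; rewrite mul0r add0r addr0 mulr1.
have Dge x : a < x < b -> E x * B <= D.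
  move=> /andP[ax xb]; rewrite /D /E ler_wpM2r // ler_expR.
  apply: le_trans (ler_norm _) _; rewrite normrM normrN ler_wpM2l //.
  by rewrite ger0_norm; lra.
have gab : g b <= g a.
  move: ab; rewrite le_eqVlt => /predU1P[->//|ab].
  have dg' x : x \in `]a, b[%R ->
      is_derive x 1 g (- A * E x * f x + E x * df x - D).
    by rewrite in_itv /= => /dg.
  have cg : {within `[a, b], continuous g}.
    apply: continuous_in_subspaceT => x; rewrite inE /= in_itv /= => xab.
    apply: (contD (contM (cont_der (dE x)) (fc x xab))).
    apply: contN; apply: contM; first exact: cst_continuous.
    by apply: contD; [exact: cvg_id|exact: cst_continuous].
  have [c cab gc] := MVT ab dg' cg.
  have {}cab : a < c < b by move: cab; rewrite in_itv.
  have [_ dfc] := fd c cab; have := Dge c cab.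
  have E0 : 0 < E c by rewrite expR_gt0.
  have := ler_wpM2l (ltW E0) dfc.
  move=> h1 h2; rewrite -subr_le0 gc mulr_le0_ge0 //; last by lra.
  lra.
have {gab} : E b * f b <= f a + D * (b - a).
  by move: gab; rewrite /g /E subrr !mulr0 expR0 subr0 mul1r; lra.
rewrite /E mulNr expRN => h.
have e0 : 0 < expR (A * (b - a)) by rewrite expR_gt0.
move: h; rewrite mulrC ler_pdivrMr // => /le_trans -> //.
rewrite mulrDl mulrC lerD2l.
have e1 : expR (A * (b - a)) <= expR (`|A| * (b - a)).
  by rewrite ler_expR ler_wpM2r ?subr_ge0 // ler_norm.
have -> : 2 * `|A| * (b - a) = `|A| * (b - a) + `|A| * (b - a) by lra.
rewrite /D expRD; have ba : 0 <= (b - a) * B by rewrite mulr_ge0 ?subr_ge0.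
have := ler_wpM2l (mulr_ge0 (expR_ge0 (`|A| * (b - a))) ba) e1; lra.
Qed.

End Calculus.

Section Functional.
Context {R : realType}.
Variable (K : nat).
Let L := K.+1.
Implicit Types (w : R -> int -> R) (s : R -> R) (J : R -> int -> R).

(** Hypocoercive functional: the cross term with the multiplier J sees the
transport, the last square keeps the sum equivalent to the energies of w and
of its average as long as |J| <= s ^ 2. *)
Definition Phi s J w (t : R) : R := zsum L (fun n => w t n ^+ 2
  - J t n * w t n * avg (w t) n + s t ^+ 4 * avg (w t) n ^+ 2).

Lemma der_avg w (t : R) (w' : int -> R) : (forall n, is_derive t 1 (w^~ n) (w' n)) ->
  forall n, is_derive t 1 (fun t => avg (w t) n) (avg w' n).
Proof.
move=> dw n; have := derM (derD (dw (n + 1)) (dw (n - 1))) (is_derive_cst (2^-1 : R) t 1).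
by move/is_derive_eq; apply; rewrite mulr0 addr0.
Qed.

Lemma der_Phi s J w (t : R) (s' : R) (Jt w' : int -> R) :
  is_derive t 1 s s' -> (forall n, is_derive t 1 (J^~ n) (Jt n)) ->
  (forall n, is_derive t 1 (w^~ n) (w' n)) ->
  is_derive t 1 (Phi s J w) (zsum L (fun n =>
    2 * w t n * w' n - Jt n * w t n * avg (w t) n - J t n * w' n * avg (w t) n
    - J t n * w t n * avg w' n + 4 * s t ^+ 3 * s' * avg (w t) n ^+ 2
    + 2 * s t ^+ 4 * avg (w t) n * avg w' n)).
Proof.
move=> ds dJ dw; apply: der_zsum => n.
have dy := der_avg dw n; have dx := dw n.
have h : is_derive t 1 (fun t => w t n * w t n - J t n * w t n * avg (w t) n
    + s t * s t * (s t * s t) * (avg (w t) n * avg (w t) n)) _ :=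
  derD (derD (derM dx dx) (derN (derM (derM (dJ n) dx) dy)))
    (derM (derM (derM ds ds) (derM ds ds)) (derM dy dy)).
rewrite (_ : (fun _ => _) = (fun t => w t n * w t n - J t n * w t n * avg (w t) n
    + s t * s t * (s t * s t) * (avg (w t) n * avg (w t) n))); last first.
  by apply/funext => u; ring.
apply: (is_derive_eq h); ring.
Qed.

Lemma cvg_Phi s J w (t : R) :
  {for t, continuous s} -> (forall n, {for t, continuous (J^~ n)}) ->
  (forall n, {for t, continuous (w^~ n)}) ->
  {for t, continuous (Phi s J w)}.
Proof.
move=> cs cJ cw; apply: cvg_zsum => n.
have cy : {for t, continuous (fun t => avg (w t) n)}.
  apply: contM; last exact: cst_continuous.
  by apply: contD; exact: cw.
have cX k (f : R -> R) : {for t, continuous f} -> {for t, continuous (fun t : R => f t ^+ k : R)}.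
  move=> cf; elim: k => [|k IH]; first exact: cst_continuous.
  rewrite (_ : (fun t => f t ^+ k.+1) = (fun t => f t * f t ^+ k)).
    exact: contM cf IH.
  by apply/funext => u; rewrite exprS.
apply: contD.
  apply: contD; first exact: cX.
  by apply: contN; apply: contM => //; apply: contM; [exact: cJ|exact: cw].
by apply: contM; exact: cX.
Qed.

End Functional.

(** * Contraction on a time interval of length 33 / mu ^ 4 *)

Definition nsq {R : realType} (K : nat) (f : int -> R) : R :=
  zsum K.+1 (fun n => f n ^+ 2).

Lemma nsq_ge0 {R : realType} K (f : int -> R) : 0 <= nsq K f.
Proof. by apply: zsum_ge0 => n; exact: sqr_ge0. Qed.

(** Solutions supported in |n| < K, up to a source of size eps.  This is what a
cut-off at frequency K leaves of a solution. *)
Record approx_sol {R : realType} (K : nat) (kap : R) (la : int -> R)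
    (eps B T : R) (w e : R -> int -> R) : Prop := ApproxSol {
  as_supp : forall t, supp K (w t);
  as_supp_src : forall t, supp K.+1 (e t);
  as_cont : forall t n, 0 <= t <= T -> {for t, continuous (w^~ n)};
  as_der : forall t n, 0 < t < T ->
    is_derive t 1 (w^~ n) (rhs kap la (w t) (e t) n);
  as_src : forall t, 0 <= t <= T -> nsq K (e t) <= eps ^+ 2;
  as_bnd : forall t, 0 <= t <= T -> nsq K (w t) <= B }.

Section Phases.
Context {R : realType}.
Variables (K : nat) (kap : R) (la : int -> R) (eps B T : R) (w e : R -> int -> R).
Hypotheses (kap0 : 0 <= kap) (la_ge : forall n, `|n%:~R| <= la n)
  (la_lip : forall n, `|la (n + 1) - la n| <= 1) (eps0 : 0 < eps) (B0 : 0 <= B).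
Hypothesis sol : approx_sol K kap la eps B T w e.

Lemma Phi_ge (s : R -> R) (J : R -> int -> R) (t : R) :
  (forall n, `|J t n| <= s t ^+ 2) ->
  nsq K (w t) + s t ^+ 4 * nsq K (avg (w t)) <= 2 * Phi K s J w t.
Proof.
move=> Js; rewrite /nsq /Phi -!zsumZ -zsumD; apply: ler_zsum => n.
have s4 : 0 <= s t ^+ 4 by rewrite (exprM _ 2 2) sqr_ge0.
have := @ler_mul_amgm R 1 (s t ^+ 4) (- J t n) (w t n) (avg (w t) n) ler01 s4.
have -> : (- J t n) ^+ 2 <= 1 * s t ^+ 4.
  rewrite mul1r sqrrN (exprM _ 2 2) -(real_normK (num_real (J t n))).
  by rewrite ler_sqr ?nnegrE ?sqr_ge0.
move=> /(_ isT); lra.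
Qed.

(** Gronwall's inequality for the functional, for arbitrary weights s and J that
meet the three structural conditions of the last hypothesis. *)
Lemma hypo_growth (s s' rho : R -> R) (J Jt : R -> int -> R) (a b M smax : R) :
  0 <= a -> a <= b -> b <= T -> 0 <= M ->
  (forall t, a <= t <= b -> [/\ 0 <= s t, s t <= smax, {for t, continuous s},
     (forall n, {for t, continuous (J^~ n)}) & forall n, `|J t n| <= s t ^+ 2]) ->
  (forall t, a < t < b -> [/\ is_derive t 1 s (s' t),
     forall n, is_derive t 1 (J^~ n) (Jt t n), 0 <= rho t & kap * s t ^+ 2 <= M]) ->
  (forall t n, a < t < b ->
    [/\ Jt t n ^+ 2 <= kap * `|n%:~R| * rho t,
        `|J t (n + 1) - 2 * J t n + J t (n - 1)| <= 2 * kap * s t ^+ 4 &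
        4 * s t ^+ 3 * s' t + rho t / 2
          <= cdiff (J t) n + kap * s t ^+ 4 * `|n%:~R|]) ->
  Phi K s J w b <= expR (6 * M * (b - a)) * Phi K s J w a +
    expR (12 * M * (b - a)) * (b - a) * (4 * eps * (1 + smax ^+ 4) * (B + 1)).
Proof.
move=> a0 ab bT M0 Hs Hd HJ.
have sm0 : 0 <= smax.
  by have [|h1 h2 _ _ _] := Hs a; [rewrite lexx|exact: le_trans h1 h2].
pose dP t := zsum K.+1 (fun n =>
    2 * w t n * rhs kap la (w t) (e t) n - Jt t n * w t n * avg (w t) n
    - J t n * rhs kap la (w t) (e t) n * avg (w t) n
    - J t n * w t n * avg (rhs kap la (w t) (e t)) n
    + 4 * s t ^+ 3 * s' t * avg (w t) n ^+ 2
    + 2 * s t ^+ 4 * avg (w t) n * avg (rhs kap la (w t) (e t)) n).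
apply: le_trans (@gronwall R (Phi K s J w) dP a b (6 * M)
  (4 * eps * (1 + smax ^+ 4) * (B + 1)) ab _ _ _) _ => [|t tab|t tab|].
- by rewrite !mulr_ge0 ?addr_ge0 ?exprn_ge0 // ltW.
- have [_ _ cs cJ _] := Hs t tab; apply: cvg_Phi => // n.
  by apply: (as_cont sol); lra.
- have [ds dJ rho0 kM] := Hd t tab.
  have tab' : a <= t <= b by lra.
  have tT : 0 < t < T by lra.
  have tT' : 0 <= t <= T by lra.
  have [s0 sm _ _ Js] := Hs t tab'.
  split; first by apply: der_Phi => // n; exact: (as_der sol).
  apply: le_trans (hypo_static kap0 la_ge la_lip (as_supp sol t)
    (as_supp_src sol t) s0 rho0 eps0 Js _ _ _ (as_src sol tT')) _.
  + by move=> n; have [] := HJ t n tab.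
  + by move=> n; have [] := HJ t n tab.
  + by move=> n; have [] := HJ t n tab.
  apply: lerD.
    have h1 := Phi_ge Js; have h0 : 0 <= nsq K (w t) + s t ^+ 4 * nsq K (avg (w t)).
      by rewrite addr_ge0 ?nsq_ge0 // mulr_ge0 ?nsq_ge0 // exprn_ge0.
    have h2 := ler_wpM2r h0 kM; have h3 := ler_wpM2l M0 h1.
    rewrite -/(nsq K (w t)) -/(nsq K (avg (w t))); lra.
  have h4 : s t ^+ 4 <= smax ^+ 4 by rewrite lerXn2r ?nnegrE.
  have s4 : 0 <= s t ^+ 4 by rewrite exprn_ge0.
  apply: ler_pM; [| |apply: ler_wpM2l|rewrite lerD2r; exact: (as_bnd sol)].
  + by rewrite mulr_ge0 ?addr_ge0 // mulr_ge0 // ltW.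
  + by rewrite addr_ge0 // nsq_ge0.
  + by rewrite mulr_ge0 // ltW.
  + by rewrite lerD2l.
- by rewrite ger0_norm ?mulr_ge0 // (_ : 2 * (6 * M) = 12 * M)//; lra.
Qed.

(** The case J = 0, s = 0 of the growth estimate: the energy cannot increase but
for the source. *)
Lemma energy_growth (a b : R) : 0 <= a -> a <= b -> b <= T ->
  nsq K (w b) <= nsq K (w a) + (b - a) * (4 * eps * (B + 1)).
Proof.
move=> a0 ab bT.
have E t : Phi K (fun=> 0) (fun _ _ => 0) w t = nsq K (w t).
  by apply: eq_zsum => n; rewrite !mul0r subr0 expr0n /= mul0r addr0.
rewrite -!E.
have := @hypo_growth (fun=> 0) (fun=> 0) (fun=> 0) (fun _ _ => 0) (fun _ _ => 0)
  a b 0 0 a0 ab bT (lexx 0).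
move=> H; apply: le_trans (H _ _ _) _.
- move=> t tab; split => //; first exact: cst_continuous.
    by move=> n; exact: cst_continuous.
  by move=> n; rewrite normr0 expr0n.
- move=> t tab; split => //; first exact: is_derive_cst.
    by move=> n; exact: is_derive_cst.
  by rewrite expr0n mulr0.
- move=> t n tab; split.
  + by rewrite expr0n mulr0.
  + by rewrite !(mulr0, subr0, addr0) normr0 expr0n mulr0.
  + by rewrite /cdiff !(mulr0, mul0r, subr0, addr0) expr0n /= mulr0 !mul0r.
- by rewrite !mulr0 !mul0r expR0 !mul1r expr0n /= addr0 mulr1.
Qed.

End Phases.

Section ThreePhases.
Context {R : realType}.
Variables (K : nat) (mu : R) (la : int -> R) (eps B T : R) (w e : R -> int -> R).
Hypotheses (mu0 : 0 < mu) (mu1 : mu <= 1) (la_ge : forall n, `|n%:~R| <= la n)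
  (la_lip : forall n, `|la (n + 1) - la n| <= 1) (eps0 : 0 < eps) (B0 : 0 <= B).
Hypothesis sol : approx_sol K (mu ^+ 6) la eps B T w e.

Let kap0 : 0 <= mu ^+ 6. Proof. by rewrite exprn_ge0 // ltW. Qed.

Let T1 : R := 32 / mu ^+ 4.
Let err : R := 4 * eps * (1 + (mu^-1) ^+ 4) * (B + 1).

(** At time 0 the functional is just the energy of w, while at the end it controls the
average with the weight mu^(-4).  The growth rate 6 kap s ^ 2 is at most 6 mu ^ 4, and
the phase lasts 32 / mu ^ 4, whence the exponent 192. *)
Lemma growing_phase : T1 <= T ->
  nsq K (w T1) + (mu^-1) ^+ 4 * nsq K (avg (w T1)) <=
  2 * (expR 192 * nsq K (w 0) + expR 384 * T1 * err).
Proof.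
move=> T1T.
pose k := mu ^+ 3; have k0 : 0 < k by rewrite exprn_gt0.
(* The slope k / 32 makes the growth 4 s ^ 3 s' of the last weight equal to
   k s ^ 3 / 8, half of the gain k s ^ 3 / 4 given by the commutator; rho, the
   share of J moving in time, uses another 9 / 2048. *)
pose s (t : R) := k / 32 * t.
pose J (t : R) (n : int) := s t ^+ 3 * k * sat (k * s t) n.
pose rho (t : R) := 9 / 1024 * k * s t ^+ 3.
pose Jt (t : R) (n : int) := k * n%:~R * (k / 32) * s t ^+ 2
  * (3 + 2 * (k * s t * `|n%:~R|)) / (1 + k * s t * `|n%:~R|) ^+ 2.
have mun0 : mu != 0 by rewrite gt_eqF.
have T10 : 0 <= T1 by rewrite divr_ge0 // exprn_ge0 // ltW.
have sT1 : s T1 = mu^-1 by rewrite /s /k /T1; field; rewrite mun0.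
have s_ge0 t : 0 <= t -> 0 <= s t by move=> t0; rewrite !mulr_ge0 // ltW.
have s_le t : t <= T1 -> s t <= mu^-1.
  by rewrite -sT1 => tT; rewrite ler_wpM2l // divr_ge0 // ltW.
have ks_le1 t : t <= T1 -> k * s t <= 1.
  move=> /s_le /(ler_wpM2l (ltW k0)) /le_trans; apply.
  rewrite /k exprSr mulfK // exprn_ile1 // ltW //.
have ks_ge0 t : 0 <= t -> 0 <= k * s t by move=> t0; rewrite mulr_ge0 ?s_ge0 // ltW.
have kapE : mu ^+ 6 = k ^+ 2 by rewrite /k -exprM.
have ds (t : R) : is_derive t 1 s (k / 32).
  have := derM (is_derive_cst (k / 32) t 1) (is_derive_id t 1).
  by move/is_derive_eq; apply; rewrite mul0r add0r mulr1.
have dJ (t : R) n : 0 <= t -> is_derive t 1 (J^~ n) (Jt t n).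
  move=> t0.
  pose D (t : R) := 1 + k * s t * `|n%:~R|.
  have Dgt0 : 0 < D t by apply: sat_den_gt0; exact: ks_ge0.
  have dD : is_derive t 1 D (k * (k / 32) * `|n%:~R|).
    have := derD (is_derive_cst (1 : R) t 1) (derM (derM (is_derive_cst k t 1) (ds t))
      (is_derive_cst (`|n%:~R| : R) t 1)).
    by move/is_derive_eq; apply; rewrite mul0r mulr0 !(add0r, addr0).
  have dV : is_derive t 1 (fun t => (D t)^-1) (- (D t) ^- 2 * (k * (k / 32) * `|n%:~R|)).
    have := is_deriveV (lt0r_neq0 Dgt0) dD.
    by move/is_derive_eq; apply; rewrite mulrC.
  have h : is_derive t 1 (fun t => s t * (s t * s t) * k * (n%:~R * (D t)^-1)) _ :=
    derM (derM (derM (ds t) (derM (ds t) (ds t))) (is_derive_cst k t 1))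
    (derM (is_derive_cst (n%:~R : R) t 1) dV).
  rewrite (_ : J^~ n = (fun t => s t * (s t * s t) * k * (n%:~R * (D t)^-1))).
    apply: (is_derive_eq h); rewrite /Jt -/(D t).
    have Dn0 : D t != 0 by rewrite gt_eqF.
    have E : k * s t * `|n%:~R| = D t - 1 by rewrite /D; ring.
    rewrite /cst; transitivity (s t ^+ 2 * k * n%:~R * (k / 32) *
      (3 / D t - (k * s t * `|n%:~R|) / D t ^+ 2)); first by field; rewrite Dn0.
    by rewrite E; field; rewrite Dn0.
  by apply/funext => u; rewrite /J /sat -/(D u); ring.
have rho_ge0 (t : R) : 0 <= t -> 0 <= rho t.
  move=> t0; apply: mulr_ge0; last by apply: exprn_ge0; exact: s_ge0.
  by apply: mulr_ge0; [lra|exact: ltW].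
have cs (t : R) : {for t, continuous s} := cont_der (ds t).
have Jle t n : 0 <= t -> `|J t n| <= s t ^+ 2.
  move=> t0; have := sat_norm n (ks_ge0 t t0).
  move=> /(ler_wpM2l (sqr_ge0 (s t))); rewrite mulr1; apply: le_trans.
  rewrite /J normrM [X in X * _]normrM (ger0_norm (exprn_ge0 3 (s_ge0 t t0))) (gtr0_norm k0).
  rewrite le_eqVlt; apply/orP; left; apply/eqP; ring.
have := @hypo_growth R K (mu ^+ 6) la eps B T w e kap0 la_ge la_lip eps0 B0 sol
  s (fun=> k / 32) rho J Jt 0 T1 (mu ^+ 4) (mu^-1) (lexx 0) T10 T1T.
have -> : 6 * mu ^+ 4 * (T1 - 0) = 192 by rewrite /T1; field; rewrite mun0.
have -> : 12 * mu ^+ 4 * (T1 - 0) = 384 by rewrite /T1; field; rewrite mun0.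
rewrite subr0 -/err => /(_ (exprn_ge0 _ (ltW mu0))) H.
have JT n : `|J T1 n| <= s T1 ^+ 2 by exact: Jle.
have := Phi_ge K w JT; rewrite sT1 => /le_trans; apply.
rewrite ler_pM2l //.
have <- : Phi K s J w 0 = nsq K (w 0).
  apply: eq_zsum => n; rewrite /J /s !mulr0 !expr0n /=; ring.
apply: H.
- move=> t /andP[t0 tT]; split => //; [exact: s_ge0|exact: s_le| |].
    by move=> n; exact: cont_der (dJ t n t0).
  by move=> n; exact: Jle.
- move=> t /andP[/ltW t0 /ltW tT]; split.
  + exact: ds.
  + by move=> n; exact: dJ.
  + exact: rho_ge0.
  + have : s t ^+ 2 <= (mu^-1) ^+ 2 by rewrite lerXn2r ?nnegrE ?s_ge0 ?invr_ge0 ?s_le // ltW.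
    move/(ler_wpM2l kap0)/le_trans; apply.
    by rewrite exprVn (exprD _ 4 2) mulfK // expf_neq0.
- move=> t n /andP[/ltW t0 /ltW tT]; split.
  + set z := k * s t * `|n%:~R|; have z0 : 0 <= z by rewrite mulr_ge0 ?ks_ge0.
    have z1 : 1 + z != 0 by rewrite gt_eqF // ltr_wpDr.
    (* The time derivative of J is measured by rho, with a quotient q <= 1 that
     depends on z = k s |n| only. *)
    pose q := z * (3 + 2 * z) ^+ 2 / (9 * (1 + z) ^+ 4).
    have -> : Jt t n ^+ 2 = mu ^+ 6 * `|n%:~R| * rho t * q.
      transitivity (k ^+ 2 * n%:~R ^+ 2 * (k / 32) ^+ 2 * s t ^+ 4 * (3 + 2 * z) ^+ 2
        / (1 + z) ^+ 4); first by rewrite /Jt -/z; field; rewrite z1.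
      rewrite -(real_normK (num_real (n%:~R : R))) kapE /rho /q.
      transitivity (k ^+ 3 / 1024 * `|n%:~R| * s t ^+ 3 * (k * s t * `|n%:~R|)
        * (3 + 2 * z) ^+ 2 / (1 + z) ^+ 4); first by field; rewrite z1.
      by rewrite -/z; field; rewrite z1.
    rewrite ler_piMr //.
      apply: mulr_ge0; last exact: rho_ge0.
      by apply: mulr_ge0.
    rewrite ler_pdivrMr ?mul1r; last by rewrite mulr_gt0 // exprn_gt0 // ltr_wpDr.
    have z2 : 0 <= z ^+ 2 by rewrite exprn_ge0.
    have z3 : 0 <= z ^+ 3 by rewrite exprn_ge0.
    have z4 : 0 <= z ^+ 4 by rewrite exprn_ge0.
    lra.
  + have := sat_diff2 n (ks_ge0 t t0) (ks_le1 t tT).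
    have p0 : 0 <= s t ^+ 3 * k by rewrite mulr_ge0 ?exprn_ge0 ?s_ge0 // ltW.
    move=> /(ler_wpM2l p0).
    have -> : s t ^+ 3 * k * (2 * (k * s t)) = 2 * mu ^+ 6 * s t ^+ 4 by rewrite kapE; ring.
    apply: le_trans; rewrite (_ : J t (n + 1) - _ + _ = s t ^+ 3 * k *
      (sat (k * s t) (n + 1) - 2 * sat (k * s t) n + sat (k * s t) (n - 1))).
      by rewrite normrM (ger0_norm p0).
    by rewrite /J; ring.
  + have := sat_cdiff n (ks_ge0 t t0) (ks_le1 t tT).
    have p0 : 0 <= s t ^+ 3 * k by rewrite mulr_ge0 ?exprn_ge0 ?s_ge0 // ltW.
    move=> /(ler_wpM2l p0).
    have -> : s t ^+ 3 * k * (cdiff (sat (k * s t)) n + k * s t * `|n%:~R|) =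
      cdiff (J t) n + mu ^+ 6 * s t ^+ 4 * `|n%:~R|.
      by rewrite kapE /cdiff /J; field.
    apply: le_trans; rewrite /rho.
    have -> : 4 * s t ^+ 3 * (k / 32) + 9 / 1024 * k * s t ^+ 3 / 2 =
      s t ^+ 3 * k * (1 / 8 + 9 / 2048) by field.
    by rewrite ler_wpM2l //; lra.
Qed.

(** With J = 0 and s constant the functional grows at the rate 6 mu ^ 4 at most, hence
by a bounded factor during the time mu^(-4). *)
Lemma plateau_phase (a b : R) : 0 <= a -> a <= b -> b <= T -> b - a <= (mu^-1) ^+ 4 ->
  nsq K (w b) + (mu^-1) ^+ 4 * nsq K (avg (w b)) <=
  expR 6 * (nsq K (w a) + (mu^-1) ^+ 4 * nsq K (avg (w a)))
   + expR 12 * (mu^-1) ^+ 4 * err.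
Proof.
move=> a0 ab bT bma.
have mun0 : mu != 0 by rewrite gt_eqF.
have muV0 : 0 <= mu^-1 by rewrite invr_ge0 ltW.
have E t : Phi K (fun=> mu^-1) (fun _ _ => 0) w t =
    nsq K (w t) + (mu^-1) ^+ 4 * nsq K (avg (w t)).
  rewrite /nsq -zsumZ -zsumD; apply: eq_zsum => n; ring.
rewrite -!E.
have H := @hypo_growth R K (mu ^+ 6) la eps B T w e kap0 la_ge la_lip eps0 B0 sol
  (fun=> mu^-1) (fun=> 0) (fun=> 0) (fun _ _ => 0) (fun _ _ => 0)
  a b (mu ^+ 4) (mu^-1) a0 ab bT (exprn_ge0 _ (ltW mu0)).
have m4 : mu ^+ 4 * (b - a) <= 1.
  have := ler_wpM2l (exprn_ge0 4 (ltW mu0)) bma.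
  by rewrite exprVn divff // expf_neq0.
apply: le_trans (H _ _ _) _.
- move=> t tab; split => //; first exact: cst_continuous.
    by move=> n; exact: cst_continuous.
  by move=> n; rewrite normr0 sqr_ge0.
- move=> t tab; split => //; first exact: is_derive_cst.
    by move=> n; exact: is_derive_cst.
  by rewrite exprVn (exprD _ 4 2) mulfK // expf_neq0.
- move=> t n tab; split.
  + by rewrite expr0n mulr0.
  + rewrite mulr0 subr0 addr0 normr0; apply: mulr_ge0; last exact: exprn_ge0.
    by apply: mulr_ge0.
  + rewrite /cdiff !(mulr0, mul0r, subr0, addr0) add0r mulr_ge0 //.
    by apply: mulr_ge0; [exact: kap0|exact: exprn_ge0].
have err0 : 0 <= err.
  rewrite /err; apply: mulr_ge0; last exact: addr_ge0.
  apply: mulr_ge0; first by apply: mulr_ge0; rewrite // ltW.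
  by apply: addr_ge0 => //; exact: exprn_ge0.
have P0 : 0 <= Phi K (fun=> mu^-1) (fun _ _ => 0) w a.
  by rewrite E addr_ge0 ?nsq_ge0 // mulr_ge0 ?nsq_ge0 // exprn_ge0.
apply: lerD; first by apply: ler_wpM2r => //; rewrite ler_expR; lra.
apply: ler_wpM2r => //; apply: ler_pM; rewrite ?expR_ge0 ?subr_ge0 // ler_expR; lra.
Qed.

Lemma der_nsq (t : R) : 0 < t < T -> is_derive t 1 (fun t => nsq K (w t))
  (zsum K.+1 (fun n => 2 * w t n * rhs (mu ^+ 6) la (w t) (e t) n)).
Proof.
move=> tT; apply: der_zsum => n; have dx := as_der sol n tT.
exact: derX2 dx.
Qed.

(** Uncertainty principle.  Testing the commutator of [sat] with sin y against w gives
the local mass, while the same quantity is bounded by the product of the norms of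
sat (at most N), of w, and of its average: if the latter is small, frequencies
below N carry little mass. *)
Lemma local_mass (t N : R) : 1 <= N ->
  N / 4 * nsq K (w t) - N ^+ 2 * (mu ^+ 2 * nsq K (w t) + (mu^-1) ^+ 2 * nsq K (avg (w t)))
  <= zsum K.+1 (fun n => `|n%:~R| * w t n ^+ 2).
Proof.
move=> N1; have N0 : 0 < N by apply: lt_le_trans N1.
have b0 : 0 <= N^-1 by rewrite invr_ge0 ltW.
have b1 : N^-1 <= 1 by rewrite invf_le1.
have wK := suppS (as_supp sol t).
have anti := zsum_cdiff_antisym (sat N^-1) (supp_sqr wK).
have h1 : zsum K.+1 (fun n => N / 4 * w t n ^+ 2 - `|n%:~R| * w t n ^+ 2)
    <= N * zsum K.+1 (fun n => cdiff (sat N^-1) n * w t n ^+ 2).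
  rewrite -zsumZ; apply: ler_zsum => n; rewrite -mulrBl mulrA ler_wpM2r ?sqr_ge0 //.
  have := ler_wpM2l (ltW N0) (sat_cdiff n b0 b1).
  by rewrite mulrDr (mulrA N N^-1) divff ?gt_eqF // mul1r; lra.
have h2 : - zsum K.+1 (fun n => sat N^-1 n * cdiff (fun n => w t n ^+ 2) n) <=
    N * (mu ^+ 2 * nsq K (cdiff (w t)) + (mu^-1) ^+ 2 * nsq K (avg (w t))).
  rewrite -zsumN /nsq -!zsumZ -zsumD -zsumZ; apply: ler_zsum => n.
  have m0 : 0 <= N * mu ^+ 2 by rewrite mulr_ge0 ?sqr_ge0 // ltW.
  have m1 : 0 <= N * (mu^-1) ^+ 2 by rewrite mulr_ge0 ?sqr_ge0 // ltW.
  have := @ler_mul_amgm R _ _ (sat N^-1 n) (cdiff (w t) n) (avg (w t) n) m0 m1 _.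
  have -> : N * mu ^+ 2 * (N * (mu^-1) ^+ 2) = N ^+ 2.
    by field; rewrite gt_eqF.
  have sN : `|sat N^-1 n| <= N.
    by have := sat_norm n b0; rewrite mulrC ler_pdivrMr // mul1r.
  rewrite -(real_normK (num_real (sat _ _))) ler_sqr ?nnegrE ?(ltW N0) //.
  move=> /(_ sN) h; rewrite /cdiff /avg in h *; lra.
have h3 := zsum_cdiff_le wK.
rewrite zsumD zsumN zsumZ in h1.
have h4 : mu ^+ 2 * nsq K (cdiff (w t)) <= mu ^+ 2 * nsq K (w t).
  by rewrite ler_wpM2l ?sqr_ge0.
rewrite anti opprK in h2.
have h5 := ler_wpM2l (ltW N0) (le_trans h2 (ler_wpM2l (ltW N0)
  (lerD h4 (lexx ((mu^-1) ^+ 2 * nsq K (avg (w t))))))).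
rewrite -/(nsq K (w t)) in h1; lra.
Qed.

(** The transport term is antisymmetric, so that only the damping and the source
contribute to the derivative of the energy. *)
Lemma energy_decay (t : R) : 0 <= t <= T ->
  zsum K.+1 (fun n => 2 * w t n * rhs (mu ^+ 6) la (w t) (e t) n) <=
  - (2 * mu ^+ 6) * zsum K.+1 (fun n => `|n%:~R| * w t n ^+ 2) + eps * (B + 1).
Proof.
move=> tT.
have t1 := zsum_cdiff_self (suppS (as_supp sol t)).
apply: (@le_trans _ _ (- (2 * mu ^+ 6) * zsum K.+1 (fun n => `|n%:~R| * w t n ^+ 2)
  - 2 * zsum K.+1 (fun n => w t n * cdiff (w t) n)
  + (eps * nsq K (w t) + eps^-1 * nsq K (e t)))).
  rewrite /nsq -!zsumZ -!zsumN -!zsumD; apply: ler_zsum => n.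
  have := ler_mul_eps 1 (w t n) (e t n) eps0.
  have := ler_wpM2l kap0 (ler_wpM2r (sqr_ge0 (w t n)) (la_ge n)).
  rewrite /rhs; lra.
rewrite t1 mulr0 subr0 lerD2l mulrDr mulr1 lerD //.
  by rewrite ler_pM2l //; exact: (as_bnd sol).
by rewrite mulrC ler_pdivrMr // -expr2; exact: (as_src sol).
Qed.

End ThreePhases.

Section Contraction.
Context {R : realType}.

Let C0 : R := 2 * expR 198.
(** Small enough for the loss N eta (1 + C0) of the uncertainty principle to be
negligible against its gain N / 4. *)
Definition eta : R := (16 * (1 + C0))^-1.
(** The energy above a quarter of its initial value decays by exp (- eta / 2) during the
plateau; hence this convex combination. *)
Definition contr : R := 1 / 4 + 3 / 4 * expR (- (eta / 2)).

Lemma eta_gt0 : 0 < eta.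
Proof. by rewrite invr_gt0 mulr_gt0 // addr_gt0 // mulr_gt0 // expR_gt0. Qed.

Lemma contr_lt1 : contr < 1.
Proof.
have : expR (- (eta / 2)) < 1 by rewrite expR_lt1 oppr_lt0 divr_gt0 ?eta_gt0.
rewrite /contr; lra.
Qed.

Lemma contr_gt0 : 0 < contr.
Proof. have := expR_gt0 (- (eta / 2)); rewrite /contr; lra. Qed.

(** Growing phase up to T1, then the plateau: on [T1, T] the average of w is of order
mu ^ 2 times w(0), and the dissipation is at least of order kap N = eta mu ^ 4. *)
Lemma contraction (mu B : R) : 0 < mu -> mu <= 1 -> mu ^+ 2 <= eta -> 0 <= B ->
  exists C : R, forall K (la : int -> R) (eps : R) (w e : R -> int -> R),
    (forall n, `|n%:~R| <= la n) -> (forall n, `|la (n + 1) - la n| <= 1) -> 0 < eps ->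
    approx_sol K (mu ^+ 6) la eps B (33 / mu ^+ 4) w e ->
    nsq K (w (33 / mu ^+ 4)) <= contr * nsq K (w 0) + C * eps.
Proof.
move=> mu0 mu1 mueta B0.
have mun0 : mu != 0 by rewrite gt_eqF.
have m40 : 0 < mu ^+ 4 by rewrite exprn_gt0.
pose E1 : R := 4 * (1 + (mu^-1) ^+ 4) * (B + 1).
pose T1 : R := 32 / mu ^+ 4; pose T : R := 33 / mu ^+ 4.
pose E2 : R := expR 6 * (2 * (expR 384 * T1 * E1)) + expR 12 * (mu^-1) ^+ 4 * E1.
pose E3 : R := T * (4 * (B + 1)).
(* N is the largest frequency below which the uncertainty principle forbids
   mass; E1, ..., E4 collect the contributions of the source. *)
pose N : R := eta / mu ^+ 2.
pose E4 : R := 2 * mu ^+ 6 * N * eta * (E2 + E3) + (B + 1).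
pose A : R := - (eta * mu ^+ 4 / 2).
exists (E3 * expR (- (eta / 2)) + expR (2 * `|A| * (T - T1)) * (T - T1) * E4).
move=> K la eps w e la_ge la_lip eps0 sol.
have T10 : 0 <= T1 by rewrite divr_ge0 // ltW.
have TT1 : T - T1 = (mu^-1) ^+ 4 by rewrite /T /T1 exprVn; field; rewrite mun0.
have m4V : 0 < (mu^-1) ^+ 4 by rewrite exprn_gt0 // invr_gt0.
have T1T : T1 <= T by lra.
set W0 := nsq K (w 0); have W00 : 0 <= W0 by exact: nsq_ge0.
have P1 := growing_phase mu0 mu1 la_ge la_lip eps0 B0 sol T1T.
rewrite -/T1 -/W0 in P1.
have Ybnd t : T1 <= t <= T -> nsq K (avg (w t)) <= mu ^+ 4 * (C0 * W0 + E2 * eps).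
  move=> /andP[t1 tT].
  have ht : t - T1 <= (mu^-1) ^+ 4 by lra.
  have P2 := plateau_phase mu0 la_ge la_lip eps0 B0 sol T10 t1 tT ht.
  have P12 := ler_wpM2l (expR_ge0 6) P1.
  have hC : expR 6 * expR 192 = expR 198 :> R by rewrite -expRD; congr expR; lra.
  have W0t := nsq_ge0 K (w t).
  have : (mu^-1) ^+ 4 * nsq K (avg (w t)) <= C0 * W0 + E2 * eps.
    rewrite /C0 -hC /E2 /E1; lra.
  by rewrite exprVn ler_pdivrMl.
have Wbnd t : 0 <= t <= T -> nsq K (w t) <= W0 + E3 * eps.
  move=> /andP[t0 tT].
  apply: le_trans (energy_growth (exprn_ge0 6 (ltW mu0)) la_ge la_lip eps0 B0 sol
    (lexx 0) t0 tT) _.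
  rewrite lerD2l /E3 subr0.
  have -> : T * (4 * (B + 1)) * eps = T * (4 * eps * (B + 1)) by ring.
  by rewrite ler_wpM2r // mulr_ge0 ?addr_ge0 // mulr_ge0 // ltW.
have eta0 := eta_gt0.
have N1 : 1 <= N by rewrite ler_pdivlMr ?exprn_gt0 // mul1r.
have etaE : eta * (1 + C0) = 1 / 16.
  rewrite /eta; field.
  by rewrite gt_eqF // addr_gt0 // mulr_gt0 // expR_gt0.
have Nmu : N ^+ 2 * mu ^+ 2 = N * eta by rewrite /N; field; rewrite mun0.
have kN : mu ^+ 6 * N = eta * mu ^+ 4 by rewrite /N; field; rewrite mun0.
(* Below a quarter of the initial energy nothing has to be proved; subtracting
   it turns the dissipation into a linear rate. *)
pose f t := nsq K (w t) - W0 / 4.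
pose df t := zsum K.+1 (fun n => 2 * w t n * rhs (mu ^+ 6) la (w t) (e t) n).
have dfle t : T1 <= t <= T -> df t <= A * f t + E4 * eps.
  move=> tT; have tT' : 0 <= t <= T by lra.
  have D := energy_decay mu0 la_ge eps0 sol tT'.
  have Lm := local_mass mu0 sol t N1.
  have hY := Ybnd t tT; have hW := Wbnd t tT'.
  have hY2 : N ^+ 2 * ((mu^-1) ^+ 2 * nsq K (avg (w t))) <= N * eta * (C0 * W0 + E2 * eps).
    rewrite -Nmu -(mulrA (N ^+ 2)); apply: ler_wpM2l; first exact: sqr_ge0.
    apply: le_trans (ler_wpM2l (sqr_ge0 mu^-1) hY) _.
    by rewrite le_eqVlt; apply/orP; left; apply/eqP; field; rewrite mun0.
  have hW2 : N ^+ 2 * (mu ^+ 2 * nsq K (w t)) <= N * eta * (W0 + E3 * eps).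
    by rewrite mulrA Nmu; apply: ler_wpM2l => //; apply: mulr_ge0; apply: ltW => //; exact: lt_le_trans N1.
  have k6 : 0 <= 2 * mu ^+ 6 by rewrite mulr_ge0 // exprn_ge0 // ltW.
  have Lm' : N / 4 * nsq K (w t) - (N * eta * (W0 + E3 * eps) + N * eta * (C0 * W0 + E2 * eps))
    <= zsum K.+1 (fun n => `|n%:~R| * w t n ^+ 2) by lra.
  have := ler_wpM2l k6 Lm'.
  have -> : N / 4 * nsq K (w t) - (N * eta * (W0 + E3 * eps) + N * eta * (C0 * W0 + E2 * eps))
    = N / 4 * nsq K (w t) - N * (eta * (1 + C0)) * W0 - N * eta * (E2 + E3) * eps by ring.
  rewrite etaE => hL.
  have -> : A * f t + E4 * eps = - (mu ^+ 6 * N / 2) * (nsq K (w t) - W0 / 4)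
     + (2 * mu ^+ 6 * N * eta * (E2 + E3) + (B + 1)) * eps by rewrite kN /A /f /E4; ring.
  rewrite /df; lra.
have E40 : 0 <= E4 * eps.
  have B1 : 0 <= B + 1 by rewrite addr_ge0.
  have T0 : 0 <= T by apply: le_trans T1T.
  have E10 : 0 <= E1.
    by apply: mulr_ge0 => //; apply: mulr_ge0 => //; apply: addr_ge0 => //; exact: ltW.
  have E20 : 0 <= E2.
    have p1 := mulr_ge0 (mulr_ge0 (expR_ge0 (384 : R)) T10) E10.
    have p2 := mulr_ge0 (expR_ge0 (6 : R)) (mulr_ge0 (ler0n R 2) p1).
    have p3 := mulr_ge0 (mulr_ge0 (expR_ge0 (12 : R)) (ltW m4V)) E10.
    exact: addr_ge0 p2 p3.
  have E30 : 0 <= E3 by apply: mulr_ge0 => //; apply: mulr_ge0.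
  apply: mulr_ge0; last exact: ltW.
  apply: addr_ge0 => //; apply: mulr_ge0; last exact: addr_ge0.
  apply: mulr_ge0; last exact: ltW.
  apply: mulr_ge0; last exact: le_trans N1.
  by apply: mulr_ge0 => //; apply: exprn_ge0; exact: ltW.
have cf t : T1 <= t <= T -> {for t, continuous f}.
  move=> tT; apply: contD; last exact: cst_continuous.
  apply: cvg_zsum => n; have tT' : 0 <= t <= T by lra.
  exact: (@contX2 R (w^~ n) t (as_cont sol tT')).
have G : f T <= expR (A * (T - T1)) * f T1 + expR (2 * `|A| * (T - T1)) * (T - T1) * (E4 * eps).
  apply: (@gronwall R f df) => // t tT.
  have tT2 : T1 <= t <= T by lra.
  split; last exact: dfle.
  have tT' : 0 < t < T by lra.
  by have := derD (der_nsq sol tT') (is_derive_cst (- (W0 / 4)) t 1); move/is_derive_eq; apply; rewrite addr0.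
have AT : A * (T - T1) = - (eta / 2) by rewrite TT1 /A; field; rewrite mun0.
rewrite AT in G.
have W1 := Wbnd T1; have := expR_ge0 (- (eta / 2)).
rewrite /contr -/W0 -/T; have {}W1 : nsq K (w T1) <= W0 + E3 * eps by apply: W1; lra.
move=> /ler_wpM2l /(_ _ _ W1); rewrite /f in G; lra.
Qed.

End Contraction.

(** * Passing from finitely supported sequences to square summable ones *)

Section Limits.
Context {R : realType}.
Implicit Types (f : int -> R) (K : nat).

Lemma nsq_le K1 K2 f : (K1 <= K2)%N -> nsq K1 f <= nsq K2 f.
Proof. by move=> h; apply: zsum_le => // n; exact: sqr_ge0. Qed.

Lemma le_limit (X Y D : R) N :
  (forall r : nat, (N < r)%N -> X <= Y + D / r%:R) -> X <= Y.
Proof.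
move=> h; rewrite leNgt; apply/negP => XY.
have d0 : 0 < X - Y by rewrite subr_gt0.
pose r := maxn N.+1 (Num.bound (`|D| / (X - Y))).+1.
have rN : (N < r)%N by rewrite /r; lia.
have r0 : 0 < r%:R :> R by rewrite ltr0n; lia.
have : `|D| / (X - Y) < r%:R.
  apply: lt_le_trans (archi_boundP _) _; first by rewrite divr_ge0 // ltW.
  by rewrite ler_nat /r; lia.
rewrite ltr_pdivrMr // => hr; have := h r rN; rewrite -lerBlDl ler_pdivlMr //.
by have := ler_norm D; lra.
Qed.
End Limits.

Section Cutoff.
Context {R : realType}.
Implicit Types (r : nat) (n : int) (v : R -> int -> R).

(** A Lipschitz cut-off: its commutator with the transport is of size 1 / r in l2,
whereas a sharp cut-off would leave an error of order 1. *)
Definition tent r n : R := if (`|n| <= r)%N then 1 - `|n|%:R / r%:R else 0.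

Lemma tent_supp r n : (0 < r)%N -> (r <= `|n|)%N -> tent r n = 0.
Proof.
move=> r0; rewrite /tent leq_eqVlt => /predU1P[<-|]; last by rewrite ltnNge => /negbTE ->.
by rewrite leqnn divff ?subrr // pnatr_eq0 -lt0n.
Qed.

Lemma tent_bnd r n : (0 < r)%N -> 0 <= tent r n <= 1.
Proof.
move=> r0; rewrite /tent; case: ifP => [nr|_]; last by rewrite lexx ler01.
have r0' : 0 < r%:R :> R by rewrite ltr0n.
rewrite subr_ge0 ler_pdivrMr // mul1r ler_nat nr /= lerBlDr lerDl.
by rewrite divr_ge0.
Qed.

Lemma tent_lip r n : (0 < r)%N -> `|tent r (n + 1) - tent r n| <= r%:R^-1.
Proof.
move=> r0; have r0' : 0 < r%:R :> R by rewrite ltr0n.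
have tE m : tent r m = (r - `|m|)%:R / r%:R.
  rewrite /tent; case: leqP => mr; last by rewrite (eqP (ltnW mr)) mul0r.
  by rewrite natrB // mulrBl divff // gt_eqF.
have ri0 : 0 <= r%:R^-1 :> R by rewrite invr_ge0.
rewrite !tE -mulrBl normrM (ger0_norm ri0) ler_piMl //.
have : ((r - `|(n + 1)%R|) <= (r - `|n|).+1)%N by lia.
have : ((r - `|n|) <= (r - `|(n + 1)%R|).+1)%N by lia.
rewrite -!(ler_nat R) -!natr1 ler_norml => h1 h2; apply/andP; split; lra.
Qed.

Definition cutoff r v (t : R) n : R := tent r n * v t n.
(** The commutator of the cut-off with [cdiff], the only term of the equation that
does not act diagonally on the frequencies. *)
Definition cutoff_src r v (t : R) n : R :=
  ((tent r (n + 1) - tent r n) * v t (n + 1) - (tent r (n - 1) - tent r n) * v t (n - 1)) / 2.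

(** The local bound expresses that the solution stays in l2. *)
Record seq_sol (kap : R) (la : int -> R) v : Prop := SeqSol {
  ss_cont : forall t n, 0 <= t -> {for t, continuous (v^~ n)};
  ss_der : forall (t : R) n, 0 < t ->
    is_derive t 1 (v^~ n) (- cdiff (v t) n - kap * la n * v t n);
  ss_bnd : forall T, exists B, forall t K, 0 <= t <= T -> nsq K (v t) <= B }.

Lemma cutoff_nsq_le r v (t : R) K : (0 < r)%N -> nsq K (cutoff r v t) <= nsq K (v t).
Proof.
move=> r0; apply: ler_zsum => n; rewrite /cutoff exprMn.
have /andP[h0 h1] := tent_bnd n r0.
by rewrite ler_piMl ?sqr_ge0 // exprn_ile1.
Qed.

Lemma cutoff_src_le r v (t B : R) : (0 < r)%N -> (forall K, nsq K (v t) <= B) ->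
  nsq r (cutoff_src r v t) <= ((B + 1) / r%:R) ^+ 2.
Proof.
move=> r0 vB; have r0' : 0 < r%:R :> R by rewrite ltr0n.
have B0 : 0 <= B by apply: le_trans (nsq_ge0 0 (v t)) (vB 0%N).
apply: (@le_trans _ _ ((r%:R^-1) ^+ 2 * B)); last first.
  by rewrite expr_div_n mulrC exprVn ler_wpM2r ?invr_ge0 ?exprn_ge0 ?ltW //; nra.
apply: (@le_trans _ _ ((r%:R^-1) ^+ 2 * nsq r.+1 (v t))); last first.
  by rewrite ler_wpM2l ?sqr_ge0.
have p0 n : 0 <= v t n ^+ 2 by exact: sqr_ge0.
have h1 := zsum_shiftD_le r.+1 p0; have h2 := zsum_shiftB_le r.+1 p0.
apply: (@le_trans _ _ ((r%:R^-1) ^+ 2 *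
   (2^-1 * (zsum r.+1 (fun n => v t (n + 1) ^+ 2) + zsum r.+1 (fun n => v t (n - 1) ^+ 2))))); last first.
  by rewrite ler_wpM2l ?sqr_ge0 // /nsq; lra.
rewrite -zsumD -!zsumZ; apply: ler_zsum => n; rewrite /cutoff_src.
set p := tent r (n + 1) - _; set q := tent r (n - 1) - _.
have sqle (x : R) : `|x| <= r%:R^-1 -> x ^+ 2 <= (r%:R^-1) ^+ 2.
  by move=> h; rewrite -(real_normK (num_real x)) ler_sqr ?nnegrE ?invr_ge0 // ltW.
have hp : p ^+ 2 <= (r%:R^-1) ^+ 2 by apply: sqle; exact: tent_lip.
have hq : q ^+ 2 <= (r%:R^-1) ^+ 2.
  by apply: sqle; rewrite /q distrC; have := tent_lip (n - 1) r0; rewrite subrK.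
set x := v t (n + 1); set y := v t (n - 1).
have hp' := ler_wpM2r (sqr_ge0 x) hp; have hq' := ler_wpM2r (sqr_ge0 y) hq.
have := sqr_ge0 (p * x + q * y); set c := _ ^+ 2 in hp' hq' *.
have -> : ((p * x - q * y) / 2) ^+ 2 = (p * x - q * y) ^+ 2 / 4 by field.
rewrite -!exprMn in hp' hq'; nra.
Qed.

Lemma cutoff_sol kap la v r (T B : R) : (0 < r)%N -> seq_sol kap la v ->
  (forall t K, 0 <= t <= T -> nsq K (v t) <= B) ->
  approx_sol r kap la ((B + 1) / r%:R) B T (cutoff r v) (cutoff_src r v).
Proof.
move=> r0 sol vB; split.
- by move=> t n rn; rewrite /cutoff tent_supp ?mul0r.
- move=> t n rn; rewrite /cutoff_src !tent_supp //; [|lia..].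
  by rewrite subrr !mul0r subr0 mul0r.
- move=> t n /andP[t0 _]; apply: contM; first exact: cst_continuous.
  exact: (ss_cont sol).
- move=> t n /andP[t0 _].
  have := derM (is_derive_cst (tent r n) t 1) (ss_der sol n t0).
  move/is_derive_eq; apply; rewrite mul0r add0r /rhs /cutoff /cutoff_src /cdiff /cst.
  by field.
- by move=> t tT; apply: cutoff_src_le => // K; exact: vB.
- by move=> t tT; apply: le_trans (cutoff_nsq_le _ _ _ r0) (vB _ _ tT).
Qed.

(** For fixed K the tent converges to 1 on |n| <= K + 1 at the rate 1 / r. *)
Lemma cutoff_limit v (t Y D : R) :
  (forall r, (0 < r)%N -> nsq r (cutoff r v t) <= Y + D / r%:R) ->
  forall K, nsq K (v t) <= Y.
Proof.
move=> h K; apply: (@le_limit _ _ _ (D + 2 * K.+1%:R * nsq K (v t)) K.+1) => r Kr.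
have r0 : (0 < r)%N by lia.
have r0' : 0 < r%:R :> R by rewrite ltr0n.
have hr := h r r0.
have : (1 - 2 * (K.+1%:R / r%:R)) * nsq K (v t) <= nsq r (cutoff r v t).
  apply: (@le_trans _ _ (nsq K (cutoff r v t))); last by apply: nsq_le; lia.
  rewrite /nsq -zsumZ; apply: ler_zsum_in => n nK; rewrite /cutoff exprMn.
  rewrite ler_wpM2r ?sqr_ge0 // /tent ifT; last by lia.
  have : (`|n|%N)%:R / r%:R <= K.+1%:R / r%:R :> R.
    by rewrite ler_pM2r ?invr_gt0 // ler_nat.
  have : 0 <= (`|n|%N)%:R / r%:R :> R by rewrite divr_ge0 // ltW.
  set x := _ / _; set y := _ / _ => x0 xy.
  have := sqr_ge0 x; nra.
move=> hK; have := le_trans hK hr; lra.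
Qed.

End Cutoff.

Section Decay.
Context {R : realType}.
Implicit Types (v : R -> int -> R).

Lemma seq_sol_shift kap la v (t0 : R) : 0 <= t0 -> seq_sol kap la v ->
  seq_sol kap la (fun t => v (t0 + t)).
Proof.
move=> t00 sol.
have dsh (t : R) : is_derive t 1 (fun t : R => t0 + t) 1.
  have := derD (is_derive_cst t0 t 1) (is_derive_id t 1).
  by move/is_derive_eq; apply; rewrite add0r.
split.
- move=> t n t1.
  have c : {for t0 + t, continuous (v^~ n)} := ss_cont sol (addr_ge0 t00 t1).
  exact: (continuous_comp (cont_der (dsh t)) c).
- move=> t n t1; have t1' : 0 < t0 + t by rewrite ltr_wpDl.
  have := @is_derive1_comp R (v^~ n) (fun t : R => t0 + t) t _ _ (ss_der sol n t1') (dsh t).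
  by move/is_derive_eq; apply; rewrite mulr1.
- move=> T; have [B vB] := ss_bnd sol (t0 + T); exists B => t K tT; apply: vB; lra.
Qed.

Variables (kap : R) (la : int -> R).
Hypotheses (la_ge : forall n, `|n%:~R| <= la n)
  (la_lip : forall n, `|la (n + 1) - la n| <= 1).

Lemma seq_energy v (E : R) : 0 <= kap -> seq_sol kap la v ->
  (forall K, nsq K (v 0) <= E) -> forall t K, 0 <= t -> nsq K (v t) <= E.
Proof.
move=> kap0 sol vE t K t0; have [B vB] := ss_bnd sol t.
have tt : 0 <= t <= t by rewrite t0 lexx.
have B0 : 0 <= B by apply: le_trans (nsq_ge0 0 (v t)) (vB t 0%N tt).
apply: (@cutoff_limit _ v t E (t * 4 * (B + 1) * (B + 1))) => r r0.
have r0' : 0 < r%:R :> R by rewrite ltr0n.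
have e0 : 0 < (B + 1) / r%:R by rewrite divr_gt0 // ltr_wpDl.
have := energy_growth kap0 la_ge la_lip e0 B0 (cutoff_sol r0 sol vB) (lexx 0) t0 (lexx t).
have := le_trans (cutoff_nsq_le v 0 r r0) (vE r).
rewrite subr0; lra.
Qed.

Lemma seq_contraction v (mu E : R) : 0 < mu -> mu <= 1 -> mu ^+ 2 <= eta ->
  kap = mu ^+ 6 -> seq_sol kap la v ->
  (forall K, nsq K (v 0) <= E) -> forall K, nsq K (v (33 / mu ^+ 4)) <= contr * E.
Proof.
move=> mu0 mu1 mueta kapE sol vE K; set T := 33 / mu ^+ 4.
have [B vB] := ss_bnd sol T.
have T0 : 0 <= T by rewrite divr_ge0 // exprn_ge0 // ltW.
have TT : 0 <= T <= T by rewrite T0 lexx.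
have B0 : 0 <= B by apply: le_trans (nsq_ge0 0 (v T)) (vB T 0%N TT).
have [C HC] := contraction mu0 mu1 mueta B0.
apply: (@cutoff_limit _ v T _ (C * (B + 1))) => r r0.
have r0' : 0 < r%:R :> R by rewrite ltr0n.
have e0 : 0 < (B + 1) / r%:R by rewrite divr_gt0 // ltr_wpDl.
have cs := cutoff_sol r0 sol vB; rewrite kapE in cs.
have h1 := HC _ _ _ _ _ la_ge la_lip e0 cs.
have h2 := ler_wpM2l (ltW contr_gt0) (le_trans (cutoff_nsq_le v 0 r r0) (vE r)).
rewrite -/T in h1; lra.
Qed.

(** Iteration of the contraction over intervals of length 33 / mu ^ 4; the factor
1 / contr pays for the last, incomplete interval. *)
Lemma seq_decay v (mu E : R) : 0 < mu -> mu <= 1 -> mu ^+ 2 <= eta ->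
  kap = mu ^+ 6 -> seq_sol kap la v ->
  (forall K, nsq K (v 0) <= E) -> forall t K, 0 <= t ->
  nsq K (v t) <= contr^-1 * expR (ln contr / 33 * mu ^+ 4 * t) * E.
Proof.
move=> mu0 mu1 mueta kapE sol vE t K t0.
have m40 : 0 < mu ^+ 4 by rewrite exprn_gt0.
pose T := 33 / mu ^+ 4; have T0 : 0 < T by rewrite divr_gt0.
have kap0 : 0 <= kap by rewrite kapE exprn_ge0 // ltW.
have E0 : 0 <= E by apply: le_trans (nsq_ge0 0 (v 0)) (vE 0%N).
have step (j : nat) : forall K, nsq K (v (j%:R * T)) <= contr ^+ j * E.
  elim: j => [|j IH]; first by move=> K'; rewrite mul0r mul1r.
  have jT0 : 0 <= j%:R * T by rewrite mulr_ge0 // ltW.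
  have sh := seq_sol_shift jT0 sol.
  have IH' : forall K, nsq K ((fun t => v (j%:R * T + t)) 0) <= contr ^+ j * E.
    by move=> K'; rewrite addr0.
  have jE : j.+1%:R * T = j%:R * T + T by rewrite -natr1 mulrDl mul1r.
  move=> K'; rewrite jE exprS -mulrA.
  exact: (seq_contraction mu0 mu1 mueta kapE sh IH' K').
pose j := Num.truncn (t / T).
have /andP[j1 j2] : j%:R <= t / T < j.+1%:R by apply: truncn_itv; rewrite divr_ge0 // ltW.
have jt : j%:R * T <= t by rewrite -ler_pdivlMr.
have jT0 : 0 <= j%:R * T by rewrite mulr_ge0 // ltW.
have IH' : forall K, nsq K ((fun t => v (j%:R * T + t)) 0) <= contr ^+ j * E.
  by move=> K'; rewrite addr0; exact: step.
have dt0 : 0 <= t - j%:R * T by rewrite subr_ge0.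
have := seq_energy kap0 (seq_sol_shift jT0 sol) IH' K dt0.
rewrite (_ : j%:R * T + (t - j%:R * T) = t); last by ring.
move=> /le_trans; apply.
rewrite ler_wpM2r //.
have q0 : 0 < contr :> R by exact: contr_gt0.
have lq : ln contr <= 0 :> R by rewrite ln_le0 // ltW // contr_lt1.
rewrite ler_pdivlMl // -exprS -{1}(lnK (_ : contr \is Num.pos)) //.
rewrite -expRM_natr ler_expR.
have -> : ln contr / 33 * mu ^+ 4 * t = ln contr * (t / T).
  by rewrite /T; field; rewrite gt_eqF.
by apply: ler_wnM2l => //; exact: ltW.
Qed.

End Decay.

(** * Decay of a single x-frequency *)

Section ModeDecay.
Context {R : realType}.
Variables (nu : R) (la : int -> R).
Hypotheses (la_ge : forall n, `|n%:~R| <= la n)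
  (la_lip : forall n, `|la (n + 1) - la n| <= 1).
Hypotheses (nu0 : 0 < nu) (nu_eta : nu <= eta ^+ 3).

Lemma eta_le1 : eta <= 1 :> R.
Proof.
by have h := expR_ge0 (198 : R); rewrite /eta invf_le1; lra.
Qed.

(** Dividing time by a replaces nu by kap = nu / a, so that the rate becomes
kap^(2/3) a = nu^(2/3) a^(1/3), which is at least nu^(2/3) since a >= 1. *)
Lemma real_mode_decay (a E : R) (v : R -> int -> R) : 1 <= a ->
  (forall (t : R) n, 0 <= t -> {for t, continuous (v^~ n)}) ->
  (forall (t : R) n, 0 < t ->
    is_derive t 1 (v^~ n) (- a * cdiff (v t) n - nu * la n * v t n)) ->
  (forall T, exists B, forall t K, 0 <= t <= T -> nsq K (v t) <= B) ->
  (forall K, nsq K (v 0) <= E) -> forall t K, 0 <= t ->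
  nsq K (v t) <= contr^-1 * expR (ln contr / 33 * nu `^ (2 / 3) * t) * E.
Proof.
move=> a1 vc vd vB vE t K t0; have a0 : 0 < a by apply: lt_le_trans a1.
have an0 : a != 0 by rewrite gt_eqF.
have E0 : 0 <= E by apply: le_trans (nsq_ge0 0 (v 0)) (vE 0%N).
have dsc (x : R) : is_derive x 1 (fun x : R => a^-1 * x) a^-1.
  have := derM (is_derive_cst a^-1 x 1) (is_derive_id x 1).
  by move/is_derive_eq; apply; rewrite mul0r add0r mulr1.
pose V (x : R) := v (a^-1 * x).
have sol : seq_sol (nu / a) la V.
  split.
  - move=> x n x0; have x0' : 0 <= a^-1 * x by rewrite mulr_ge0 // invr_ge0 ltW.
    exact: (continuous_comp (cont_der (dsc x)) (vc _ n x0')).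
  - move=> x n x0; have x0' : 0 < a^-1 * x by rewrite mulr_gt0 // invr_gt0.
    have := @is_derive1_comp R (v^~ n) (fun x : R => a^-1 * x) x _ _ (vd _ n x0') (dsc x).
    by move/is_derive_eq; apply; rewrite /V; field; rewrite an0.
  - move=> T; have [B HB] := vB (a^-1 * T); exists B => x K' /andP[x0 xT].
    have ai0 : 0 <= a^-1 by rewrite invr_ge0 ltW.
    by apply: HB; rewrite mulr_ge0 //= ler_wpM2l.
pose mu := (nu / a) `^ (6%:R^-1).
have nua0 : 0 < nu / a by rewrite divr_gt0.
have mu0 : 0 < mu by rewrite powR_gt0.
have mu6 : mu ^+ 6 = nu / a.
  by rewrite -powR_mulrn ?ltW // -powRrM mulVf // powRr1 // ltW.
have mueta : mu ^+ 2 <= eta.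
  have : (mu ^+ 2) ^+ 3 <= eta ^+ 3.
    rewrite -exprM mu6; apply: le_trans nu_eta.
    by rewrite ler_pdivrMr // ler_peMr // ltW.
  by rewrite ler_pXn2r ?nnegrE ?exprn_ge0 // ltW // eta_gt0.
have mu1 : mu <= 1.
  have : mu ^+ 2 <= 1 ^+ 2 by rewrite expr1n; apply: le_trans mueta eta_le1.
  by rewrite ler_sqr // ?nnegrE // ltW.
have V0 : forall K, nsq K (V 0) <= E by move=> K'; rewrite /V mulr0.
have at0 : 0 <= a * t by rewrite mulr_ge0 // ltW.
have := seq_decay la_ge la_lip mu0 mu1 mueta (esym mu6) sol V0 K at0.
rewrite /V mulKf // => /le_trans; apply.
rewrite ler_wpM2r // ler_wpM2l ?invr_ge0 ?(ltW contr_gt0) // ler_expR.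
have lq : ln contr <= 0 :> R by rewrite ln_le0 // ltW // contr_lt1.
have mu4 : mu ^+ 4 = (nu / a) `^ (2 / 3).
  rewrite -powR_mulrn ?ltW // -powRrM; congr (_ `^ _); by field.
have h : nu `^ (2 / 3) <= mu ^+ 4 * a.
  have -> : nu `^ (2 / 3) = (nu / a) `^ (2 / 3) * a `^ (2 / 3).
    by rewrite -powRM ?divfK // ltW.
  rewrite mu4; apply: ler_wpM2l; first exact: powR_ge0.
  rewrite -{2}(powRr1 (ltW a0)).
  by apply: ler_powR => //; lra.
have c0 : ln contr / 33 <= 0 :> R by rewrite pmulr_lle0.
have := ler_wnM2l c0 (ler_wpM2r t0 h).
rewrite [in X in _ <= X -> _]mulrA; apply: le_trans; rewrite le_eqVlt.
by apply/orP; left; apply/eqP; ring.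
Qed.

Lemma cos_int_succ (n : int) : cos ((n + 1)%:~R * (pi / 2)) = - sin (n%:~R * (pi / 2)) :> R.
Proof. by rewrite rmorphD /= mulrDl mul1r cosD cos_pihalf sin_pihalf mulr0 mulr1 sub0r. Qed.
Lemma sin_int_succ (n : int) : sin ((n + 1)%:~R * (pi / 2)) = cos (n%:~R * (pi / 2)) :> R.
Proof. by rewrite rmorphD /= mulrDl mul1r sinD cos_pihalf sin_pihalf mulr0 mulr1 add0r. Qed.
Lemma cos_int_pred (n : int) : cos ((n - 1)%:~R * (pi / 2)) = sin (n%:~R * (pi / 2)) :> R.
Proof. by rewrite -sin_int_succ subrK. Qed.
Lemma sin_int_pred (n : int) : sin ((n - 1)%:~R * (pi / 2)) = - cos (n%:~R * (pi / 2)) :> R.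
Proof. by rewrite -[n in RHS](subrK 1) cos_int_succ opprK. Qed.

(** The complex unknown p + i q solves u' = - i a avg u - nu la u.  Multiplying its
n-th coefficient by the n-th power of i or of - i, according to the sign of a,
is a translation of y by a quarter period; it turns - i a avg into - |a| cdiff,
which is real, so that real and imaginary parts decouple. *)
Lemma mode_decay (a E : R) (p q : R -> int -> R) : 1 <= `|a| ->
  (forall (t : R) n, 0 <= t -> {for t, continuous (p^~ n)}) ->
  (forall (t : R) n, 0 <= t -> {for t, continuous (q^~ n)}) ->
  (forall (t : R) n, 0 < t ->
    is_derive t 1 (p^~ n) (a * avg (q t) n - nu * la n * p t n)) ->
  (forall (t : R) n, 0 < t ->
    is_derive t 1 (q^~ n) (- a * avg (p t) n - nu * la n * q t n)) ->
  (forall T, exists B, forall t K, 0 <= t <= T -> nsq K (p t) + nsq K (q t) <= B) ->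
  (forall K, nsq K (p 0) + nsq K (q 0) <= E) -> forall t K, 0 <= t ->
  nsq K (p t) + nsq K (q t) <=
    2 * (contr^-1 * expR (ln contr / 33 * nu `^ (2 / 3) * t) * E).
Proof.
move=> a1 cp cq dp dq pqB pqE t K t0.
pose sg : R := Num.sg a.
have an0 : a != 0 by rewrite -normr_gt0; apply: lt_le_trans a1.
have sg2 : sg * sg = 1 by rewrite -expr2 sqr_sg an0.
have aE : `|a| * sg = a by rewrite mulrC -numEsg.
have aE' : `|a| = a * sg by rewrite -{2}aE -mulrA sg2 mulr1.
pose c (n : int) : R := cos (n%:~R * (pi / 2)).
pose s (n : int) : R := sin (n%:~R * (pi / 2)).
have cs n : c n ^+ 2 + s n ^+ 2 = 1 by exact: cos2Dsin2.
pose x (t : R) n := c n * p t n - sg * s n * q t n.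
pose y (t : R) n := sg * s n * p t n + c n * q t n.
have xy (u : R) n : x u n ^+ 2 + y u n ^+ 2 = p u n ^+ 2 + q u n ^+ 2.
  transitivity ((c n ^+ 2 + (sg * sg) * s n ^+ 2) * (p u n ^+ 2 + q u n ^+ 2)).
    by rewrite /x /y; ring.
  by rewrite sg2 mul1r cs mul1r.
have nxy K' t' : nsq K' (x t') + nsq K' (y t') = nsq K' (p t') + nsq K' (q t').
  by rewrite /nsq -!zsumD; apply: eq_zsum => n; rewrite xy.
have lin (A B : R) (f g : R -> R) (t' f' g' : R) : is_derive t' 1 f f' -> is_derive t' 1 g g' ->
    is_derive t' 1 (fun t => A * f t + B * g t) (A * f' + B * g').
  move=> df dg; have := derD (derM (is_derive_cst A t' 1) df) (derM (is_derive_cst B t' 1) dg).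
  by move/is_derive_eq; apply; rewrite !mul0r !add0r.
have linc (A B : R) (f g : R -> R) (t' : R) : {for t', continuous f} -> {for t', continuous g} ->
    {for t', continuous (fun t => A * f t + B * g t)}.
  by move=> cf cg; apply: contD; apply: contM => //; exact: cst_continuous.
have xE n : x^~ n = (fun t => c n * p t n + (- (sg * s n)) * q t n).
  by apply/funext => u; rewrite /x; ring.
have hx : nsq K (x t) <= contr^-1 * expR (ln contr / 33 * nu `^ (2 / 3) * t) * E.
  apply: (@real_mode_decay `|a| E x a1 _ _ _ _ t K t0).
  - by move=> t' n t'0; rewrite xE; apply: linc; [exact: cp|exact: cq].
  - move=> t' n t'0; rewrite xE; apply: (is_derive_eq (lin _ _ _ _ _ _ _ (dp _ n t'0) (dq _ n t'0))).
    rewrite /cdiff /x /c /s cos_int_succ cos_int_pred sin_int_succ sin_int_pred /avg aE'.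
    set C := cos _; set S := sin _.
    transitivity (a * ((q t' (n + 1) + q t' (n - 1)) / 2) * C * (sg * sg)
      + sg * S * (a * ((p t' (n + 1) + p t' (n - 1)) / 2))
      - nu * la n * (C * p t' n - sg * S * q t' n)).
      by rewrite sg2; ring.
    by field.
  - move=> T; have [B HB] := pqB T; exists B => t' K' t'T.
    by have := HB t' K' t'T; rewrite -nxy; have := nsq_ge0 K' (y t'); lra.
  - by move=> K'; have := pqE K'; rewrite -nxy; have := nsq_ge0 K' (y 0); lra.
have hy : nsq K (y t) <= contr^-1 * expR (ln contr / 33 * nu `^ (2 / 3) * t) * E.
  apply: (@real_mode_decay `|a| E y a1 _ _ _ _ t K t0).
  - by move=> t' n t'0; apply: linc; [exact: cp|exact: cq].
  - move=> t' n t'0; apply: (is_derive_eq (lin _ _ _ _ _ _ _ (dp _ n t'0) (dq _ n t'0))).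
    rewrite /cdiff /y /c /s cos_int_succ cos_int_pred sin_int_succ sin_int_pred /avg aE'.
    set C := cos _; set S := sin _.
    transitivity (- a * ((p t' (n + 1) + p t' (n - 1)) / 2) * C * (sg * sg)
      + sg * S * (a * ((q t' (n + 1) + q t' (n - 1)) / 2))
      - nu * la n * (sg * S * p t' n + C * q t' n)).
      by rewrite sg2; ring.
    by field.
  - move=> T; have [B HB] := pqB T; exists B => t' K' t'T.
    by have := HB t' K' t'T; rewrite -nxy; have := nsq_ge0 K' (x t'); lra.
  - by move=> K'; have := pqE K'; rewrite -nxy; have := nsq_ge0 K' (x 0); lra.
rewrite -nxy; lra.
Qed.

End ModeDecay.

(** * Bessel inequality and approximation by orthonormal families *)

Section L2.
Context d (T : measurableType d) (R : realType).
Variables (m : {measure set T -> \bar R}) (D : set T).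
Hypotheses (mD : measurable D) (finD : (m D < +oo)%E).
Implicit Types (f g h : T -> R) (c : R).

Definition itg f := m.-integrable D (EFin \o f).
Definition sqitg f := measurable_fun D f /\ itg (fun x => f x ^+ 2).
Definition ip f g : R := \int[m]_(x in D) (f x * g x).

Lemma itgD f g : itg f -> itg g -> itg (fun x => f x + g x).
Proof. by move=> h1 h2; exact: (integrableD mD h1 h2). Qed.

Lemma itgZ c f : itg f -> itg (fun x => c * f x).
Proof. by move=> h; exact: (integrableZl mD c h). Qed.

Lemma itgB f g : itg f -> itg g -> itg (fun x => f x - g x).
Proof. by move=> h1 h2; exact: (integrableB mD h1 h2). Qed.

Lemma le_itg f g : measurable_fun D f -> (forall x, D x -> `|f x| <= g x) ->
  itg g -> itg f.
Proof.
move=> mf fg ig; apply: (le_integrable mD _ _ ig); first exact/measurable_EFinP.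
by move=> x Dx /=; rewrite lee_fin; apply: le_trans (fg x Dx) (ler_norm _).
Qed.

Lemma itg_cst c : itg (fun=> c).
Proof.
apply/integrableP; split; first exact: measurable_cst.
by rewrite /= integral_cst // lte_mul_pinfty // ?lee_fin.
Qed.

Lemma sqitg_mul f g : sqitg f -> sqitg g -> itg (fun x => f x * g x).
Proof.
move=> [mf f2] [mg g2]; apply: (le_itg (g := fun x => f x ^+ 2 + g x ^+ 2)).
- exact: measurable_funM.
- move=> x _; rewrite normrM; have := sqr_ge0 (`|f x| - `|g x|).
  by rewrite -(real_normK (num_real (f x))) -(real_normK (num_real (g x)));
     have := sqr_ge0 `|f x|; have := sqr_ge0 `|g x|; nra.
- exact: itgD.
Qed.

Lemma sqitg_bnd f c : measurable_fun D f -> (forall x, D x -> `|f x| <= c) -> sqitg f.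
Proof.
move=> mf fc; split => //; apply: (le_itg (g := fun=> c ^+ 2)).
- exact: measurable_funX.
- move=> x Dx; rewrite normrX ler_sqr ?nnegrE ?fc //.
  by apply: le_trans (fc x Dx).
- exact: itg_cst.
Qed.

Lemma sqitg_cst c : sqitg (fun=> c).
Proof. by apply: (sqitg_bnd (c := `|c|)) => //; exact: measurable_cst. Qed.

Lemma sqitg_itg f : sqitg f -> itg f.
Proof.
move=> sf; have := sqitg_mul sf (sqitg_cst 1).
by rewrite (_ : (fun x => f x * 1) = f) //; apply/funext => x; rewrite mulr1.
Qed.

Lemma sqitgZ c f : sqitg f -> sqitg (fun x => c * f x).
Proof.
move=> [mf f2]; split; first by apply: measurable_funM => //; exact: measurable_cst.
rewrite (_ : (fun x => _) = (fun x => c ^+ 2 * f x ^+ 2)); first exact: itgZ.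
by apply/funext => x; rewrite exprMn.
Qed.

Lemma sqitgD f g : sqitg f -> sqitg g -> sqitg (fun x => f x + g x).
Proof.
move=> sf sg; split; first by apply: measurable_funD; [case: sf|case: sg].
rewrite (_ : (fun x => _) = (fun x => (f x ^+ 2 + g x ^+ 2) + 2 * (f x * g x))).
  apply: itgD; last by apply: itgZ; exact: sqitg_mul.
  by apply: itgD; [case: sf|case: sg].
by apply/funext => x; ring.
Qed.

Lemma sqitgB f g : sqitg f -> sqitg g -> sqitg (fun x => f x - g x).
Proof.
move=> sf sg; rewrite (_ : (fun x => _) = (fun x => f x + (- 1) * g x)).
  by apply: sqitgD => //; exact: sqitgZ.
by apply/funext => x; ring.
Qed.

Lemma sqitgM_bnd f g c : sqitg f -> measurable_fun D g ->
  (forall x, D x -> `|g x| <= c) -> sqitg (fun x => f x * g x).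
Proof.
move=> [mf f2] mg gc; split; first exact: measurable_funM.
apply: (le_itg (g := fun x => c ^+ 2 * f x ^+ 2)).
- by apply: measurable_funX; exact: measurable_funM.
- move=> x Dx; rewrite ger0_norm ?sqr_ge0 // exprMn mulrC.
  apply: ler_wpM2r; first exact: sqr_ge0.
  rewrite -(real_normK (num_real (g x))) ler_sqr ?nnegrE ?gc //.
  by apply: le_trans (gc x Dx).
- exact: itgZ.
Qed.

Lemma ipC f g : ip f g = ip g f.
Proof. by apply: eq_Rintegral => x _; rewrite mulrC. Qed.

Lemma ipDl f g h : sqitg f -> sqitg g -> sqitg h ->
  ip (fun x => f x + g x) h = ip f h + ip g h.
Proof.
move=> sf sg sh; rewrite /ip -RintegralD //; last 2 first.
- exact: sqitg_mul.
- exact: sqitg_mul.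
by apply: eq_Rintegral => x _; rewrite mulrDl.
Qed.

Lemma ipZl c f h : sqitg f -> sqitg h -> ip (fun x => c * f x) h = c * ip f h.
Proof.
move=> sf sh; rewrite /ip -RintegralZl //; last exact: sqitg_mul.
by apply: eq_Rintegral => x _; rewrite mulrA.
Qed.

Lemma ipBl f g h : sqitg f -> sqitg g -> sqitg h ->
  ip (fun x => f x - g x) h = ip f h - ip g h.
Proof.
move=> sf sg sh; rewrite /ip -RintegralB //; last 2 first.
- exact: sqitg_mul.
- exact: sqitg_mul.
by apply: eq_Rintegral => x _; rewrite mulrBl.
Qed.

Lemma ip_ge0 f : 0 <= ip f f.
Proof. by apply: Rintegral_ge0 => x _; rewrite -expr2 sqr_ge0. Qed.

Lemma ip_le f g : sqitg f -> sqitg g -> (forall x, D x -> `|f x| <= `|g x|) ->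
  ip f f <= ip g g.
Proof.
move=> sf sg fg; apply: le_Rintegral => //; [exact: sqitg_mul..|].
move=> x Dx; rewrite -!expr2 -(real_normK (num_real (f x))) -(real_normK (num_real (g x))).
by rewrite ler_sqr ?nnegrE // fg.
Qed.

Section Bessel.
Variable E : int -> T -> R.
Hypotheses (sE : forall n, sqitg (E n)) (oE : forall i j, ip (E i) (E j) = (i == j)%:R).

Definition coef f (n : int) : R := ip f (E n).
(** The squared distance from f to the span of the first members of the family. *)
Definition defect N f : R := ip f f - zsum N (fun n => coef f n ^+ 2).

Lemma coefD f g n : sqitg f -> sqitg g ->
  coef (fun x => f x + g x) n = coef f n + coef g n.
Proof. by move=> sf sg; exact: ipDl. Qed.

Lemma coefZ c f n : sqitg f -> coef (fun x => c * f x) n = c * coef f n.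
Proof. by move=> sf; exact: ipZl. Qed.

Lemma coefB f g n : sqitg f -> sqitg g ->
  coef (fun x => f x - g x) n = coef f n - coef g n.
Proof. by move=> sf sg; exact: ipBl. Qed.

(** The defect is the squared norm of the remainder that is left when the components of
f are removed one after the other. *)
Lemma defect_ge0 N f : sqitg f -> 0 <= defect N f.
Proof.
move=> sf.
suff [r [sr -> _]] : exists r, [/\ sqitg r, defect N f = ip r r &
    forall n, coef r n = if (`|n| <= N)%N then 0 else coef f n] by exact: ip_ge0.
have remove r n c : sqitg r -> coef r n = c -> let r' := (fun x => r x - c * E n x) in
    [/\ sqitg r', ip r' r' = ip r r - c ^+ 2 &
      forall k, coef r' k = if k == n then 0 else coef r k].
  move=> sr rc r'; have sr' : sqitg r' by apply: sqitgB => //; exact: sqitgZ.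
  have cE k : coef r' k = coef r k - c * (n == k)%:R.
    rewrite coefB //; last exact: sqitgZ.
    by congr (_ - _); rewrite /coef ipZl // oE.
  split=> //.
  - rewrite {1}/r' ipBl //; last exact: sqitgZ.
    rewrite ipZl // [ip r r']ipC [ip (E n) r']ipC -/(coef r' n) cE eqxx rc mulr1 subrr mulr0 subr0.
    rewrite {1}/r' ipBl //; last exact: sqitgZ.
    rewrite ipZl // [ip (E n) r]ipC -/(coef r n) rc; ring.
  - move=> k; rewrite cE eq_sym; case: eqP => [->|_]; last by rewrite mulr0 subr0.
    by rewrite rc mulr1 subrr.
elim: N => [|N [r [sr rr rc]]].
  have [h1 h2 h3] := remove f 0 _ sf erefl.
  exists (fun x => f x - coef f 0 * E 0 x); split => //.
    by rewrite h2 /defect /zsum big_ord_recl big_ord0 /= addr0 subr0.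
  by move=> n; rewrite h3 leqn0 absz_eq0.
have c1 : coef r (- N.+1%:Z) = coef f (- N.+1%:Z).
  by rewrite rc; case: ifP => //; lia.
have [sr1 h2 h3] := remove r (- N.+1%:Z) _ sr c1.
set r1 := (fun x => _) in sr1 h2 h3.
have c2 : coef r1 N.+1%:Z = coef f N.+1%:Z.
  by rewrite h3 rc; case: eqP => [|_]; [lia|case: ifP => //; lia].
have [sr2 h4 h5] := remove r1 N.+1%:Z _ sr1 c2.
set r2 := (fun x => _) in sr2 h4 h5.
exists r2; split => //; first by rewrite h4 h2 -rr /defect zsumS; ring.
move=> n; rewrite h5 h3 rc.
case: eqP => [->|n1]; first by rewrite ifT //; lia.
case: eqP => [->|n2]; first by rewrite ifT //; lia.
by case: ifPn => h; case: ifPn => // h'; lia.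
Qed.

Lemma defect_le N f : defect N f <= ip f f.
Proof. by rewrite /defect lerBlDr lerDl; apply: zsum_ge0 => n; exact: sqr_ge0. Qed.

Lemma defect_anti f N1 N2 : (N1 <= N2)%N -> defect N2 f <= defect N1 f.
Proof. by move=> h; rewrite lerD2l lerN2 zsum_le // => n; exact: sqr_ge0. Qed.

(** Parallelogram law: the defect is a quadratic form, non-negative on the
difference. *)
Lemma defectD N f g : sqitg f -> sqitg g ->
  defect N (fun x => f x + g x) <= 2 * (defect N f + defect N g).
Proof.
move=> sf sg.
have sD := sqitgD sf sg; have sB := sqitgB sf sg.
suff E0 : defect N (fun x => f x + g x) + defect N (fun x => f x - g x)
    = 2 * (defect N f + defect N g) by have := defect_ge0 N sB; lra.
have iD : ip (fun x => f x + g x) (fun x => f x + g x) = ip f f + 2 * ip f g + ip g g.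
  rewrite ipDl // [ip f _]ipC [ip g _]ipC !ipDl // [ip g f]ipC; ring.
have iB : ip (fun x => f x - g x) (fun x => f x - g x) = ip f f - 2 * ip f g + ip g g.
  rewrite ipBl // [ip f _]ipC [ip g _]ipC !ipBl // [ip g f]ipC; ring.
rewrite /defect iD iB.
rewrite (@eq_zsum _ N (fun n => coef (fun x => f x + g x) n ^+ 2)
  (fun n => (coef f n ^+ 2 + coef g n ^+ 2) + 2 * (coef f n * coef g n))); last first.
  by move=> n; rewrite coefD //; ring.
rewrite (@eq_zsum _ N (fun n => coef (fun x => f x - g x) n ^+ 2)
  (fun n => (coef f n ^+ 2 + coef g n ^+ 2) - 2 * (coef f n * coef g n))); last first.
  by move=> n; rewrite coefB //; ring.
by rewrite !zsumD zsumN !zsumZ; ring.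
Qed.

Lemma defectZ N c f : sqitg f -> defect N (fun x => c * f x) = c ^+ 2 * defect N f.
Proof.
move=> sf; rewrite /defect ipZl //; last exact: sqitgZ.
rewrite ipC ipZl // (@eq_zsum _ N _ (fun n => c ^+ 2 * coef f n ^+ 2)).
  by rewrite zsumZ; ring.
by move=> n; rewrite coefZ // exprMn.
Qed.

(** Membership in the closed span of the family, expressed by defects. *)
Definition parseval f := sqitg f /\ forall e, 0 < e -> exists N, defect N f <= e.

Lemma parsevalD f g : parseval f -> parseval g -> parseval (fun x => f x + g x).
Proof.
move=> [sf pf] [sg pg]; split; first exact: sqitgD.
move=> e e0; have e4 : 0 < e / 4 by rewrite divr_gt0.
have [N1 h1] := pf _ e4; have [N2 h2] := pg _ e4.
exists (maxn N1 N2); apply: le_trans (defectD _ sf sg) _.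
have h3 := le_trans (defect_anti f (leq_maxl N1 N2)) h1.
have h4 := le_trans (defect_anti g (leq_maxr N1 N2)) h2.
lra.
Qed.

Lemma parsevalZ c f : parseval f -> parseval (fun x => c * f x).
Proof.
move=> [sf pf]; split; first exact: sqitgZ.
move=> e e0; have c0 : 0 < c ^+ 2 + 1 by rewrite ltr_wpDl ?sqr_ge0.
have [N h] := pf _ (divr_gt0 e0 c0).
exists N; rewrite defectZ //.
have d0 := defect_ge0 N sf; move: h; rewrite ler_pdivlMr //.
by rewrite mulrC; have := sqr_ge0 c; nra.
Qed.

(** The defect of f is at most twice those of g and of f - g, and the latter is
bounded by the squared distance from f to g. *)
Lemma parseval_closed f : sqitg f ->
  (forall e, 0 < e -> exists g, parseval g /\ ip (fun x => f x - g x) (fun x => f x - g x) <= e) ->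
  parseval f.
Proof.
move=> sf h; split=> // e e0; have e4 : 0 < e / 4 by rewrite divr_gt0.
have [g [[sg pg] fg]] := h _ e4; have [N hN] := pg _ e4; exists N.
have sB := sqitgB sf sg.
have := defectD N sg sB; rewrite (_ : (fun x => _) = f); last first.
  by apply/funext => x; ring.
by have := defect_le N (fun x => f x - g x); lra.
Qed.

End Bessel.
End L2.

(** * The Fourier series of the sawtooth *)

Section CosineSeries.
Context {R : realType}.
Implicit Types (x : R) (N k : nat).

Lemma mean_value_bound (f df : R -> R) (a b M : R) : a <= b -> 0 <= M ->
  (forall x, a <= x <= b -> is_derive x 1 f (df x) /\ `|df x| <= M) ->
  `|f b - f a| <= M * (b - a).
Proof.
move=> ab M0 h.
have fc x : a <= x <= b -> {for x, continuous f} by move=> /h [/cont_der].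
have h1 := @gronwall R f df a b 0 M ab M0 fc.
have h2 := @gronwall R (fun x => - f x) (fun x => - df x) a b 0 M ab M0
  (fun x xab => contN (fc x xab)).
rewrite normr0 !(mulr0, mul0r) expR0 !mul1r in h1 h2.
have {h1} h1 : f b <= f a + (b - a) * M.
  apply: h1 => x xab; have [|d l] := h x; first by lra.
  by split=> //; have := ler_norm (df x); lra.
have {h2} h2 : - f b <= - f a + (b - a) * M.
  apply: h2 => x xab; have [|d l] := h x; first by lra.
  by split; [exact: derN|have := ler_norm (- df x); rewrite normrN; lra].
by rewrite ler_norml; lra.
Qed.

(** [sin_sum] is a partial sum of the Fourier series of the sawtooth (pi - x) / 2 on
(0, 2 pi); [cos_sum] is its derivative and [vers_sum] its integral. *)
Definition sin_sum N x : R := \sum_(k < N) sin (k.+1%:R * x) / k.+1%:R.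
Definition cos_sum N x : R := \sum_(k < N) cos (k.+1%:R * x).
Definition vers_sum N x : R := \sum_(k < N) (1 - cos (k.+1%:R * x)) / k.+1%:R ^+ 2.

Lemma dirichlet_kernel N x :
  2 * sin (x / 2) * (2^-1 + cos_sum N x) = sin ((N%:R + 2^-1) * x).
Proof.
elim: N => [|N IH].
  by rewrite /cos_sum big_ord0 addr0 add0r [_^-1 * x]mulrC; field.
rewrite /cos_sum big_ord_recr /= -/(cos_sum N x) addrA mulrDr IH.
have -> : (N%:R + 2^-1) * x = N.+1%:R * x - x / 2 by rewrite -natr1; field.
have -> : (N.+1%:R + 2^-1) * x = N.+1%:R * x + x / 2 by field.
by rewrite sinB sinD; ring.
Qed.

Lemma sin_nat_pi N : sin (N%:R * pi) = 0 :> R.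
Proof.
elim: N => [|N IH]; first by rewrite mul0r sin0.
by rewrite -natr1 mulrDl mul1r sinDpi IH oppr0.
Qed.

Lemma der_scal (g dg : R -> R) (c x : R) : (forall y : R, is_derive y 1 g (dg y)) ->
  is_derive x 1 (fun x => g (c * x)) (c * dg (c * x)).
Proof.
move=> h; have d : is_derive x 1 (fun x : R => c * x) c.
  have := derM (is_derive_cst c x 1) (is_derive_id x 1).
  by move/is_derive_eq; apply; rewrite mul0r add0r mulr1.
have := @is_derive1_comp R g (fun x : R => c * x) x _ _ (h _) d.
by move/is_derive_eq; apply; rewrite mulrC.
Qed.

Lemma der_ord_sum N (F : 'I_N -> R -> R) (dF : 'I_N -> R) x :
  (forall k : 'I_N, is_derive x 1 (F k) (dF k)) ->
  is_derive x 1 (fun x => \sum_(k < N) F k x) (\sum_(k < N) dF k).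
Proof.
move=> h; rewrite (_ : (fun x => _) = \sum_(k < N) F k); first exact: is_derive_sum.
by apply/funext => t; rewrite fct_sumE.
Qed.

Lemma derZc (g : R -> R) (c x dg : R) : is_derive x 1 g dg ->
  is_derive x 1 (fun x => c * g x) (c * dg).
Proof.
move=> h; have := derM (is_derive_cst c x 1) h.
by move/is_derive_eq; apply; rewrite mul0r add0r.
Qed.

Lemma der_sin_sum N x : is_derive x 1 (sin_sum N) (cos_sum N x).
Proof.
apply: der_ord_sum => k.
rewrite (_ : (fun x => _) = (fun x => k.+1%:R^-1 * sin (k.+1%:R * x))); last first.
  by apply/funext => y; rewrite mulrC.
have := derZc k.+1%:R^-1 (@der_scal sin cos k.+1%:R x (@is_derive_sin R)).
by move/is_derive_eq; apply; rewrite mulKf // pnatr_eq0.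
Qed.

Lemma der_vers_sum N x : is_derive x 1 (vers_sum N) (sin_sum N x).
Proof.
apply: der_ord_sum => k.
have : (k.+1%:R : R) != 0 by rewrite pnatr_eq0.
move: (k.+1%:R : R) => c cn0.
rewrite (_ : (fun x => _) = (fun x => (c ^+ 2)^-1 * (1 - cos (c * x)))); last first.
  by apply/funext => y; rewrite mulrC.
have := derZc (c ^+ 2)^-1 (derD (is_derive_cst (1 : R) x 1)
  (derN (@der_scal cos (fun x => - sin x) c x (@is_derive_cos R)))).
by move/is_derive_eq; apply; field; rewrite cn0.
Qed.

Lemma cos_abs_le1 x : `|cos x| <= 1.
Proof. by rewrite ler_norml cos_geN1 cos_le1. Qed.

Lemma sin_half_lb (eps x : R) : 0 < eps -> eps <= x -> x <= 2 * pi - eps ->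
  sin (eps / 2) <= sin (x / 2).
Proof.
move=> e0 ex xe.
have [xpi|xpi] := leP x pi.
  by rewrite leNgt ltr_sin ?in_itv /= -?leNgt; have := pi_gt0 R; lra.
have -> : sin (x / 2) = sin (pi - x / 2).
  by rewrite sinB sinpi cospi; ring.
by rewrite leNgt ltr_sin ?in_itv /= -?leNgt; have := pi_gt0 R; lra.
Qed.

(** Away from 0 and 2 pi the partial sums converge at the rate 1 / N.  Both sides
vanish at pi, and the Dirichlet kernel oscillates: one integration by parts of it
gains a factor 1 / N. *)
Lemma sin_sum_bound (eps : R) : 0 < eps -> eps <= pi -> exists C : R, 0 <= C /\
  forall N x, eps <= x <= 2 * pi - eps ->
    `|sin_sum N x - (pi - x) / 2| <= C / (2 * N%:R + 1).
Proof.
move=> e0 epi; have p0 := pi_gt0 R.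
pose sg := sin (eps / 2).
have sg0 : 0 < sg by rewrite sin_gt0_pi //; lra.
exists (pi / (2 * sg ^+ 2) + sg^-1); split.
  by rewrite addr_ge0 ?invr_ge0 ?divr_ge0 ?mulr_ge0 ?sqr_ge0 // ltW.
move=> N x /andP[x1 x2].
pose P : R := 2 * N%:R + 1.
have P0 : 0 < P by rewrite ltr_wpDl // mulr_ge0.
(* The boundary term of the integration by parts is included in W, whose
   derivative dW is then of order 1 / N. *)
pose W (x : R) := sin_sum N x - (pi - x) / 2
  + cos ((N%:R + 2^-1) * x) * (P * sin (2^-1 * x))^-1.
have sgx y : eps <= y <= 2 * pi - eps -> sg <= sin (2^-1 * y).
  by move=> /andP[y1 y2]; rewrite mulrC; exact: sin_half_lb.
pose dW (x : R) := - (cos ((N%:R + 2^-1) * x) * cos (2^-1 * x)) / (2 * P * sin (2^-1 * x) ^+ 2).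
have dWE (y : R) : eps <= y <= 2 * pi - eps -> is_derive y 1 W (dW y) /\ `|dW y| <= 1 / (2 * P * sg ^+ 2).
  move=> ye; have sy := sgx y ye; have sy0 : 0 < sin (2^-1 * y) by apply: lt_le_trans sy.
  split.
    have Pn0 : P * sin (2^-1 * y) != 0 by rewrite gt_eqF // mulr_gt0.
    have d1 := derZc P (@der_scal sin cos 2^-1 y (@is_derive_sin R)).
    have d2 := @is_deriveV R (fun y => P * sin (2^-1 * y)) y _ 1 Pn0 d1.
    have d3 := @der_scal cos (fun x => - sin x) (N%:R + 2^-1) y (@is_derive_cos R).
    have d4 := derD (derD (der_sin_sum N y) (derN (derM (derD (is_derive_cst (pi : R) y 1)
       (derN (is_derive_id y 1))) (is_derive_cst (2^-1 : R) y 1)))) (derM d3 d2).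
    apply: (is_derive_eq d4).
    have dk := dirichlet_kernel N y; rewrite [y / 2]mulrC in dk.
    have -> : cos_sum N y = sin ((N%:R + 2^-1) * y) / (2 * sin (2^-1 * y)) - 2^-1.
      by rewrite -dk; field; rewrite gt_eqF.
    have -> : N%:R + 2^-1 = P / 2 by rewrite /P; field.
    rewrite /dW /cst /= (_ : N%:R + 2^-1 = P / 2); last by rewrite /P; field.
    rewrite /GRing.scale /=; field.
    by rewrite !gt_eqF.
  have sq : sg ^+ 2 <= sin (2^-1 * y) ^+ 2 by rewrite lerXn2r ?nnegrE // ltW.
  rewrite /dW mulNr normrN normrM normfV (gtr0_norm (_ : 0 < 2 * P * _)); last first.
    by rewrite mulr_gt0 ?exprn_gt0 // mulr_gt0.
  have c1 : `|cos ((N%:R + 2^-1) * y) * cos (2^-1 * y)| <= 1.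
    by rewrite normrM -[leRHS]mulr1 ler_pM ?cos_abs_le1.
  have i0 : 0 < 2 * P * sg ^+ 2 by rewrite mulr_gt0 ?exprn_gt0 // mulr_gt0.
  have i1 : 2 * P * sg ^+ 2 <= 2 * P * sin (2^-1 * y) ^+ 2.
    by rewrite ler_wpM2l // mulr_ge0 // ltW.
  apply: ler_pM => //; first by rewrite invr_ge0 (le_trans (ltW i0)).
  by rewrite lef_pV2 // posrE // (lt_le_trans i0).
have Wpi : W pi = 0.
  rewrite /W subrr mul0r subr0.
  have -> : sin_sum N pi = 0.
    by rewrite /sin_sum big1 // => k _; rewrite sin_nat_pi mul0r.
  by rewrite mulrDl [2^-1 * _]mulrC cosDpihalf sin_nat_pi !oppr0 !mul0r !addr0.
have Wx : `|W x| <= 1 / (2 * P * sg ^+ 2) * pi.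
  have M0 : 0 <= 1 / (2 * P * sg ^+ 2) by rewrite divr_ge0 // !mulr_ge0 ?sqr_ge0 // ltW.
  have [xpi|xpi] := leP x pi.
    have := @mean_value_bound W dW x pi _ xpi M0.
    rewrite Wpi sub0r normrN => /(_ _)/le_trans; apply.
      by move=> y yx; apply: dWE; lra.
    by rewrite ler_wpM2l //; lra.
  have := @mean_value_bound W dW pi x _ (ltW xpi) M0.
  rewrite Wpi subr0 => /(_ _)/le_trans; apply.
    by move=> y yx; apply: dWE; lra.
  by rewrite ler_wpM2l //; lra.
have sx : sg <= sin (2^-1 * x) by apply: sgx; rewrite x1.
have sx0 : 0 < sin (2^-1 * x) by apply: lt_le_trans sx.
have cx : `|cos ((N%:R + 2^-1) * x) * (P * sin (2^-1 * x))^-1| <= (P * sg)^-1.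
  rewrite normrM normfV (gtr0_norm (mulr_gt0 P0 sx0)) -[leRHS]mul1r.
  apply: ler_pM => //; [by rewrite invr_ge0 ltW // mulr_gt0|exact: cos_abs_le1|].
  by rewrite lef_pV2 ?posrE ?mulr_gt0 // ler_wpM2l // ltW.
have -> : sin_sum N x - (pi - x) / 2 = W x - cos ((N%:R + 2^-1) * x) * (P * sin (2^-1 * x))^-1.
  by rewrite /W addrK.
apply: le_trans (ler_normB _ _) _; apply: le_trans (lerD Wx cx) _.
rewrite le_eqVlt; apply/orP; left; apply/eqP; rewrite -/P; field.
by rewrite !gt_eqF.
Qed.

(** The sum of (1 - cos (k b)) / k ^ 2 is b (2 pi - b) / 4, by integrating the sawtooth
series.  The integral starts at a small a > 0, near which the series does not
converge uniformly; there the partial sums are only used through their sign.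
A lower bound suffices, the upper one being Bessel's inequality. *)
Lemma vers_sum_lb (b eps : R) : 0 < b < 2 * pi -> 0 < eps ->
  exists N, b * (2 * pi - b) / 4 - eps <= vers_sum N b.
Proof.
move=> /andP[b0 b2] e0; have p0 := pi_gt0 R.
pose a := Num.min (Num.min b (2 * pi - b)) (Num.min pi (eps / pi)).
have a0 : 0 < a by rewrite /a !lt_min b0 subr_gt0 b2 p0 divr_gt0.
have ab : a <= b by rewrite /a !ge_min lexx.
have a2b : a <= 2 * pi - b by rewrite /a !ge_min lexx orbT.
have api : a <= pi by rewrite /a !ge_min lexx orbT.
have ae : a * pi <= eps by rewrite -ler_pdivlMr // /a !ge_min lexx !orbT.
have [C [C0 HC]] := sin_sum_bound a0 api.
pose N := (Num.bound (C * (2 * pi) / eps)); exists N.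
pose f (x : R) := vers_sum N x - x * (2 * pi - x) / 4.
have df (x : R) : is_derive x 1 f (sin_sum N x - (pi - x) / 2).
  have := derD (der_vers_sum N x) (derN (derM (derM (is_derive_id x 1)
    (derD (is_derive_cst (2 * pi : R) x 1) (derN (is_derive_id x 1)))) (is_derive_cst (4^-1 : R) x 1))).
  by move/is_derive_eq; apply; rewrite /cst /=; field.
have P0 : 0 < 2 * N%:R + 1 :> R by rewrite ltr_wpDl // mulr_ge0.
have M0 : 0 <= C / (2 * N%:R + 1) by rewrite divr_ge0 // ltW.
have hab x : a <= x <= b -> `|sin_sum N x - (pi - x) / 2| <= C / (2 * N%:R + 1).
  by move=> /andP[x1 x2]; apply: HC; lra.
have h := @mean_value_bound f _ a b _ ab M0 (fun x xab => conj (df x) (hab x xab)).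
have hN : C / (2 * N%:R + 1) * (b - a) <= eps / 2.
  have bN : C * (2 * pi) / eps < N%:R by apply: archi_boundP; rewrite divr_ge0 ?mulr_ge0 // ltW.
  rewrite ltr_pdivrMr // in bN.
  rewrite mulrAC ler_pdivrMr //.
  have : C * (b - a) <= C * (2 * pi) by rewrite ler_wpM2l //; lra.
  have : 0 <= N%:R :> R by []. nra.
have va : 0 <= vers_sum N a.
  apply: sumr_ge0 => k _; rewrite divr_ge0 ?sqr_ge0 // subr_ge0 cos_le1 //.
have := le_trans h hN; rewrite ler_norml /f => /andP[h1 _].
have : a * (2 * pi - a) / 4 <= eps / 2 by nra.
lra.
Qed.

End CosineSeries.

(** * The Hartley basis on a circle *)

Section Trig.
Context {R : realType}.
Notation mu1 := (@lebesgue_measure R).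

Lemma Rintegral_deriv (F f : R -> R) (a b : R) : a <= b ->
  (forall x : R, is_derive x 1 F (f x)) -> continuous f ->
  \int[mu1]_(x in `[a, b]) f x = F b - F a.
Proof.
move=> ab dF cf; move: ab; rewrite le_eqVlt => /predU1P[<-|ab].
  by rewrite set_itv1 Rintegral_set1 subrr.
have cF : continuous F by move=> x; exact: cont_der (dF x).
rewrite /Rintegral (@continuous_FTC2 _ f F a b) //.
- exact: continuous_subspaceT.
- split => //.
  + by apply: cvg_at_right_filter; exact: cF.
  + by apply: cvg_at_left_filter; exact: cF.
- by move=> x _; rewrite derive1E; case: (dF x).
Qed.

Lemma continuous_cosM (c : R) : continuous (fun x : R => cos (c * x)).
Proof. by move=> x; exact: cont_der (@der_scal R cos (fun x => - sin x) c x (@is_derive_cos R)). Qed.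

Lemma continuous_sinM (c : R) : continuous (fun x : R => sin (c * x)).
Proof. by move=> x; exact: cont_der (@der_scal R sin cos c x (@is_derive_sin R)). Qed.

Lemma Rintegral_cosM (c b : R) : c != 0 -> 0 <= b ->
  \int[mu1]_(x in `[0, b]) cos (c * x) = sin (c * b) / c.
Proof.
move=> c0 b0.
have dF (x : R) : is_derive x 1 (fun x => c^-1 * sin (c * x)) (cos (c * x)).
  apply: (is_derive_eq (derZc c^-1 (@der_scal R sin cos c x (@is_derive_sin R)))).
  by rewrite mulKf.
rewrite (Rintegral_deriv b0 dF (@continuous_cosM c)).
by rewrite mulr0 sin0 mulr0 subr0 mulrC.
Qed.

Lemma Rintegral_sinM (c b : R) : c != 0 -> 0 <= b ->
  \int[mu1]_(x in `[0, b]) sin (c * x) = (1 - cos (c * b)) / c.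
Proof.
move=> c0 b0.
have dF (x : R) : is_derive x 1 (fun x => (- c^-1) * cos (c * x)) (sin (c * x)).
  apply: (is_derive_eq (derZc (- c^-1) (@der_scal R cos (fun x => - sin x) c x (@is_derive_cos R)))).
  by field.
rewrite (Rintegral_deriv b0 dF (@continuous_sinM c)).
by rewrite mulr0 cos0; field.
Qed.

Variable delta : R.
Hypothesis delta0 : 0 < delta.
Let P : R := 2 * pi * delta.
Let P0 : 0 < P. Proof. by rewrite !mulr_gt0 // pi_gt0. Qed.
Definition period_cell : set (measurableTypeR R) := `[0, 2 * pi * delta].
Local Notation I := period_cell.

Lemma measurable_period_cell : measurable I. Proof. exact: measurable_itv. Qed.
Lemma mu_period_cell : mu1 I = P%:E.
Proof. by rewrite /period_cell lebesgue_measure_itv /= lte_fin -/P P0 -EFinB subr0. Qed.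
Lemma period_cell_fin : (mu1 I < +oo)%E.
Proof. by rewrite mu_period_cell ltry. Qed.

Local Notation mI := measurable_period_cell.
Local Notation finI := period_cell_fin.

(** Normalised Hartley functions: a single real orthonormal family indexed by the
integers, which spans the same space as the complex exponentials. *)
Definition cas (n : int) (x : R) : R :=
  (cos (n%:~R / delta * x) + sin (n%:~R / delta * x)) / Num.sqrt P.

Lemma continuous_cas n : continuous (cas n).
Proof.
move=> x; have h := @contD R (fun x => cos (n%:~R / delta * x))
  (fun x => sin (n%:~R / delta * x)) x (@continuous_cosM _ x) (@continuous_sinM _ x).
exact: (contM h (@cst_continuous _ _ (Num.sqrt P)^-1 x)).
Qed.

Lemma measurable_continuous (f : R -> R) (A : set (measurableTypeR R)) :
  continuous f -> measurable_fun A (f : measurableTypeR R -> R).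
Proof.
move=> /continuous_measurable_fun mf.
by apply: (@measurable_funTS _ _ (measurableTypeR R) R); exact: mf.
Qed.

Lemma sqrtP_gt0 : 0 < Num.sqrt P. Proof. by rewrite sqrtr_gt0. Qed.

Lemma cas_bnd n x : `|cas n x| <= 2 / Num.sqrt P.
Proof.
have s0 := sqrtP_gt0.
rewrite /cas normrM normfV (gtr0_norm s0) ler_pM2r ?invr_gt0 //.
apply: le_trans (ler_normD _ _) _; have := cos_abs_le1 (n%:~R / delta * x).
have : `|sin (n%:~R / delta * x)| <= 1 by rewrite ler_norml sin_geN1 sin_le1.
lra.
Qed.

Lemma sqitg_cas n : sqitg mu1 I (cas n).
Proof.
apply: (@sqitg_bnd _ _ R mu1 I mI finI (cas n) (2 / Num.sqrt P)); last first.
  by move=> x _; exact: cas_bnd.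
by apply: measurable_continuous; exact: continuous_cas.
Qed.

Lemma itg_continuous (f : R -> R) b : continuous f -> mu1.-integrable (`[0, b] : set (measurableTypeR R)) (EFin \o f).
Proof.
move=> cf; apply: continuous_compact_integrable; first exact: segment_compact.
exact: continuous_subspaceT.
Qed.

Lemma intr_delta_neq0 (k : int) : k != 0 -> k%:~R / delta != 0 :> R.
Proof. by move=> k0; rewrite mulf_neq0 ?invr_eq0 ?intr_eq0 // gt_eqF. Qed.

Lemma sin_int_2pi (k : int) : sin (k%:~R / delta * P) = 0.
Proof.
have -> : k%:~R / delta * P = k%:~R * 2 * pi by rewrite /P; field; rewrite gt_eqF.
case: k => k; rewrite ?NegzE ?rmorphN /= ?mulNr ?sinN.
  by rewrite -[k%:~R]/(k%:R) -natrM sin_nat_pi.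
by rewrite -[k.+1%:~R]/(k.+1%:R) -natrM sin_nat_pi oppr0.
Qed.

Lemma cos_int_2pi (k : int) : cos (k%:~R / delta * P) = 1.
Proof.
have -> : k%:~R / delta * P = (k%:~R * pi) + k%:~R * pi.
  by rewrite /P; field; rewrite gt_eqF.
have s0 : sin (k%:~R * pi) = 0 :> R.
  case: k => k; rewrite ?NegzE ?rmorphN /= ?mulNr ?sinN.
    by rewrite -[k%:~R]/(k%:R) sin_nat_pi.
  by rewrite -[k.+1%:~R]/(k.+1%:R) sin_nat_pi oppr0.
by rewrite cosD s0 mulr0 subr0 -expr2; have := cos2Dsin2 (k%:~R * pi : R); rewrite s0 expr0n addr0.
Qed.

Lemma cas_orthonormal i j : ip mu1 I (cas i) (cas j) = (i == j)%:R.
Proof.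
pose f x := P^-1 * (cos ((i - j)%:~R / delta * x) + sin ((i + j)%:~R / delta * x)).
have -> : ip mu1 I (cas i) (cas j) = \int[mu1]_(x in I) f x.
  apply: eq_Rintegral => x _; rewrite /cas /f.
  have -> : P^-1 = (Num.sqrt P)^-1 * (Num.sqrt P)^-1.
    by rewrite -invfM -expr2 sqr_sqrtr // ltW.
  rewrite rmorphB rmorphD /= !mulrBl !mulrDl cosB sinD; ring.
have ic : itg mu1 I (fun x => cos ((i - j)%:~R / delta * x)).
  by apply: itg_continuous; exact: continuous_cosM.
have is' : itg mu1 I (fun x => sin ((i + j)%:~R / delta * x)).
  by apply: itg_continuous; exact: continuous_sinM.
rewrite RintegralZl; [|exact: mI|exact: (itgD mI ic is')].
rewrite RintegralD; [|exact: mI|exact: ic|exact: is'].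
have sin_int k : \int[mu1]_(x in I) sin (k%:~R / delta * x) = 0.
  have [->|k0] := eqVneq k 0.
    under eq_Rintegral do rewrite mul0r mul0r sin0.
    by rewrite Rintegral_cst ?mul0r //; exact: mI.
  by rewrite Rintegral_sinM ?intr_delta_neq0 // -/P ?cos_int_2pi ?subrr ?mul0r // ltW.
rewrite sin_int addr0; have [->|ij] := eqVneq i j.
  rewrite subrr; under eq_Rintegral do rewrite mul0r mul0r cos0.
  rewrite Rintegral_cst; last exact: mI.
  rewrite mul1r (_ : fine _ = P); last exact: (congr1 fine mu_period_cell).
  rewrite mulVf //.
  by rewrite gt_eqF.
rewrite Rintegral_cosM ?intr_delta_neq0 ?subr_eq0 // -/P ?sin_int_2pi ?mul0r ?mulr0 //.
exact: ltW.
Qed.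

Definition ind (b : R) : R -> R := \1_(`[0, b]).

Lemma sqitg_ind b : sqitg mu1 I (ind b).
Proof.
apply: (@sqitg_bnd _ _ R mu1 I mI finI (ind b) 1).
  by apply: measurable_indic; exact: measurable_itv.
by move=> x _; rewrite /ind indicE; case: (_ \in _); rewrite ?normr1 ?normr0.
Qed.

Lemma ip_ind b g : 0 <= b <= P -> ip mu1 I (ind b) g = \int[mu1]_(x in `[0, b]) g x.
Proof.
move=> /andP[b0 bP].
have -> : [set` `[0, b]] = I `&` [set` `[0, b]].
  apply/seteqP; split => [x /= xb|x []//]; split => //.
  move: xb; rewrite /period_cell /= !in_itv /= => /andP[-> xb] /=.
  exact: le_trans bP.
rewrite Rintegral_mkcondr; apply: eq_Rintegral => x _.
by rewrite /ind indicE patchE; case: (x \in _); rewrite ?mul1r ?mul0r.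
Qed.

Local Notation coefI := (coef mu1 I cas).
Local Notation defectI := (defect mu1 I cas).
Local Notation parsevalI := (parseval mu1 I cas).

Lemma fine_mu_itv (b : R) : 0 <= b -> fine (mu1 [set` `[0, b]]) = b.
Proof.
rewrite le_eqVlt => /predU1P[<-|b0]; first by rewrite set_itv1 lebesgue_measure_set1.
by rewrite lebesgue_measure_itv /= lte_fin b0 /= subr0.
Qed.

Lemma ip_ind_ind b : 0 <= b <= P -> ip mu1 I (ind b) (ind b) = b.
Proof.
move=> bP; rewrite ip_ind //; have /andP[b0 _] := bP.
rewrite (@eq_Rintegral _ _ _ _ _ (fun=> 1)); last first.
  by move=> x xb; rewrite /ind indicE xb.
by rewrite Rintegral_cst ?mul1r ?fine_mu_itv //; exact: measurable_itv.
Qed.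

Lemma coef_ind0 b : 0 <= b <= P -> coefI (ind b) 0 = b / Num.sqrt P.
Proof.
move=> bP; rewrite /coef ip_ind //; have /andP[b0 _] := bP.
rewrite (@eq_Rintegral _ _ _ _ _ (fun=> (Num.sqrt P)^-1)); last first.
  by move=> x _; rewrite /cas !mul0r cos0 sin0 addr0 mul1r.
by rewrite Rintegral_cst ?fine_mu_itv 1?mulrC //; exact: measurable_itv.
Qed.

Lemma coef_ind b (n : int) : 0 <= b <= P -> n != 0 -> coefI (ind b) n =
  delta / n%:~R * (sin (n%:~R / delta * b) + 1 - cos (n%:~R / delta * b)) / Num.sqrt P.
Proof.
move=> bP n0; rewrite /coef ip_ind //; have /andP[b0 _] := bP.
have mb : measurable (`[0, b] : set (measurableTypeR R)) by exact: measurable_itv.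
have ic : itg mu1 `[0, b] (fun x => cos (n%:~R / delta * x)).
  by apply: itg_continuous; exact: continuous_cosM.
have is' : itg mu1 `[0, b] (fun x => sin (n%:~R / delta * x)).
  by apply: itg_continuous; exact: continuous_sinM.
rewrite /cas RintegralZr; [|exact: mb|exact: (itgD mb ic is')].
rewrite RintegralD; [|exact: mb|exact: ic|exact: is'].
rewrite Rintegral_cosM ?intr_delta_neq0 // Rintegral_sinM ?intr_delta_neq0 //.
have := sqrtP_gt0; have : n%:~R != 0 :> R by rewrite intr_eq0.
move=> nn s0; field; rewrite nn !gt_eqF //.
Qed.

Lemma zsum_coef_ind b N : 0 <= b <= P -> zsum N (fun n => coefI (ind b) n ^+ 2) =
  b ^+ 2 / P + 4 * delta ^+ 2 / P * vers_sum N (b / delta).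
Proof.
move=> bP; have PE : P = Num.sqrt P ^+ 2 by rewrite sqr_sqrtr // ltW.
elim: N => [|N IH].
  by rewrite zsum0 /vers_sum big_ord0 mulr0 addr0 coef_ind0 // expr_div_n -PE.
rewrite zsumS IH /vers_sum big_ord_recr /= -/(vers_sum N (b / delta)).
rewrite !coef_ind //; [|lia..].
rewrite rmorphN /= !mulNr sinN cosN -[N.+1%:~R]/(N.+1%:R).
have -> : N.+1%:R / delta * b = N.+1%:R * (b / delta) by rewrite mulrAC mulrA.
have nn : N.+1%:R != 0 :> R by rewrite pnatr_eq0.
move: (N.+1%:R : R) nn => c nn; set s := sin _; set co := cos _.
have s2 : s ^+ 2 = 1 - co ^+ 2 by have := cos2Dsin2 (c * (b / delta)); rewrite -/s -/co; lra.
rewrite !expr_div_n -PE.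
have Pn0 : P != 0 by rewrite gt_eqF.
have -> : (delta / - c * (- s + 1 - co)) ^+ 2 =
  delta ^+ 2 / c ^+ 2 * (s ^+ 2 + 1 + co ^+ 2 - 2 * s + 2 * s * co - 2 * co).
  by field; rewrite nn.
have -> : (delta / c * (s + 1 - co)) ^+ 2 =
  delta ^+ 2 / c ^+ 2 * (s ^+ 2 + 1 + co ^+ 2 + 2 * s - 2 * s * co - 2 * co).
  by field; rewrite nn.
by rewrite s2; field; rewrite nn.
Qed.

(** Indicators of initial segments have explicit coefficients, and their Parseval
identity is the value of the versine series. *)
Lemma parseval_ind b : 0 <= b <= P -> parsevalI (ind b).
Proof.
move=> bP; split; first exact: sqitg_ind.
move=> e e0; have /andP[b0 bP'] := bP.
have dE N : defectI N (ind b) = b - (b ^+ 2 / P + 4 * delta ^+ 2 / P * vers_sum N (b / delta)).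
  by rewrite /defect ip_ind_ind // zsum_coef_ind.
have v0 : vers_sum 0 (b / delta) = 0 by rewrite /vers_sum big_ord0.
(* At the end points, where the versine series is 0, the indicator is
   almost everywhere equal to a constant. *)
have [b00|bn0] := eqVneq b 0.
  by exists 0%N; rewrite dE v0 b00 expr0n /= mul0r mulr0 addr0 subr0 ltW.
have [bPP|bnP] := eqVneq b P.
  exists 0%N; rewrite dE v0 bPP mulr0 addr0 expr2 mulfK ?subrr ?ltW //.
  by rewrite gt_eqF.
have bb : 0 < b / delta < 2 * pi.
  have bgt0 : 0 < b by rewrite lt_def bn0.
  have bltP : b < P by rewrite lt_neqAle bnP.
  by rewrite divr_gt0 //= ltr_pdivrMr.
have c0 : 0 < 4 * delta ^+ 2 / P by rewrite divr_gt0 // mulr_gt0 // exprn_gt0.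
have [N hN] := vers_sum_lb bb (divr_gt0 e0 c0).
exists N; rewrite dE.
have := ler_wpM2l (ltW c0) hN.
have E1 : 4 * delta ^+ 2 / P * (e / (4 * delta ^+ 2 / P)) = e by rewrite mulrC divfK // gt_eqF.
have E2 : 4 * delta ^+ 2 / P * (b / delta * (2 * pi - b / delta) / 4) = b - b ^+ 2 / P.
  have dn0 : delta != 0 by rewrite gt_eqF.
  have pn0 : (pi : R) != 0 by rewrite gt_eqF // pi_gt0.
  by rewrite /P; move: (pi : R) pn0 => q qn0; field; rewrite dn0 qn0.
by rewrite mulrBr E1 E2; lra.
Qed.

End Trig.

(** * Completeness of the Hartley basis *)

Section Completeness.
Context {R : realType}.
Notation mu1 := (@lebesgue_measure R).
Variable delta : R.
Hypothesis delta0 : 0 < delta.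
Let P : R := 2 * pi * delta.
Let P0 : 0 < P. Proof. by rewrite !mulr_gt0 // pi_gt0. Qed.
Local Notation I := (period_cell delta).
Local Notation mI := (measurable_period_cell delta).
Local Notation finI := (period_cell_fin delta0).
Local Notation prs := (parseval mu1 I (cas delta)).
Local Notation sq := (sqitg mu1 I).
Let sE := sqitg_cas delta0.
Let oE := cas_orthonormal delta0.

Lemma in_period_cell x : I x = (0 <= x <= P) :> Prop.
Proof. by rewrite /period_cell /= in_itv. Qed.

Lemma sq_continuous (g : R -> R) : continuous g -> sq g.
Proof.
move=> cg; split; first exact: measurable_continuous.
by apply: itg_continuous => x; exact: (contX2 (cg x)).
Qed.

(** Uniform approximation of a continuous function by combinations of indicators of
initial segments, by taking the supremum of the points up to which it is
possible. *)
Lemma step_approx (g : R -> R) (e : R) : continuous g -> 0 < e ->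
  exists h, prs h /\ forall x, I x -> `|g x - h x| <= e.
Proof.
move=> cg e0.
pose good b := 0 <= b <= P /\ exists h, [/\ prs h,
  forall x, 0 <= x <= b -> `|g x - h x| <= e & forall x, b < x -> h x = 0].
have good0 : good 0.
  split; first by rewrite lexx ltW.
  exists (fun x => g 0 * ind 0 x); split.
  - by apply: (parsevalZ mI finI sE oE); apply: parseval_ind; rewrite // lexx ltW.
  - move=> x x0; have -> : x = 0 by lra.
    rewrite /ind indicE mem_set /= ?in_itv /= ?lexx // mulr1 subrr normr0 ltW //.
  - move=> x x0; rewrite /ind indicE memNset ?mulr0 //= in_itv /=; apply/negP; lra.
pose S := [set b | good b].
have supS : has_sup S.
  by split; [exists 0|exists P => b [/andP[_ bP] _]].
pose s := sup S.
have s0 : 0 <= s by apply: ub_le_sup => //; case: supS.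
have sP : s <= P by apply: ge_sup; [exists 0|move=> b [/andP[_ bP] _]].
have [r r0 hr] : exists2 r, 0 < r & forall x, `|x - s| < r -> `|g x - g s| <= e.
  have /cvgrPdist_le /(_ e e0) := cg s.
  move=> /nbhs_ballP [r /= r0 hr]; exists r => // x xs.
  by rewrite distrC; apply: hr; rewrite /ball /= distrC.
have [b [/andP[b0 bP] [h [ph h1 h2]]] sb] := sup_adherent r0 supS.
have sb' : s - r < b by [].
have bs : b <= s.
  apply: ub_le_sup; first by case: supS.
  by split; [rewrite b0|exists h].
pose b' := Num.min P (s + r / 2).
have bb' : b <= b' by rewrite /b' le_min bP; lra.
have b'P : b' <= P by rewrite /b' ge_min lexx.
have goodb' : good b'.
  split; first by rewrite (le_trans b0) // b'P.
  exists (fun x => h x + (g s * ind b' x + (- g s) * ind b x)); split.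
  - apply: (parsevalD mI finI sE oE ph).
    apply: (parsevalD mI finI sE oE).
      by apply: (parsevalZ mI finI sE oE); apply: parseval_ind; rewrite // b'P (le_trans b0).
    by apply: (parsevalZ mI finI sE oE); apply: parseval_ind; rewrite // b0.
  - move=> x /andP[x0 xb'].
    have i1 : ind b' x = 1 by rewrite /ind indicE mem_set //= in_itv /= x0.
    have [xb|xb] := leP x b.
      have i2 : ind b x = 1 by rewrite /ind indicE mem_set //= in_itv /= x0.
      by rewrite i1 i2 !mulr1 subrr addr0; apply: h1; rewrite x0.
    have i2 : ind b x = 0 by rewrite /ind indicE memNset //= in_itv /= x0 /=; apply/negP; rewrite -ltNge.
    rewrite i1 i2 mulr1 mulr0 addr0 h2 // add0r; apply: hr.
    have : b' <= s + r / 2 by rewrite /b' ge_min lexx orbT.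
    by rewrite ltr_norml; move=> ?; apply/andP; split; lra.
  - move=> x xb'; rewrite h2; last by apply: le_lt_trans xb'.
    have i1 : ind b' x = 0.
      by rewrite /ind indicE memNset //= in_itv /=; apply/negP; rewrite negb_and -!ltNge xb' orbT.
    have i2 : ind b x = 0.
      rewrite /ind indicE memNset //= in_itv /=; apply/negP; rewrite negb_and -!ltNge orbC.
      by rewrite (le_lt_trans bb').
    by rewrite i1 i2 !mulr0 !addr0.
have b's : b' <= s by apply: ub_le_sup => //; case: supS.
have b'E : b' = P.
  by move: b's; rewrite /b' minEle; case: ifP => // _ h3; lra.
have [_ [h' [ph' h'1 _]]] := goodb'; exists h'; split=> // x.
by rewrite in_period_cell => xP; apply: h'1; rewrite b'E.
Qed.

Lemma parseval_continuous (g : R -> R) : continuous g -> prs g.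
Proof.
move=> cg; have sg := sq_continuous cg.
apply: (parseval_closed mI finI sE oE sg) => e e0.
pose eps := Num.sqrt (e / P).
have eP0 : 0 < e / P by rewrite divr_gt0.
have eps0 : 0 < eps by rewrite sqrtr_gt0.
have [h [ph gh]] := step_approx cg eps0; exists h; split=> //.
have [sh _] := ph.
apply: le_trans (ip_le mI (sqitgB mI sg sh) (sqitg_cst mI finI eps) _) _.
  by move=> x Ix; rewrite (gtr0_norm eps0); exact: gh.
rewrite /ip Rintegral_cst; last exact: mI.
rewrite (_ : fine _ = P); last exact: (congr1 fine (mu_period_cell delta0)).
have -> : eps * eps = e / P by rewrite -expr2 sqr_sqrtr // ltW.
by rewrite divfK // gt_eqF.
Qed.

(** Truncation of the values; it makes an approximation in mean of a bounded
function an approximation in square mean. *)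
Definition clamp (M x : R) : R := Num.max (- M) (Num.min x M).

Lemma clamp_bnd M x : 0 <= M -> `|clamp M x| <= M.
Proof.
move=> M0; rewrite /clamp ler_norml le_max lexx /= ge_max ge_min lexx orbT andbT; lra.
Qed.

Lemma clamp_id M x : `|x| <= M -> clamp M x = x.
Proof.
rewrite ler_norml => /andP[h1 h2]; rewrite /clamp (min_idPl h2).
by apply/max_idPr.
Qed.

Lemma clamp_cases M x : 0 <= M ->
  [\/ x < - M /\ clamp M x = - M, - M <= x <= M /\ clamp M x = x | M < x /\ clamp M x = M].
Proof.
move=> M0; have [xM|xM] := ltP x (- M).
  by apply: Or31; split=> //; rewrite /clamp (min_idPl _) ?(max_idPl _) //; lra.
have [Mx|Mx] := ltP M x.
  by apply: Or33; split=> //; rewrite /clamp (min_idPr _) ?(max_idPr _) //; lra.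
by apply: Or32; split; rewrite ?clamp_id // ?ler_norml xM Mx.
Qed.

Lemma clamp_dist M a x : 0 <= M -> `|a| <= M -> `|a - clamp M x| <= `|a - x|.
Proof.
move=> M0; rewrite ler_norml => /andP[h1 h2].
have [[h ->]|[h ->]//|[h ->]] := clamp_cases x M0.
  by rewrite !ger0_norm; lra.
by rewrite !ler0_norm; lra.
Qed.

Lemma clamp_dist0 M a : 0 <= M -> `|a - clamp M a| <= `|a|.
Proof.
move=> M0; have [[h ->]|[h ->]|[h ->]] := clamp_cases a M0.
- by rewrite !ler0_norm; lra.
- by rewrite subrr normr0.
- by rewrite !ger0_norm; lra.
Qed.

Lemma continuous_clamp M (g : R -> R) : continuous g -> continuous (fun x => clamp M (g x)).
Proof.
move=> cg x; have h := @continuous_min R R g (fun=> M) x (cg x) (@cst_continuous _ _ M x).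
exact: (@continuous_max R R (fun=> - M) _ x (@cst_continuous _ _ (- M) x) h).
Qed.

(** Continuous functions are dense in L1; clamped at the bound of f they remain
continuous and approximate f in L2 as well. *)
Lemma parseval_bnd (f : R -> R) M : measurable_fun I f ->
  0 <= M -> (forall x, `|f x| <= M) -> prs f.
Proof.
move=> mf M0 fM; have sf : sq f by apply: (@sqitg_bnd _ _ R mu1 I mI finI f M).
apply: (parseval_closed mI finI sE oE sf) => e e0.
have [g [cg ig gl]] := approximation_continuous_integrable mI finI (sqitg_itg mI finI sf).
have M1 : 0 < 2 * M + 1 by lra.
have := gl; move=> /fine_cvgP [gfin /cvgrPdist_lt /(_ (e / (2 * M + 1)) (divr_gt0 e0 M1)) gd].
have [n _ /(_ n (leqnn n)) [nfin nd]] := (filterI gfin gd).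
pose k x := clamp M (g n x).
have ck : continuous k by apply: continuous_clamp; exact: cg.
exists k; split; first exact: parseval_continuous.
have sk := sq_continuous ck.
have ifg : itg mu1 I (fun x => f x - g n x).
  by apply: (itgB mI); [exact: (sqitg_itg mI finI sf)|exact: ig].
have ifg' : itg mu1 I (fun x => `|f x - g n x|) by exact: integrable_norm ifg.
have : ip mu1 I (fun x => f x - k x) (fun x => f x - k x) <=
    \int[mu1]_(x in I) (2 * M * `|f x - g n x|).
  apply: le_Rintegral.
  - exact: mI.
  - by apply: (sqitg_mul mI); exact: (sqitgB mI sf sk).
  - exact: (itgZ mI).
  - move=> x Ix; rewrite -expr2 -(real_normK (num_real (f x - k x))) expr2.
    apply: ler_pM => //; last by apply: clamp_dist => //; exact: fM.
    apply: le_trans (ler_normB _ _) _; have := clamp_bnd (g n x) M0; have := fM x.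
    by rewrite -/(k x); lra.
move=> /le_trans; apply.
rewrite RintegralZl; [|exact: mI|exact: ifg'].
have : \int[mu1]_(x in I) `|f x - g n x| <= e / (2 * M + 1).
  apply: ltW; move: nd => /=; rewrite sub0r normrN => /(le_lt_trans _); apply.
  exact: ler_norm.
have i0 : 0 <= \int[mu1]_(x in I) `|f x - g n x| by apply: Rintegral_ge0.
move: i0; clear -M1; move: (Rintegral _ _ _) => X X0.
by rewrite ler_pdivlMr // => h; lra.
Qed.

(** Truncating the values of f reduces the claim to bounded functions, by dominated
convergence. *)
Theorem parseval_L2 (f : R -> R) : sq f -> prs f.
Proof.
move=> sf; apply: (parseval_closed mI finI sE oE sf) => e e0.
pose k (n : nat) x := clamp n%:R (f x).
have mk n : measurable_fun I (k n).
  apply: measurable_maxr; first exact: measurable_cst.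
  by apply: measurable_minr; [case: sf|exact: measurable_cst].
have bk n x : `|k n x| <= n%:R by exact: clamp_bnd.
have pk n : prs (k n) by exact: (parseval_bnd (mk n) (ler0n _ n) (bk n)).
have sk n : sq (k n) by case: (pk n).
have dk n x : `|f x - k n x| <= `|f x| by exact: clamp_dist0.
have [mf f2] := sf.
have m1 n : measurable_fun I (fun x => ((f x - k n x) ^+ 2)%:E).
  by apply/measurable_EFinP; apply: measurable_funX; apply: measurable_funB.
have m2 : measurable_fun I (fun=> 0%E : \bar R) by exact: measurable_cst.
have m3 : {ae mu1, forall x, I x -> (fun n => ((f x - k n x) ^+ 2)%:E) @ \oo --> (0 : \bar R)%E}.
  apply/aeW => x _; apply: cvg_near_cst; near=> n.
  rewrite /k clamp_id ?subrr ?expr0n //; near: n; exact: nbhs_infty_ger.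
have m4 : {ae mu1, forall x n, I x -> (`|((f x - k n x) ^+ 2)%:E| <= (f x ^+ 2)%:E)%E}.
  apply/aeW => x n _ /=; rewrite lee_fin ger0_norm ?sqr_ge0 //.
  rewrite -(real_normK (num_real (f x - _))) -(real_normK (num_real (f x))).
  by rewrite ler_sqr ?nnegrE.
have [_ _] := dominated_convergence mI m1 m2 m3 f2 m4.
rewrite integral0 => H.
move: H => /fine_cvgP [gfin /cvgrPdist_lt /(_ e e0) gd].
have [n _ /(_ n (leqnn n)) nd] := gd.
exists (k n); split; first exact: pk.
move: nd; rewrite /= sub0r normrN => nd.
apply: ltW; apply: le_lt_trans nd.
have -> : ip mu1 I (fun x => f x - k n x) (fun x => f x - k n x) =
    \int[mu1]_(x in I) ((f x - k n x) ^+ 2).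
  by apply: eq_Rintegral => x _; rewrite expr2.
exact: ler_norm.
Unshelve. all: by end_near.
Qed.

End Completeness.

(** * Fourier coefficients of complex functions on a circle *)

Section ComplexParseval.
Context {R : realType}.
Notation mu1 := (@lebesgue_measure R).
Variable delta : R.
Hypothesis delta0 : 0 < delta.
Let P : R := 2 * pi * delta.
Let P0 : 0 < P. Proof. by rewrite !mulr_gt0 // pi_gt0. Qed.
Local Notation I := (period_cell delta).
Local Notation mI := (measurable_period_cell delta).
Local Notation finI := (period_cell_fin delta0).
Local Notation sq := (sqitg mu1 I).
Local Notation nip f := (ip mu1 I f f).
Implicit Types (g h : R -> R) (n : int).

Definition cosn n (x : R) : R := cos (n%:~R / delta * x).
Definition sinn n (x : R) : R := sin (n%:~R / delta * x).
Definition ca g n : R := ip mu1 I g (cosn n).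
Definition sb g n : R := ip mu1 I g (sinn n).
(** [cr g h n] and [ci g h n] are the real and imaginary parts of the n-th
Fourier coefficient of g + i h. *)
Definition cr g h n : R := P^-1 * \int[mu1]_(x in I) (g x * cosn n x + h x * sinn n x).
Definition ci g h n : R := P^-1 * \int[mu1]_(x in I) (h x * cosn n x - g x * sinn n x).

Lemma sq_cosn n : sq (cosn n).
Proof. by apply: sq_continuous; exact: continuous_cosM. Qed.
Lemma sq_sinn n : sq (sinn n).
Proof. by apply: sq_continuous; exact: continuous_sinM. Qed.

Lemma crE g h n : sq g -> sq h -> cr g h n = P^-1 * (ca g n + sb h n).
Proof.
move=> sg sh; rewrite /cr RintegralD //; first exact: mI.
  exact: (sqitg_mul mI sg (sq_cosn n)).
exact: (sqitg_mul mI sh (sq_sinn n)).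
Qed.

Lemma ciE g h n : sq g -> sq h -> ci g h n = P^-1 * (ca h n - sb g n).
Proof.
move=> sg sh; rewrite /ci RintegralB //; first exact: mI.
  exact: (sqitg_mul mI sh (sq_cosn n)).
exact: (sqitg_mul mI sg (sq_sinn n)).
Qed.

Lemma ca_opp g n : ca g (- n) = ca g n.
Proof. by apply: eq_Rintegral => x _; rewrite /cosn rmorphN !mulNr cosN. Qed.

Lemma sb_opp g n : sq g -> sb g (- n) = - sb g n.
Proof.
move=> sg; have h := ipZl mI (- 1) (sq_sinn n) sg.
rewrite /sb ipC [in RHS]ipC -[RHS]mulN1r; apply: etrans _ h.
by apply: eq_Rintegral => x _; rewrite /sinn rmorphN /= !mulNr sinN; ring.
Qed.

Lemma coef_cas g n : sq g -> coef mu1 I (cas delta) g n = (ca g n + sb g n) / Num.sqrt P.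
Proof.
move=> sg; rewrite /coef ipC.
have -> : ip mu1 I (cas delta n) g = ip mu1 I (fun x => (Num.sqrt P)^-1 * (cosn n x + sinn n x)) g.
  by apply: eq_Rintegral => x _; rewrite /cas -/P -/(cosn n x) -/(sinn n x); ring.
have sD := sqitgD mI (sq_cosn n) (sq_sinn n).
rewrite (ipZl mI) // (ipDl mI) //; [|exact: sq_cosn|exact: sq_sinn].
by rewrite [ip mu1 I (cosn n) g]ipC [ip mu1 I (sinn n) g]ipC mulrC.
Qed.

(** The complex coefficients and the Hartley ones differ, at n, by an odd function of
n; the symmetric sums of their squares agree. *)
Lemma pair_coef_sum g h N : sq g -> sq h ->
  P * zsum N (fun n => cr g h n ^+ 2 + ci g h n ^+ 2) =
  zsum N (fun n => coef mu1 I (cas delta) g n ^+ 2) +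
  zsum N (fun n => coef mu1 I (cas delta) h n ^+ 2).
Proof.
move=> sg sh; have Pn0 : P != 0 by rewrite gt_eqF.
pose od n := ca g n * sb h n - ca h n * sb g n - ca g n * sb g n - ca h n * sb h n.
have z0 : zsum N od = 0.
  by apply: zsum_odd => n; rewrite /od !ca_opp !sb_opp //; ring.
have -> : zsum N (fun n => coef mu1 I (cas delta) g n ^+ 2) +
  zsum N (fun n => coef mu1 I (cas delta) h n ^+ 2) =
  zsum N (fun n => coef mu1 I (cas delta) g n ^+ 2) +
  zsum N (fun n => coef mu1 I (cas delta) h n ^+ 2) + 2 / P * zsum N od.
  by rewrite z0 mulr0 addr0.
rewrite -!zsumZ -!zsumD; apply: eq_zsum => n.
rewrite crE // ciE // !coef_cas // !expr_div_n sqr_sqrtr ?ltW // /od.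
by field; rewrite Pn0.
Qed.

Lemma pair_bessel g h N : sq g -> sq h ->
  P * zsum N (fun n => cr g h n ^+ 2 + ci g h n ^+ 2) <= nip g + nip h.
Proof.
move=> sg sh; rewrite pair_coef_sum //.
have := defect_ge0 mI finI (sqitg_cas delta0) (cas_orthonormal delta0) N sg.
have := defect_ge0 mI finI (sqitg_cas delta0) (cas_orthonormal delta0) N sh.
rewrite /defect; lra.
Qed.

Lemma pair_parseval g h e : sq g -> sq h -> 0 < e -> exists N,
  nip g + nip h <= P * zsum N (fun n => cr g h n ^+ 2 + ci g h n ^+ 2) + e.
Proof.
move=> sg sh e0; have e2 : 0 < e / 2 by rewrite divr_gt0.
have [_ /(_ _ e2) [N1 h1]] := parseval_L2 delta0 sg.
have [_ /(_ _ e2) [N2 h2]] := parseval_L2 delta0 sh.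
exists (maxn N1 N2); rewrite pair_coef_sum //.
have h3 := le_trans (defect_anti mu1 I (cas delta) g (leq_maxl N1 N2)) h1.
have h4 := le_trans (defect_anti mu1 I (cas delta) h (leq_maxr N1 N2)) h2.
rewrite /defect in h3 h4; lra.
Qed.

Lemma ip_cst_cosn c n : ip mu1 I (fun=> c) (cosn n) = if n == 0 then c * P else 0.
Proof.
rewrite /ip; case: eqVneq => [->|n0].
  under eq_Rintegral do rewrite /cosn !mul0r cos0 mulr1.
  rewrite Rintegral_cst; last exact: mI.
  by congr (_ * _); exact: (congr1 fine (mu_period_cell delta0)).
rewrite RintegralZl; [|exact: mI|exact: (itg_continuous _ (@continuous_cosM _ _))].
by rewrite Rintegral_cosM ?intr_delta_neq0 ?(ltW P0) // (sin_int_2pi delta0) mul0r mulr0.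
Qed.

Lemma ip_cst_sinn c n : ip mu1 I (fun=> c) (sinn n) = 0.
Proof.
rewrite /ip; have [->|n0] := eqVneq n 0.
  under eq_Rintegral do rewrite /sinn !mul0r sin0 mulr0.
  by rewrite Rintegral_cst ?mul0r //; exact: mI.
rewrite RintegralZl; [|exact: mI|exact: (itg_continuous _ (@continuous_sinM _ _))].
by rewrite Rintegral_sinM ?intr_delta_neq0 ?(ltW P0) // (cos_int_2pi delta0) subrr mul0r mulr0.
Qed.

Lemma pair_coef_mean g h n : sq g -> sq h ->
  let g0 := fun x => g x - cr g h 0 in let h0 := fun x => h x - ci g h 0 in
  cr g0 h0 n = (if n == 0 then 0 else cr g h n) /\
  ci g0 h0 n = (if n == 0 then 0 else ci g h n).
Proof.
move=> sg sh g0 h0; have Pn0 : P != 0 by rewrite gt_eqF.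
have sc c := sqitg_cst mI finI c.
have sg0 : sq g0 := sqitgB mI sg (sc (cr g h 0)).
have sh0 : sq h0 := sqitgB mI sh (sc (ci g h 0)).
rewrite crE // ciE //.
have caE c f : sq f -> ca (fun x => f x - c) n = ca f n - (if n == 0 then c * P else 0).
  by move=> sf; rewrite /ca (ipBl mI sf (sc c) (sq_cosn n)) ip_cst_cosn.
have sbE c f : sq f -> sb (fun x => f x - c) n = sb f n.
  by move=> sf; rewrite /sb (ipBl mI sf (sc c) (sq_sinn n)) ip_cst_sinn subr0.
rewrite !caE // !sbE //.
case: eqVneq => [->|n0]; last by rewrite !subr0 -crE // -ciE.
have s0 f : sq f -> sb f 0 = 0.
  by move=> sf; have := sb_opp 0 sf; rewrite oppr0; lra.
by rewrite crE // ciE // !s0 //; split; field.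
Qed.

End ComplexParseval.

(** * Iterated integrals over rectangles *)

Section Rectangle.
Context d1 d2 (T1 : measurableType d1) (T2 : measurableType d2) (R : realType).
Variables (m1 : {sigma_finite_measure set T1 -> \bar R})
  (m2 : {sigma_finite_measure set T2 -> \bar R}).
Variables (A : set T1) (B : set T2).
Hypotheses (mA : measurable A) (mB : measurable B).

Let mAB : measurable (A `*` B). Proof. exact: measurableX. Qed.

Lemma patch_rectangle (F : T1 * T2 -> \bar R) y :
  (fun x => (F \_ (A `*` B)) (x, y)) =
  if y \in B then (fun x => F (x, y)) \_ A else cst 0%E.
Proof.
apply/funext => x; rewrite patchE.
have -> : ((x, y) \in A `*` B) = (x \in A) && (y \in B).
  apply/idP/andP; first by move/set_mem => -[/= ? ?]; split; exact: mem_set.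
  by move=> [/set_mem ? /set_mem ?]; apply: mem_set.
by case: (y \in B); rewrite ?andbT ?andbF ?patchE.
Qed.

Lemma inner_rectangle (F : T1 * T2 -> \bar R) :
  (fun y => \int[m1]_x (F \_ (A `*` B)) (x, y))%E =
  (fun y => \int[m1]_(x in A) F (x, y))%E \_ B.
Proof.
apply/funext => y; rewrite patch_rectangle patchE; case: ifPn => yB.
  by rewrite [RHS]integral_mkcond.
exact: integral0.
Qed.

Lemma tonelli_rectangle (F : T1 * T2 -> \bar R) : measurable_fun setT F ->
  (forall z, 0 <= F z)%E ->
  (\int[m1 \x m2]_(z in A `*` B) F z = \int[m2]_(y in B) \int[m1]_(x in A) F (x, y))%E
  /\ measurable_fun B (fun y => \int[m1]_(x in A) F (x, y))%E.
Proof.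
move=> mF F0.
have mf : measurable_fun setT (F \_ (A `*` B)).
  by apply/(measurable_restrictT _ mAB); exact: measurable_funTS.
have f0 z : (0 <= (F \_ (A `*` B)) z)%E by rewrite patchE; case: ifP.
split.
  rewrite integral_mkcond (fubini_tonelli2 _ mf f0) [RHS]integral_mkcond.
  by rewrite -inner_rectangle.
apply/(measurable_restrictT _ mB); rewrite -inner_rectangle.
exact: (measurable_fun_fubini_tonelli_G _ mf f0).
Qed.

(** Measurability holds without integrability: the integral is the difference of those
of the positive and negative parts, each of which is measurable by Tonelli's
theorem. *)
Lemma measurable_inner (F : T1 * T2 -> R) : measurable_fun setT F ->
  measurable_fun setT (fun y => \int[m1]_(x in A) F (x, y)).
Proof.
move=> mF; have mE : measurable_fun setT (EFin \o F) by exact/measurable_EFinP.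
have mpos (G : T1 * T2 -> \bar R) : measurable_fun setT G -> (forall z, 0 <= G z)%E ->
    measurable_fun setT (fun y => \int[m1]_(x in A) G (x, y))%E.
  move=> mG G0.
  have mf : measurable_fun setT (G \_ (A `*` setT)).
    apply/(measurable_restrictT _ (measurableX mA measurableT)).
    exact: measurable_funTS.
  have f0 z : (0 <= (G \_ (A `*` setT)) z)%E by rewrite patchE; case: ifP.
  have := measurable_fun_fubini_tonelli_G (m1 := m1) _ mf f0; apply: eq_measurable_fun => y _.
  rewrite /fubini_G [RHS]integral_mkcond; apply: eq_integral => x _.
  rewrite !patchE; have -> : ((x, y) \in A `*` setT) = (x \in A).
    by rewrite in_setX in_setT andbT.
  by [].
have h : measurable_fun setT (fun y => \int[m1]_(x in A) ((EFin \o F)^\+ (x, y)) -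
    \int[m1]_(x in A) ((EFin \o F)^\- (x, y)))%E.
  apply: emeasurable_funB; apply: mpos => //.
  - exact: measurable_funepos.
  - exact: measurable_funeneg.
suff h2 : measurable_fun setT (fun y => \int[m1]_(x in A) (F (x, y))%:E)%E.
  exact: (measurableT_comp (f := fine)).
by move: h; apply: eq_measurable_fun => y _; rewrite [RHS]integralE; congr (_ - _)%E; apply: eq_integral => x _; rewrite ?funeposE ?funenegE.
Qed.

Lemma ae_section (F : T1 * T2 -> R) : measurable_fun setT F ->
  (m1 \x m2)%E.-integrable (A `*` B) (EFin \o F) ->
  {ae m2, forall y, B y -> m1.-integrable A (EFin \o (fun x => F (x, y)))}.
Proof.
move=> mF iF.
have mE : measurable_fun setT (abse \o (EFin \o F)).
  by apply: measurableT_comp => //; exact/measurable_EFinP.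
have E0 z : (0 <= (abse \o (EFin \o F)) z)%E by exact: abse_ge0.
have [e mK] := tonelli_rectangle mE E0.
have iK : m2.-integrable B (fun y => \int[m1]_(x in A) (abse \o (EFin \o F)) (x, y))%E.
  apply/integrableP; split=> //.
  have -> : (\int[m2]_(y in B) `|\int[m1]_(x in A) (abse \o (EFin \o F)) (x, y)| =
     \int[m2]_(y in B) \int[m1]_(x in A) (abse \o (EFin \o F)) (x, y))%E.
    by apply: eq_integral => y _; rewrite gee0_abs // integral_ge0.
  by rewrite -e; move/integrableP: iF => [].
have := integrable_ae mB iK; apply: filterS => y h By.
apply/integrableP; split.
  apply: measurable_funTS; apply/measurable_EFinP.
  exact: measurableT_comp mF (pair2_measurable y).
by have := h By; rewrite fin_numElt => /andP[].
Qed.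

(** Fubini's theorem for real-valued inner integrals, whose junk value 0 on the
null set of non-integrable sections is harmless. *)
Lemma fubini_rectangle (F : T1 * T2 -> R) : measurable_fun setT F ->
  (m1 \x m2)%E.-integrable (A `*` B) (EFin \o F) ->
  let r := fun y => \int[m1]_(x in A) F (x, y) in
  [/\ measurable_fun B r, m2.-integrable B (EFin \o r) &
   \int[(m1 \x m2)%E]_(z in A `*` B) F z = \int[m2]_(y in B) r y].
Proof.
move=> mF iF r.
pose f := (EFin \o F) \_ (A `*` B).
have if_ : (m1 \x m2)%E.-integrable setT f by move: iF; rewrite (integrable_mkcond _ mAB).
have mf : measurable_fun setT f := measurable_int _ if_.
pose G y := (\int[m1]_x f (x, y))%E.
pose H y := (\int[m1]_(x in A) (F (x, y))%:E)%E.
have GE : G = H \_ B := inner_rectangle (EFin \o F).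
have mG : measurable_fun setT G := measurable_fubini_G if_.
have mH : measurable_fun B H by apply/(measurable_restrictT _ mB); rewrite -GE.
have iG : m2.-integrable setT G.
  apply/integrableP; split=> //.
  have := if_; move=> /(integrable21ltyP m1 m2 mf); apply: le_lt_trans.
  apply: ge0_le_integral => //.
  - exact: measurableT_comp.
  - apply: (measurable_fun_fubini_tonelli_G (abse \o f)) => //.
    exact: measurableT_comp.
  - by move=> y; exact: abse_ge0.
  - move=> y _; apply: le_abse_integral => //.
    exact: measurableT_comp mf (pair2_measurable y).
have iH : m2.-integrable B H by rewrite (integrable_mkcond _ mB) -GE.
have rH y : r y = fine (H y) by [].
have mr : measurable_fun B r.
  by apply: (measurableT_comp (f := fine)) => //.
have ir : m2.-integrable B (EFin \o r).
  apply: (le_integrable mB _ _ iH); first exact/measurable_EFinP.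
  move=> y By /=; rewrite rH; case: (H y) => //=.
    by rewrite normr0 leey.
  by rewrite normr0 leey.
split=> //; rewrite /Rintegral; congr fine.
rewrite integral_mkcond -(integral21_prod_meas1 if_) -/G.
have -> : (\int[m2]_y G y = \int[m2]_(y in B) H y)%E by rewrite GE -integral_mkcond.
apply: ae_eq_integral => //; first exact/measurable_EFinP.
have := integrable_ae mB iH; apply: filterS => y h By.
by rewrite /= rH fineK // h.
Qed.

End Rectangle.

(** * Plancherel identity on the torus *)

Section AlmostEverywhere.
Context d (T : measurableType d) (R : realType).
Variables (m : {measure set T -> \bar R}) (D : set T).
Hypotheses (mD : measurable D).
Implicit Types (f g : T -> R).

(** Dominated convergence applied to the constant sequence f. *)
Lemma ae_le_itg f g : measurable_fun D f -> itg m D g ->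
  {ae m, forall x, D x -> `|f x| <= g x} -> itg m D f.
Proof.
move=> mf ig fg.
have mE : measurable_fun D (EFin \o f) by exact/measurable_EFinP.
have [] := dominated_convergence (f_ := fun=> EFin \o f) (f := EFin \o f)
  (g := EFin \o g) mD (fun=> mE) mE _ ig _ => //.
- by apply: aeW => x _; exact: cvg_cst.
- by apply: filterS fg => x fgx n Dx /=; rewrite lee_fin fgx.
Qed.

Lemma ae_eq_Rintegral f g : measurable_fun D f -> measurable_fun D g ->
  {ae m, forall x, D x -> f x = g x} ->
  \int[m]_(x in D) f x = \int[m]_(x in D) g x.
Proof.
move=> mf mg fg; rewrite /Rintegral; congr fine; apply: ae_eq_integral => //.
- exact/measurable_EFinP.
- exact/measurable_EFinP.
- by apply: filterS fg => x h Dx; rewrite h.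
Qed.

Lemma ae_le_Rintegral f g : itg m D f -> itg m D g ->
  {ae m, forall x, D x -> f x <= g x} ->
  \int[m]_(x in D) f x <= \int[m]_(x in D) g x.
Proof.
move=> if_ ig fg; have mf : measurable_fun D f by apply/measurable_EFinP; exact: measurable_int if_.
have mg : measurable_fun D g by apply/measurable_EFinP; exact: measurable_int ig.
pose h x := Num.max (f x) (g x).
have mh : measurable_fun D h by exact: measurable_maxr.
have ih : itg m D h.
  apply: (le_itg (g := fun x => `|f x| + `|g x|) mD mh) => [x _|].
    by rewrite /h maxEle; case: ifP => _; rewrite ?lerDl ?lerDr normr_ge0.
  exact: (itgD mD (integrable_norm if_) (integrable_norm ig)).
rewrite -(@ae_eq_Rintegral h g) //.
  by apply: le_Rintegral => // x _; rewrite /h le_max lexx.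
by apply: filterS fg => x h1 Dx; rewrite /h; apply/max_idPr/h1.
Qed.

(** Without integrability: if f has no integral, both sides are 0. *)
Lemma RintegralN f : \int[m]_(x in D) (- f x) = - \int[m]_(x in D) f x.
Proof.
rewrite /Rintegral integralE [in RHS]integralE.
have -> : (fun x => (- f x)%:E)^\+%E = ((fun x => (f x)%:E)^\-)%E.
  by apply/funext => x; rewrite funeposE funenegE EFinN.
have -> : (fun x => (- f x)%:E)^\-%E = ((fun x => (f x)%:E)^\+)%E.
  by apply/funext => x; rewrite funeposE funenegE EFinN oppeK.
move: (\int[m]_(x in D) _)%E (\int[m]_(x in D) ((fun x => (f x)%:E)^\+ x))%E => a b.
by case: a => [a||]; case: b => [b||] /=; rewrite ?oppr0 ?opprB.
Qed.

End AlmostEverywhere.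

Section ZsumIntegral.
Context d (T : measurableType d) (R : realType).
Variables (m : {measure set T -> \bar R}) (D : set T).
Hypotheses (mD : measurable D).

Lemma itg_zsum M (f : int -> T -> R) : (forall n, itg m D (f n)) ->
  itg m D (fun x => zsum M (fun n => f n x)).
Proof.
move=> hf; elim: M => [|M IH].
  by under [X in itg _ _ X]eq_fun do rewrite zsum0; exact: hf.
under [X in itg _ _ X]eq_fun do rewrite zsumS.
by apply: itgD => //; apply: itgD.
Qed.

Lemma Rintegral_zsum M (f : int -> T -> R) : (forall n, itg m D (f n)) ->
  \int[m]_(x in D) zsum M (fun n => f n x) = zsum M (fun n => \int[m]_(x in D) f n x).
Proof.
move=> hf; elim: M => [|M IH].
  by rewrite zsum0; under eq_Rintegral do rewrite zsum0.
under eq_Rintegral do rewrite zsumS.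
rewrite RintegralD //; [|exact: (itgD mD (hf _) (itg_zsum M hf))|exact: hf].
rewrite RintegralD //; [by rewrite IH zsumS|exact: hf|exact: itg_zsum].
Qed.

End ZsumIntegral.

Section Plane.
Context {R : realType}.
Notation mu1 := (@lebesgue_measure R).
Notation mu2 := (@lebesgue_measure R \x @lebesgue_measure R)%E.
Local Notation plane := (measurableTypeR R * measurableTypeR R)%type.
Variable delta : R.
Hypothesis delta0 : 0 < delta.
Let P : R := 2 * pi * delta.
Let S : R := 2 * pi * 1.
Let P0 : 0 < P. Proof. by rewrite !mulr_gt0 // pi_gt0. Qed.
Let S0 : 0 < S. Proof. by rewrite !mulr_gt0 // pi_gt0. Qed.
Local Notation I := (period_cell delta).
Local Notation J := (period_cell 1).
Local Notation mI := (measurable_period_cell delta).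
Local Notation mJ := (measurable_period_cell 1).
Local Notation C := (I `*` J).
Implicit Types (g h : plane -> R) (m n : int).

Lemma measurable_rect : measurable (C : set plane).
Proof. exact: (measurableX mI mJ). Qed.
Local Notation mC := measurable_rect.

Lemma rect_fin : (mu2 C < +oo)%E.
Proof.
rewrite product_measure1E; [|exact: mI|exact: mJ].
have := period_cell_fin delta0; have := @period_cell_fin R _ ltr01.
by move=> h1 h2; apply: lte_mul_pinfty; rewrite ?ge0_fin_numE.
Qed.

Definition psq g := measurable_fun setT g /\ sqitg mu2 C g.

Lemma psqZ c g : psq g -> psq (fun z => c * g z).
Proof.
move=> [mg sg]; split; last exact: (sqitgZ mC).
by apply: measurable_funM => //; exact: measurable_cst.
Qed.

Lemma psqD g h : psq g -> psq h -> psq (fun z => g z + h z).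
Proof.
by move=> [mg sg] [mh sh]; split; [exact: measurable_funD|exact: (sqitgD mC)].
Qed.

Lemma psqB g h : psq g -> psq h -> psq (fun z => g z - h z).
Proof.
by move=> [mg sg] [mh sh]; split; [exact: measurable_funB|exact: (sqitgB mC)].
Qed.

Lemma psqM_bnd g (w : plane -> R) c : psq g -> measurable_fun setT w ->
  (forall z, `|w z| <= c) -> psq (fun z => g z * w z).
Proof.
move=> [mg sg] mw wc; split; first exact: measurable_funM.
by apply: (sqitgM_bnd mC (c := c)) => //; exact: measurable_funTS.
Qed.

Lemma psq_snd (u : R -> R) : measurable_fun setT (u : measurableTypeR R -> R) ->
  sqitg mu1 J u -> psq (fun z => u z.2).
Proof.
move=> mu su.
have m2 : measurable_fun setT (fun z : plane => u z.2) by exact: measurableT_comp.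
split => //; split; first exact: measurable_funTS.
have mF : measurable_fun setT (fun z : plane => (u z.2 ^+ 2)%:E).
  by apply/measurable_EFinP; exact: measurable_funX.
have F0 (z : plane) : (0 <= (u z.2 ^+ 2)%:E)%E by rewrite lee_fin sqr_ge0.
apply/integrableP; split; first exact: measurable_funTS.
rewrite (eq_integral (fun z : plane => (u z.2 ^+ 2)%:E)); last first.
  by move=> z _; rewrite /= ger0_norm ?sqr_ge0.
have [-> _] := tonelli_rectangle mu1 mu1 mI mJ mF F0.
have ip : itg mu1 J (fun y => P * u y ^+ 2) := itgZ mJ P su.2.
have /integrableP[_] := ip; apply: le_lt_trans.
rewrite le_eqVlt; apply/orP; left; apply/eqP; apply: eq_integral => y _ /=.
rewrite integral_cst; last exact: mI.
transitivity ((u y ^+ 2)%:E * P%:E)%E; first by congr (_ * _)%E; exact: mu_period_cell.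
rewrite ger0_norm; first by rewrite mulrC EFinM.
by apply: mulr_ge0; [exact: ltW|exact: sqr_ge0].
Qed.

(** The Fourier coefficient in x of the row at height y, as a function of y. *)
Definition row_re g h m (y : R) : R := cr delta (fun x => g (x, y)) (fun x => h (x, y)) m.
Definition row_im g h m (y : R) : R := ci delta (fun x => g (x, y)) (fun x => h (x, y)) m.
Definition row_sq g (y : R) : R := ip mu1 I (fun x => g (x, y)) (fun x => g (x, y)).

Lemma measurable_fst_comp (f : R -> R) : continuous f ->
  measurable_fun setT (fun z : plane => f z.1).
Proof.
by move=> cf; apply: (measurableT_comp (f := f)); [exact: measurable_continuous|exact: measurable_fst].
Qed.

Lemma row_imE g h m y : row_im g h m y = row_re h (fun z => - 1 * g z) m y.
Proof. by congr (_ * _); apply: eq_Rintegral => x _; rewrite mulN1r mulNr. Qed.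

Lemma measurable_row_re g h m : psq g -> psq h ->
  measurable_fun setT (row_re g h m : measurableTypeR R -> R).
Proof.
move=> [mg _] [mh _]; apply: measurable_funM; first exact: measurable_cst.
apply: (measurable_inner mu1 mI (F := fun z : plane =>
  g z * cosn delta m z.1 + h z * sinn delta m z.1)).
apply: measurable_funD; apply: measurable_funM => //; apply: measurable_fst_comp.
- exact: continuous_cosM.
- exact: continuous_sinM.
Qed.

Lemma ae_row_sq g : psq g ->
  {ae mu1, forall y, J y -> sqitg mu1 I (fun x => g (x, y))}.
Proof.
move=> [mg sg].
have mg2 : measurable_fun setT (fun z : plane => g z ^+ 2) by exact: measurable_funX.
have := ae_section mI mJ mg2 sg.2; apply: filterS => y h Jy.
split; last exact: h.
by apply: measurable_funTS; exact: measurableT_comp mg (pair2_measurable y).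
Qed.

Lemma row_sq_integral g : psq g ->
  itg mu1 J (row_sq g) /\ \int[mu1]_(y in J) row_sq g y = ip mu2 C g g.
Proof.
move=> [mg sg].
have mg2 : measurable_fun setT (fun z : plane => g z * g z) by exact: measurable_funM.
by have [_ h1 h2] := fubini_rectangle mI mJ mg2 (sqitg_mul mC sg sg).
Qed.

Lemma ae_row_bessel g h M : psq g -> psq h -> {ae mu1, forall y, J y ->
  P * zsum M (fun m => row_re g h m y ^+ 2 + row_im g h m y ^+ 2) <= row_sq g y + row_sq h y}.
Proof.
move=> hg hh; apply: filterS2 (ae_row_sq hg) (ae_row_sq hh) => y s1 s2 Jy.
exact: (pair_bessel delta0 M (s1 Jy) (s2 Jy)).
Qed.

Lemma sqitg_row_re g h m : psq g -> psq h -> sqitg mu1 J (row_re g h m).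
Proof.
move=> hg hh; have mr := measurable_row_re m hg hh.
split; first exact: measurable_funTS.
have iq : itg mu1 J (fun y => P^-1 * (row_sq g y + row_sq h y)).
  exact: (itgZ mJ _ (itgD mJ (row_sq_integral hg).1 (row_sq_integral hh).1)).
apply: (ae_le_itg mJ _ iq); first by apply: measurable_funTS; exact: measurable_funX.
have := ae_row_bessel `|m|%N hg hh; apply: filterS => y hy Jy.
rewrite ger0_norm ?sqr_ge0 // ler_pdivlMl //; apply: le_trans (hy Jy).
rewrite ler_pM2l //.
have f0 k : 0 <= row_re g h k y ^+ 2 + row_im g h k y ^+ 2 by rewrite addr_ge0 ?sqr_ge0.
apply: le_trans (le_zsum_term m f0).
by rewrite lerDl sqr_ge0.
Qed.

Lemma sqitg_row_im g h m : psq g -> psq h -> sqitg mu1 J (row_im g h m).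
Proof.
move=> hg hh; have := sqitg_row_re m hh (psqZ (- 1) hg).
by have -> : row_im g h m = row_re h (fun z => - 1 * g z) m by apply/funext => y; exact: row_imE.
Qed.

Lemma measurable_row_im g h m : psq g -> psq h ->
  measurable_fun setT (row_im g h m : measurableTypeR R -> R).
Proof.
move=> hg hh; have := measurable_row_re m hh (psqZ (- 1) hg).
by have -> : row_im g h m = row_re h (fun z => - 1 * g z) m by apply/funext => y; exact: row_imE.
Qed.

Definition phase m n (z : plane) : R := m%:~R / delta * z.1 + n%:~R * z.2.
(** [Fr g h m n] and [Fi g h m n] are the real and imaginary parts of the
Fourier coefficient (m, n) of g + i h on the torus. *)
Definition Fr g h m n : R := (P * (2 * pi))^-1 *
  \int[mu2]_(z in C) (g z * cos (phase m n z) + h z * sin (phase m n z)).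
Definition Fi g h m n : R := (P * (2 * pi))^-1 *
  \int[mu2]_(z in C) (h z * cos (phase m n z) - g z * sin (phase m n z)).

Lemma measurable_phase m n : measurable_fun setT (phase m n).
Proof.
apply: measurable_funD; apply: measurable_funM => //.
Qed.

Lemma psq_phase g m n : psq g ->
  psq (fun z => g z * cos (phase m n z)) /\ psq (fun z => g z * sin (phase m n z)).
Proof.
move=> hg; split; apply: (psqM_bnd (c := 1)) => //.
- apply: (measurableT_comp (f := @cos R)); last exact: measurable_phase.
  by apply: measurable_continuous; exact: continuous_cos.
- by move=> z; exact: cos_abs_le1.
- apply: (measurableT_comp (f := @sin R)); last exact: measurable_phase.
  by apply: measurable_continuous; exact: continuous_sin.
- by move=> z; rewrite ler_norml sin_geN1 sin_le1.
Qed.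

(** The coefficient on the torus is that in y of the coefficients in x of the rows. *)
Lemma Fr_row g h m n : psq g -> psq h ->
  Fr g h m n = cr 1 (row_re g h m) (row_im g h m) n.
Proof.
move=> hg hh.
have [mF sF] : psq (fun z => g z * cos (phase m n z) + h z * sin (phase m n z)).
  have [h1 _] := psq_phase m n hg; have [_ h2] := psq_phase m n hh.
  exact: psqD.
have iF := sqitg_itg mC rect_fin sF.
have [mr ir e] := fubini_rectangle mI mJ mF iF.
have {}e : \int[mu2]_(z in C) (g z * cos (phase m n z) + h z * sin (phase m n z)) =
  \int[mu1]_(y in J) \int[mu1]_(x in I)
    (g (x, y) * cos (phase m n (x, y)) + h (x, y) * sin (phase m n (x, y))) := e.
rewrite /Fr e /cr -/S.
have -> : (P * (2 * pi))^-1 = S^-1 * P^-1 by rewrite invfM mulrC /S mulr1.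
rewrite -mulrA; congr (_ * _); rewrite -RintegralZl //; last exact: mJ.
have s1 := sqitg_mul mJ (sqitg_row_re m hg hh) (sq_cosn 1 n).
have s2 := sqitg_mul mJ (sqitg_row_im m hg hh) (sq_sinn 1 n).
apply: ae_eq_Rintegral; first exact: mJ.
- by apply: measurable_funM => //; exact: measurable_cst.
- by apply/measurable_EFinP; exact: measurable_int (itgD mJ s1 s2).
apply: filterS2 (ae_row_sq hg) (ae_row_sq hh) => y sg sh Jy.
move: (sg Jy) (sh Jy) => {}sg {}sh.
have i1 := sqitg_mul mI sg (sq_cosn delta m).
have i2 := sqitg_mul mI sh (sq_sinn delta m).
have i3 := sqitg_mul mI sh (sq_cosn delta m).
have i4 := sqitg_mul mI sg (sq_sinn delta m).
have iX := itgD mI i1 i2; have iY := itgB mI i3 i4.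
have -> : \int[mu1]_(x in I) (g (x, y) * cos (phase m n (x, y)) + h (x, y) * sin (phase m n (x, y))) =
  cosn 1 n y * \int[mu1]_(x in I) (g (x, y) * cosn delta m x + h (x, y) * sinn delta m x) +
  sinn 1 n y * \int[mu1]_(x in I) (h (x, y) * cosn delta m x - g (x, y) * sinn delta m x).
  rewrite -(RintegralZl _ mI iX) -(RintegralZl _ mI iY).
  rewrite -(RintegralD mI (itgZ mI _ iX) (itgZ mI _ iY)).
  apply: eq_Rintegral => x _.
  by rewrite /phase /= cosD sinD /cosn /sinn divr1; ring.
by rewrite /row_re /row_im /cr /ci -/P; ring.
Qed.

Lemma FiE g h m n : Fi g h m n = Fr h (fun z => - 1 * g z) m n.
Proof. by congr (_ * _); apply: eq_Rintegral => z _; rewrite mulN1r mulNr. Qed.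

Lemma Fi_row g h m n : psq g -> psq h ->
  Fi g h m n = ci 1 (row_re g h m) (row_im g h m) n.
Proof.
move=> hg hh; rewrite FiE Fr_row //; last exact: psqZ.
congr (_ * _); apply: eq_Rintegral => y _; rewrite -!row_imE; congr (_ + _).
rewrite -mulNr; congr (_ * _); rewrite /row_im /row_re /ci /cr -mulrN; congr (_ * _).
by rewrite -RintegralN; apply: eq_Rintegral => x _; rewrite mulN1r mulNr opprD.
Qed.

Lemma itg_row_pair g h m : psq g -> psq h ->
  itg mu1 J (fun y => row_re g h m y ^+ 2 + row_im g h m y ^+ 2).
Proof.
by move=> hg hh; apply: (itgD mJ); [case: (sqitg_row_re m hg hh)|case: (sqitg_row_im m hg hh)].
Qed.

Lemma ip_row_pair g h m : psq g -> psq h ->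
  ip mu1 J (row_re g h m) (row_re g h m) + ip mu1 J (row_im g h m) (row_im g h m) =
  \int[mu1]_(y in J) (row_re g h m y ^+ 2 + row_im g h m y ^+ 2).
Proof.
move=> hg hh; have [_ i1] := sqitg_row_re m hg hh; have [_ i2] := sqitg_row_im m hg hh.
by rewrite (RintegralD mJ i1 i2).
Qed.

Lemma row_pair_sum g h M : psq g -> psq h ->
  P * zsum M (fun m => ip mu1 J (row_re g h m) (row_re g h m) +
                       ip mu1 J (row_im g h m) (row_im g h m)) =
  \int[mu1]_(y in J) (P * zsum M (fun m => row_re g h m y ^+ 2 + row_im g h m y ^+ 2)).
Proof.
move=> hg hh; have i m := itg_row_pair m hg hh.
rewrite (RintegralZl _ mJ (itg_zsum mJ M i)) (Rintegral_zsum mJ M i); congr (_ * _).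
by apply: eq_zsum => m; exact: ip_row_pair.
Qed.

(** The part of the energy carried by the x-frequency m. *)
Definition row_energy g h m : R :=
  ip mu1 J (row_re g h m) (row_re g h m) + ip mu1 J (row_im g h m) (row_im g h m).

Lemma row_energy_bessel g h m N : psq g -> psq h ->
  S * zsum N (fun n => Fr g h m n ^+ 2 + Fi g h m n ^+ 2) <= row_energy g h m.
Proof.
move=> hg hh.
have := pair_bessel ltr01 N (sqitg_row_re m hg hh) (sqitg_row_im m hg hh).
apply: le_trans; rewrite -/S ler_pM2l //.
by apply: ler_zsum => n; rewrite Fr_row // Fi_row.
Qed.

Lemma row_energy_sum_le g h M : psq g -> psq h ->
  P * zsum M (row_energy g h) <= ip mu2 C g g + ip mu2 C h h.
Proof.
move=> hg hh.
have [iqg <-] := row_sq_integral hg; have [iqh <-] := row_sq_integral hh.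
rewrite -(RintegralD mJ iqg iqh) row_pair_sum //.
apply: (ae_le_Rintegral mJ) (ae_row_bessel M hg hh).
- by apply: (itgZ mJ); apply: (itg_zsum mJ) => m; exact: itg_row_pair.
- exact: (itgD mJ iqg iqh).
Qed.

(** Finitely many rows can be truncated at a common frequency. *)
Lemma uniform_truncation (F : int -> int -> R) (G : int -> R) M e : 0 < e ->
  (forall m n, 0 <= F m n) ->
  (forall m e, 0 < e -> exists N, G m <= S * zsum N (F m) + e) ->
  exists N, zsum M G <= zsum M (fun m => S * zsum N (F m)) + e.
Proof.
move=> e0 F0 hG; elim: M e e0 => [|M IH] e e0.
  by have [N hN] := hG 0 _ e0; exists N; rewrite !zsum0.
have e3 : 0 < e / 3 by rewrite divr_gt0.
have [N1 h1] := IH _ e3; have [N2 h2] := hG M.+1%:Z _ e3; have [N3 h3] := hG (- M.+1%:Z) _ e3.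
exists (maxn N1 (maxn N2 N3)).
have mono m K : (K <= maxn N1 (maxn N2 N3))%N ->
    S * zsum K (F m) <= S * zsum (maxn N1 (maxn N2 N3)) (F m).
  by move=> hK; rewrite ler_pM2l //; exact: zsum_le.
rewrite !zsumS.
have k1 : zsum M (fun m => S * zsum N1 (F m)) <=
    zsum M (fun m => S * zsum (maxn N1 (maxn N2 N3)) (F m)).
  by apply: ler_zsum => m; apply: mono; lia.
have k2 := mono M.+1%:Z N2 ltac:(lia); have k3 := mono (- M.+1%:Z) N3 ltac:(lia).
lra.
Qed.

Lemma row_pair_le g h M B : psq g -> psq h ->
  (forall N, P * S * zsum M (fun m => zsum N (fun n => Fr g h m n ^+ 2 + Fi g h m n ^+ 2)) <= B) ->
  P * zsum M (fun m => ip mu1 J (row_re g h m) (row_re g h m) +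
                       ip mu1 J (row_im g h m) (row_im g h m)) <= B.
Proof.
move=> hg hh hB; apply/ler_addgt0Pr => e e0.
have [||N hN] := @uniform_truncation (fun m n => Fr g h m n ^+ 2 + Fi g h m n ^+ 2)
  (fun m => ip mu1 J (row_re g h m) (row_re g h m) + ip mu1 J (row_im g h m) (row_im g h m))
  M (e / P) (divr_gt0 e0 P0).
- by move=> m n; rewrite addr_ge0 ?sqr_ge0.
- move=> m e1 e10.
  have [N hN] := pair_parseval ltr01 (sqitg_row_re m hg hh) (sqitg_row_im m hg hh) e10.
  exists N; apply: le_trans hN _; rewrite lerD2r -/S ler_pM2l //.
  by apply: ler_zsum => n; rewrite Fr_row // Fi_row.
apply: (@le_trans _ _ (P * (zsum M (fun m => S * zsum N (fun n => Fr g h m n ^+ 2 + Fi g h m n ^+ 2)) + e / P))).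
  by rewrite ler_pM2l.
rewrite mulrDr zsumZ mulrA; have -> : P * (e / P) = e by rewrite mulrC divfK // gt_eqF.
by rewrite lerD2r.
Qed.

(** For almost every y the truncated sums over the x-frequencies converge to the
energy of the row, by completeness in x, and are bounded by it; dominated convergence
then exchanges the limit and the integral in y, and completeness in y bounds the
integral of each truncated sum. *)
Theorem plane_parseval_le g h B : psq g -> psq h ->
  (forall M N, P * S * zsum M (fun m => zsum N (fun n => Fr g h m n ^+ 2 + Fi g h m n ^+ 2)) <= B) ->
  ip mu2 C g g + ip mu2 C h h <= B.
Proof.
move=> hg hh hB.
have [iqg <-] := row_sq_integral hg; have [iqh <-] := row_sq_integral hh.
rewrite -(RintegralD mJ iqg iqh).
pose q y := row_sq g y + row_sq h y.
pose psi M y := P * zsum M (fun m => row_re g h m y ^+ 2 + row_im g h m y ^+ 2).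
have ipsi M : itg mu1 J (psi M).
  by apply: (itgZ mJ); apply: (itg_zsum mJ) => m; exact: itg_row_pair.
have iq : itg mu1 J q := itgD mJ iqg iqh.
have psi0 M y : 0 <= psi M y.
  by apply: mulr_ge0; [exact: ltW|apply: zsum_ge0 => m; rewrite addr_ge0 ?sqr_ge0].
have hpsi M : \int[mu1]_(y in J) psi M y <= B.
  by rewrite -row_pair_sum //; exact: row_pair_le.
have [] := dominated_convergence (f_ := fun M => EFin \o psi M) (f := EFin \o q)
  (g := EFin \o q) mJ (fun M => measurable_int _ (ipsi M)) (measurable_int _ iq) _ iq _ => //.
- apply: filterS2 (ae_row_sq hg) (ae_row_sq hh) => y sg sh Jy.
  apply/cvg_EFin; first by apply: nearW.
  apply/cvgrPdist_le => e e0.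
  have [N hN] := pair_parseval delta0 (sg Jy) (sh Jy) e0.
  near=> M => /=.
  rewrite ger0_norm; last by rewrite subr_ge0; exact: (pair_bessel delta0 M (sg Jy) (sh Jy)).
  rewrite lerBlDr addrC; apply: le_trans hN _; rewrite lerD2r ler_pM2l //.
  apply: zsum_le; last by near: M; exact: nbhs_infty_ge.
  by move=> m; rewrite addr_ge0 ?sqr_ge0.
- have h1 M := ae_row_bessel M hg hh.
  have := ae_foralln h1; apply: filterS => y hy M Jy.
  by rewrite /= lee_fin ger0_norm ?psi0 // hy.
move=> _ _ hc.
have : (\int[mu1]_(y in J) (EFin \o q) y <= B%:E)%E.
  apply: (cvge_to_le hc); exists 0%N => // M _ /=.
  rewrite -[X in (X <= _)%E]fineK ?lee_fin ?hpsi //; exact: (integrable_fin_num mJ (ipsi M)).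
by rewrite -(fineK (integrable_fin_num mJ iq)) lee_fin.
Unshelve. all: by end_near.
Qed.

End Plane.

(** * Removing the x-average *)

Section RowMean.
Context {R : realType}.
Notation mu1 := (@lebesgue_measure R).
Notation mu2 := (@lebesgue_measure R \x @lebesgue_measure R)%E.
Local Notation plane := (measurableTypeR R * measurableTypeR R)%type.
Variable delta : R.
Hypothesis delta0 : 0 < delta.
Local Notation P := (2 * pi * delta).
Local Notation S := (2 * pi * 1).
Local Notation I := (period_cell delta).
Local Notation J := (period_cell 1).
Local Notation mI := (measurable_period_cell delta).
Local Notation mJ := (measurable_period_cell 1).
Local Notation C := (I `*` J).
Local Notation psq := (psq delta).
Local Notation row_re := (row_re delta).
Local Notation row_im := (row_im delta).
Local Notation Fr := (Fr delta).
Local Notation Fi := (Fi delta).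
Variables (g h : plane -> R).
Hypotheses (hg : psq g) (hh : psq h).

(** The function minus its average along each row. *)
Definition fluct_re (z : plane) : R := g z - row_re g h 0 z.2.
Definition fluct_im (z : plane) : R := h z - row_im g h 0 z.2.

Lemma psq_fluct : psq fluct_re /\ psq fluct_im.
Proof.
split; apply: psqB => //; apply: psq_snd => //.
- exact: measurable_row_re.
- exact: sqitg_row_re.
- exact: measurable_row_im.
- exact: sqitg_row_im.
Qed.

Lemma ae_row_fluct m : {ae mu1, forall y, J y ->
  row_re fluct_re fluct_im m y = (if m == 0 then 0 else row_re g h m y) /\
  row_im fluct_re fluct_im m y = (if m == 0 then 0 else row_im g h m y)}.
Proof.
apply: filterS2 (ae_row_sq hg) (ae_row_sq hh) => y sg sh Jy.
exact: (pair_coef_mean delta0 m (sg Jy) (sh Jy)).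
Qed.

Lemma measurable_row_filter (r : R -> R) (m : int) :
  measurable_fun J r -> measurable_fun J (fun y => if m == 0 then 0 else r y).
Proof. by move=> mr; case: eqP => // _; exact: measurable_cst. Qed.

Lemma coef_fluct m n :
  Fr fluct_re fluct_im m n = (if m == 0 then 0 else Fr g h m n) /\
  Fi fluct_re fluct_im m n = (if m == 0 then 0 else Fi g h m n).
Proof.
have [h1 h2] := psq_fluct; rewrite !(Fr_row, Fi_row) //.
have mr u v : psq u -> psq v -> measurable_fun J (row_re u v m).
  by move=> hu hv; apply: measurable_funTS; exact: measurable_row_re.
have mi u v : psq u -> psq v -> measurable_fun J (row_im u v m).
  by move=> hu hv; apply: measurable_funTS; exact: measurable_row_im.
have mc := measurable_continuous (A := J) (@continuous_cosM R (n%:~R / 1)).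
have ms := measurable_continuous (A := J) (@continuous_sinM R (n%:~R / 1)).
pose r0 y := if m == 0 then 0 else row_re g h m y.
pose i0 y := if m == 0 then 0 else row_im g h m y.
have mr0 : measurable_fun J r0 by apply: measurable_row_filter; exact: mr.
have mi0 : measurable_fun J i0 by apply: measurable_row_filter; exact: mi.
have -> : cr 1 (row_re fluct_re fluct_im m) (row_im fluct_re fluct_im m) n = cr 1 r0 i0 n.
  congr (_ * _); apply: (ae_eq_Rintegral mJ).
  - by apply: measurable_funD; apply: measurable_funM => //; [exact: mr|exact: mi].
  - by apply: measurable_funD; apply: measurable_funM.
  - by apply: filterS (ae_row_fluct m) => y hy Jy; have [-> ->] := hy Jy.
have -> : ci 1 (row_re fluct_re fluct_im m) (row_im fluct_re fluct_im m) n = ci 1 r0 i0 n.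
  congr (_ * _); apply: (ae_eq_Rintegral mJ).
  - by apply: measurable_funB; apply: measurable_funM => //; [exact: mi|exact: mr].
  - by apply: measurable_funB; apply: measurable_funM.
  - by apply: filterS (ae_row_fluct m) => y hy Jy; have [-> ->] := hy Jy.
rewrite /r0 /i0; case: eqP => // _; rewrite /cr /ci.
under eq_Rintegral do rewrite !mul0r addr0.
under [X in _ /\ _ * X = _]eq_Rintegral do rewrite !mul0r subr0.
by rewrite Rintegral_cst ?mul0r ?mulr0 //; exact: mJ.
Qed.

(** Subtracting the average in x removes the coefficients with m = 0 and leaves all
others unchanged. *)
Theorem fluct_parseval_le B :
  (forall M N, P * S * zsum M (fun m => if m == 0 then 0 else
     zsum N (fun n => Fr g h m n ^+ 2 + Fi g h m n ^+ 2)) <= B) ->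
  ip mu2 C fluct_re fluct_re + ip mu2 C fluct_im fluct_im <= B.
Proof.
move=> hB; have [h1 h2] := psq_fluct; apply: (plane_parseval_le delta0 h1 h2) => M N.
apply: le_trans (hB M N); rewrite le_eqVlt; apply/orP; left; apply/eqP; congr (_ * _).
apply: eq_zsum => m; case: (eqVneq m 0) => m0.
  rewrite -(mul0r (zsum N (fun=> 0))) -zsumZ; apply: eq_zsum => n.
  by have [-> ->] := coef_fluct m n; rewrite m0 eqxx expr0n mul0r addr0.
by apply: eq_zsum => n; have [-> ->] := coef_fluct m n; rewrite (negPf m0).
Qed.

End RowMean.

(** * Fourier coefficients and norms in real coordinates *)

Section Link.
Context {R : realType}.
Notation mu1 := (@lebesgue_measure R).
Notation mu2 := (@lebesgue_measure R \x @lebesgue_measure R)%E.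
Local Notation plane := (measurableTypeR R * measurableTypeR R)%type.
Variable delta : R.
Hypothesis delta0 : 0 < delta.
Local Notation P := (2 * pi * delta).
Local Notation S := (2 * pi * 1).
Local Notation I := (period_cell delta).
Local Notation J := (period_cell 1).
Local Notation mI := (measurable_period_cell delta).
Local Notation mJ := (measurable_period_cell 1).
Local Notation C := (I `*` J).
Local Notation mC := (measurable_rect delta).
Local Notation psq := (psq delta).
Implicit Types f : R * R -> R[i].

Definition re f : plane -> R := fun z => complex.Re (f z).
Definition im f : plane -> R := fun z => complex.Im (f z).
Definition energy f : R := ip mu2 C (re f) (re f) + ip mu2 C (im f) (im f).

Lemma energy_ge0 f : 0 <= energy f.
Proof. by rewrite addr_ge0 ?ip_ge0. Qed.

Lemma cellE : cell delta = C.
Proof. by rewrite /cell /cell_x /cell_y /period_cell mulr1. Qed.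

Lemma normc_sqr (w : R[i]) : Normc.normc w ^+ 2 = complex.Re w ^+ 2 + complex.Im w ^+ 2.
Proof. by case: w => a b /=; rewrite sqr_sqrtr // addr_ge0 ?sqr_ge0. Qed.

Lemma L2norm_poweR f : L2norm delta f =
  ((\int[mu2]_(z in C) (re f z ^+ 2 + im f z ^+ 2)%:E) `^ (2^-1))%E.
Proof.
rewrite /L2norm unlock; congr (_ `^ _)%E.
rewrite [RHS]integral_mkcond; apply: eq_integral => z _.
rewrite /= !patchE cellE; case: ifP => _ /=.
  have n0 : 0 <= Normc.normc (f z) by case: (f z) => a b; exact: sqrtr_ge0.
  by rewrite ger0_norm // powR_mulrn // normc_sqr.
by rewrite normr0 powR0.
Qed.

Lemma sqr_energy_measurable f : measurable_fun setT (re f) -> measurable_fun setT (im f) ->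
  measurable_fun setT (fun z : plane => (re f z ^+ 2 + im f z ^+ 2)%:E).
Proof.
move=> mr mi; apply/measurable_EFinP.
by apply: measurable_funD; exact: measurable_funX.
Qed.

Lemma psq_of_L2 f : measurable_fun setT (re f) -> measurable_fun setT (im f) ->
  (L2norm delta f < +oo)%E -> psq (re f) /\ psq (im f).
Proof.
move=> mr mi; rewrite L2norm_poweR => fin.
have m2 := sqr_energy_measurable mr mi.
have fin2 : (\int[mu2]_(z in C) (re f z ^+ 2 + im f z ^+ 2)%:E < +oo)%E.
  rewrite ltey; apply/eqP => e; move: fin; rewrite e /=.
  by rewrite invr_eq0 pnatr_eq0 /= ltxx.
have i2 : mu2.-integrable C (fun z => (re f z ^+ 2 + im f z ^+ 2)%:E).
  apply/integrableP; split; first exact: measurable_funTS.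
  apply: le_lt_trans fin2; rewrite le_eqVlt; apply/orP; left; apply/eqP.
  by apply: eq_integral => z _; rewrite gee0_abs // lee_fin addr_ge0 ?sqr_ge0.
split; split => //; split; try exact: measurable_funTS.
- apply: (le_itg mC _ _ i2); first by apply: measurable_funTS; exact: measurable_funX.
  by move=> z _; rewrite ger0_norm ?sqr_ge0 // lerDl sqr_ge0.
- apply: (le_itg mC _ _ i2); first by apply: measurable_funTS; exact: measurable_funX.
  by move=> z _; rewrite ger0_norm ?sqr_ge0 // lerDr sqr_ge0.
Qed.

Lemma L2normE f : psq (re f) -> psq (im f) -> L2norm delta f = (Num.sqrt (energy f))%:E.
Proof.
move=> [mr [_ sr]] [mi [_ si]]; rewrite L2norm_poweR.
have -> : (\int[mu2]_(z in C) (re f z ^+ 2 + im f z ^+ 2)%:E)%E = (energy f)%:E.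
  have i2 : mu2.-integrable C (fun z => (re f z ^+ 2 + im f z ^+ 2)%:E) := itgD mC sr si.
  rewrite -(fineK (integrable_fin_num mC i2)); congr _%:E.
  exact: (RintegralD mC sr si).
by rewrite poweR_EFin powR12_sqrt // energy_ge0.
Qed.

Lemma fourier_Fr f m n : complex.Re (fourier delta f m n) = Fr delta (re f) (im f) m n.
Proof.
rewrite /fourier /Cintegral /= mul0r subr0 /Fr -cellE; congr (_ * _).
apply: eq_Rintegral => z _; rewrite /re /im /cis /phase /alpha /beta; case: (f z) => a b /=.
by rewrite cosN sinN mulrN opprK.
Qed.

Lemma fourier_Fi f m n : complex.Im (fourier delta f m n) = Fi delta (re f) (im f) m n.
Proof.
rewrite /fourier /Cintegral /= mul0r addr0 /Fi -cellE; congr (_ * _).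
apply: eq_Rintegral => z _; rewrite /re /im /cis /phase /alpha /beta; case: (f z) => a b /=.
by rewrite cosN sinN mulrN addrC.
Qed.

Lemma neq_part_re f : re (neq_part delta f) = fluct_re delta (re f) (im f).
Proof.
apply/funext => z; rewrite /re /neq_part /Cintegral /fluct_re /=.
rewrite raddfB /= mul0r subr0; congr (_ - _ * _); apply: eq_Rintegral => x _.
by rewrite /cosn /sinn !mul0r cos0 sin0 mulr1 mulr0 addr0.
Qed.

Lemma neq_part_im f : im (neq_part delta f) = fluct_im delta (re f) (im f).
Proof.
apply/funext => z; rewrite /im /neq_part /Cintegral /fluct_im /=.
rewrite raddfB /= mul0r addr0; congr (_ - _ * _); apply: eq_Rintegral => x _.
by rewrite /cosn /sinn !mul0r cos0 sin0 mulr1 mulr0 subr0.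
Qed.

End Link.

(** * The evolution of the Fourier coefficients *)

Section Dynamics.
Context {R : realType}.
Notation mu1 := (@lebesgue_measure R).
Notation mu2 := (@lebesgue_measure R \x @lebesgue_measure R)%E.
Local Notation plane := (measurableTypeR R * measurableTypeR R)%type.
Variable delta : R.
Hypothesis delta0 : 0 < delta.
Local Notation P := (2 * pi * delta).
Local Notation S := (2 * pi * 1).
Local Notation I := (period_cell delta).
Local Notation J := (period_cell 1).
Local Notation C := (I `*` J).
Local Notation mC := (measurable_rect delta).
Local Notation finC := (rect_fin delta0).
Local Notation psq := (psq delta).
Implicit Types (g h : plane -> R) (f : R * R -> R[i]).

Lemma P_gt0 : 0 < P. Proof. by rewrite !mulr_gt0 // pi_gt0. Qed.
Lemma S_gt0 : 0 < S :> R. Proof. by rewrite !mulr_gt0 // pi_gt0. Qed.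

Lemma itg_Fr g h m n : psq g -> psq h ->
  itg mu2 C (fun z => g z * cos (phase delta m n z) + h z * sin (phase delta m n z)).
Proof.
move=> hg hh; have [h1 _] := psq_phase m n hg; have [_ h2] := psq_phase m n hh.
exact: (sqitg_itg mC finC (psqD h1 h2).2).
Qed.

Lemma FrB g1 h1 g2 h2 m n : psq g1 -> psq h1 -> psq g2 -> psq h2 ->
  Fr delta (fun z => g1 z - g2 z) (fun z => h1 z - h2 z) m n =
  Fr delta g1 h1 m n - Fr delta g2 h2 m n.
Proof.
move=> *; rewrite /Fr -mulrBr; congr (_ * _).
rewrite -(RintegralB mC); [|exact: itg_Fr|exact: itg_Fr].
by apply: eq_Rintegral => z _; ring.
Qed.

Lemma FiB g1 h1 g2 h2 m n : psq g1 -> psq h1 -> psq g2 -> psq h2 ->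
  Fi delta (fun z => g1 z - g2 z) (fun z => h1 z - h2 z) m n =
  Fi delta g1 h1 m n - Fi delta g2 h2 m n.
Proof.
move=> hg1 hh1 hg2 hh2; rewrite !FiE -FrB //; [|exact: psqZ|exact: psqZ].
by congr (_ * _); apply: eq_Rintegral => z _; ring.
Qed.

(** Multiplication by cos y averages neighbouring coefficients. *)
Lemma Fr_cos g h m n : psq g -> psq h ->
  Fr delta (fun z => cos z.2 * g z) (fun z => cos z.2 * h z) m n = avg (Fr delta g h m) n.
Proof.
move=> hg hh; rewrite /avg /Fr -mulrDr -(RintegralD mC (itg_Fr m (n + 1) hg hh) (itg_Fr m (n - 1) hg hh)).
rewrite -[RHS]mulrA; congr (_ * _); rewrite [RHS]mulrC.
rewrite -(RintegralZl _ mC); last exact: (itgD mC (itg_Fr _ _ hg hh) (itg_Fr _ _ hg hh)).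
apply: eq_Rintegral => z _.
have -> : phase delta m (n + 1) z = phase delta m n z + z.2 by rewrite /phase rmorphD /=; ring.
have -> : phase delta m (n - 1) z = phase delta m n z - z.2 by rewrite /phase rmorphB /=; ring.
by rewrite !(cosD, sinD, cosN, sinN); field.
Qed.

Lemma Fi_cos g h m n : psq g -> psq h ->
  Fi delta (fun z => cos z.2 * g z) (fun z => cos z.2 * h z) m n = avg (Fi delta g h m) n.
Proof.
move=> hg hh; rewrite FiE /avg !FiE -/(avg (Fr delta h (fun z => - 1 * g z) m) n).
rewrite -Fr_cos //; last exact: psqZ.
by congr (_ * _); apply: eq_Rintegral => z _; ring.
Qed.

Lemma coef_sqr_energy g h m n : psq g -> psq h ->
  P * S * (Fr delta g h m n ^+ 2 + Fi delta g h m n ^+ 2) <= ip mu2 C g g + ip mu2 C h h.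
Proof.
move=> hg hh; apply: le_trans (row_energy_sum_le delta0 `|m|%N hg hh).
have f0 k : 0 <= Fr delta g h m k ^+ 2 + Fi delta g h m k ^+ 2 by rewrite addr_ge0 ?sqr_ge0.
rewrite -mulrA ler_pM2l ?P_gt0 //.
apply: (@le_trans _ _ (row_energy delta g h m)).
  apply: le_trans (row_energy_bessel delta0 m `|n|%N hg hh).
  by rewrite ler_pM2l ?S_gt0 //; exact: (le_zsum_term n f0).
apply: (le_zsum_term (f := row_energy delta g h)) => k.
by rewrite addr_ge0 ?ip_ge0.
Qed.

Lemma nsq_energy g h m K : psq g -> psq h ->
  nsq K (Fr delta g h m) + nsq K (Fi delta g h m) <= S^-1 * row_energy delta g h m.
Proof.
move=> hg hh; rewrite /nsq -zsumD mulrC ler_pdivlMr ?S_gt0 // mulrC.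
exact: row_energy_bessel.
Qed.

Lemma row_energy_le g h m : psq g -> psq h ->
  row_energy delta g h m <= P^-1 * (ip mu2 C g g + ip mu2 C h h).
Proof.
move=> hg hh; rewrite mulrC ler_pdivlMr ?P_gt0 // mulrC.
apply: le_trans (row_energy_sum_le delta0 `|m|%N hg hh); rewrite ler_pM2l ?P_gt0 //.
apply: (le_zsum_term (f := row_energy delta g h)) => k.
by rewrite addr_ge0 ?ip_ge0.
Qed.

Definition la m n : R := Num.sqrt (alpha delta m ^+ 2 + beta n ^+ 2).

Lemma la_ge m n : `|n%:~R| <= la m n.
Proof. by rewrite -sqrtr_sqr; apply: ler_wsqrtr; rewrite lerDr sqr_ge0. Qed.

(** A Euclidean norm is 1-Lipschitz in each of its coordinates. *)
Lemma la_lip m n : `|la m (n + 1) - la m n| <= 1.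
Proof.
rewrite /la /beta rmorphD /=.
move: (alpha delta m) (n%:~R : R) => a b.
have sqrt_lip (x y : R) : Num.sqrt (a ^+ 2 + x ^+ 2) <= Num.sqrt (a ^+ 2 + y ^+ 2) + `|x - y|.
  rewrite -ler_sqr ?nnegrE ?addr_ge0 ?sqrtr_ge0 //.
  rewrite sqrrD !sqr_sqrtr ?addr_ge0 ?sqr_ge0 // real_normK ?num_real //.
  have : `|y| <= Num.sqrt (a ^+ 2 + y ^+ 2).
    by rewrite -sqrtr_sqr; apply: ler_wsqrtr; rewrite lerDr sqr_ge0.
  have : y * (x - y) <= `|y| * `|x - y| by rewrite -normrM ler_norm.
  have := normr_ge0 (x - y); move: (Num.sqrt _) `|x - y| `|y| => s d e.
  rewrite -mulr_natl; nra.
rewrite ler_norml; have := sqrt_lip (b + 1) b; have := sqrt_lip b (b + 1).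
have -> : b - (b + 1) = - 1 by ring.
have -> : b + 1 - b = 1 by ring.
by rewrite normrN normr1 => h1 h2; apply/andP; split; lra.
Qed.

Lemma re_cos_mul f : re (fun z => (cos z.2)%:C%C * f z) = (fun z => cos z.2 * re f z).
Proof. by apply/funext => z; rewrite /re; case: (f z) => a b /=; rewrite mul0r subr0. Qed.

Lemma im_cos_mul f : im (fun z => (cos z.2)%:C%C * f z) = (fun z => cos z.2 * im f z).
Proof. by apply/funext => z; rewrite /im; case: (f z) => a b /=; rewrite mul0r addr0. Qed.

Lemma fourier_pair f m n :
  fourier delta f m n = Complex (Fr delta (re f) (im f) m n) (Fi delta (re f) (im f) m n).
Proof. by rewrite -fourier_Fr -fourier_Fi; case: (fourier _ _ _ _). Qed.

(** The equation on one Fourier mode, in real coordinates. *)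
Lemma rate_re f m n nu : psq (re f) -> psq (im f) ->
  complex.Re (- (advection delta f m n + nu%:C%C * half_laplacian delta (fourier delta f) m n)) =
  alpha delta m * avg (Fi delta (re f) (im f) m) n - nu * la m n * Fr delta (re f) (im f) m n.
Proof.
move=> hr hi; rewrite /advection /half_laplacian /dx !fourier_pair re_cos_mul im_cos_mul.
by rewrite Fr_cos // Fi_cos // -/(la m n) /=; ring.
Qed.

Lemma rate_im f m n nu : psq (re f) -> psq (im f) ->
  complex.Im (- (advection delta f m n + nu%:C%C * half_laplacian delta (fourier delta f) m n)) =
  - alpha delta m * avg (Fr delta (re f) (im f) m) n - nu * la m n * Fi delta (re f) (im f) m n.
Proof.
move=> hr hi; rewrite /advection /half_laplacian /dx !fourier_pair re_cos_mul im_cos_mul.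
by rewrite Fr_cos // Fi_cos // -/(la m n) /=; ring.
Qed.

Lemma reB f1 f2 : re (fun z => f1 z - f2 z) = (fun z => re f1 z - re f2 z).
Proof. by apply/funext => z; rewrite /re raddfB. Qed.

Lemma imB f1 f2 : im (fun z => f1 z - f2 z) = (fun z => im f1 z - im f2 z).
Proof. by apply/funext => z; rewrite /im raddfB. Qed.

(** From g = h + (g - h).  With the continuity in time this bounds the energy near
each time. *)
Lemma ip_sub_le g h : psq g -> psq h ->
  ip mu2 C g g <= 2 * ip mu2 C h h + 2 * ip mu2 C (fun z => g z - h z) (fun z => g z - h z).
Proof.
move=> hg hh; have hd := psqB hg hh.
have i1 := sqitg_mul mC hh.2 hh.2; have i2 := sqitg_mul mC hd.2 hd.2.
rewrite -(RintegralZl _ mC i1) -(RintegralZl _ mC i2) -(RintegralD mC (itgZ mC _ i1) (itgZ mC _ i2)).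
apply: (le_Rintegral mC (sqitg_mul mC hg.2 hg.2) (itgD mC (itgZ mC _ i1) (itgZ mC _ i2))).
move=> z _; have := sqr_ge0 (g z - 2 * h z); nra.
Qed.

Section Solution.
Variables (nu : R) (theta_in : R * R -> R[i]) (theta : R -> R * R -> R[i]).
Hypothesis sol : solution delta nu theta_in theta.
(** Extending the solution by its initial value to negative times makes the
one-sided continuity at 0 a two-sided one. *)
Definition past (t : R) := theta (Num.max 0 t).

Lemma past_ge0 t : 0 <= t -> past t = theta t.
Proof. by move=> t0; rewrite /past max_r. Qed.

Lemma past_psq t : psq (re (past t)) /\ psq (im (past t)).
Proof.
have [h _ _ _] := sol; have t0 : 0 <= Num.max 0 t by rewrite le_max lexx.
by have [_ mr mi fin] := h _ t0; exact: psq_of_L2.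
Qed.

Lemma past_diff_psq s t : psq (re (fun z => past s z - past t z)) /\
  psq (im (fun z => past s z - past t z)).
Proof.
have [h1 h2] := past_psq s; have [h3 h4] := past_psq t.
by rewrite reB imB; split; exact: psqB.
Qed.

Lemma past_continuous (t e : R) : 0 < e ->
  \forall s \near t, energy delta (fun z => past s z - past t z) <= e.
Proof.
move=> e0; have [_ hc _ _] := sol; pose t' := Num.max 0 t.
have t0 : 0 <= t' by rewrite le_max lexx.
have /fine_cvg /cvgrPdist_lt /(_ (Num.sqrt e)) := hc t' t0.
rewrite sqrtr_gt0 => /(_ e0); rewrite /within /= => h.
have cm : (fun s : R => Num.max 0 s) @ t --> t'.
  by apply: continuous_max; [exact: cst_continuous|exact: cvg_id].
have {}h : \forall s \near t, `[0, +oo[%classic (Num.max 0 s) -> `|0 - fine (L2norm delta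
    (fun z => past s z - past t z))| < Num.sqrt e := cm _ h.
move: h; apply: filterS => s hs.
have s0 : 0 <= Num.max 0 s by rewrite le_max lexx.
have [h1 h2] := past_diff_psq s t.
have := hs; rewrite /= in_itv /= andbT => /(_ s0).
rewrite sub0r normrN -/(past s) -/(past t) -/t'.
rewrite (_ : L2norm _ _ = (Num.sqrt (energy delta (fun z => past s z - past t z)))%:E); last exact: L2normE.
by rewrite /= ger0_norm ?sqrtr_ge0 // ltr_sqrt // => /ltW.
Qed.

(** The energy is locally bounded in time by continuity, hence bounded on compact
intervals. *)
Lemma past_bounded (T : R) : exists B, forall t, 0 <= t <= T -> energy delta (past t) <= B.
Proof.
have /compact_near_coveringP cov := @segment_compact R 0 T.
have : \forall B \near +oo, `[0, T]%classic `<=` (fun t => energy delta (past t) <= B).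
  apply: cov => t _.
  have h := past_continuous t ltr01.
  have hB : \forall B \near +oo, 2 * energy delta (past t) + 2 <= B :> R by apply: nbhs_pinfty_ge; exact: num_real.
  exists ([set s | energy delta (fun z => past s z - past t z) <= 1],
          [set B : R | 2 * energy delta (past t) + 2 <= B]); first by split.
  move=> [s B] [/= h1 h2]; apply: le_trans h2.
  have [a1 a2] := past_psq s; have [b1 b2] := past_psq t.
  have := ip_sub_le a1 b1; have := ip_sub_le a2 b2.
  move: h1; rewrite /energy reB imB; lra.
move=> [B [_ hB]]; exists (B + 1) => t tT; apply: (hB (B + 1)); first by rewrite ltrDl.
by rewrite /= in_itv.
Qed.

End Solution.
End Dynamics.

(** * Decay of the non-zero x-frequencies *)

Section Decay.
Context {R : realType}.
Notation mu2 := (@lebesgue_measure R \x @lebesgue_measure R)%E.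
Variable delta : R.
Hypotheses (delta0 : 0 < delta) (delta1 : delta < 1).
Local Notation P := (2 * pi * delta).
Local Notation S := (2 * pi * 1).

Variables (nu : R) (theta_in : R * R -> R[i]) (theta : R -> R * R -> R[i]).
Hypotheses (nu0 : 0 < nu) (nu_eta : nu <= eta ^+ 3).
Hypothesis in_L2 : inL2 delta theta_in.
Hypothesis sol : solution delta nu theta_in theta.

Definition pr m (t : R) n := Fr delta (re (past theta t)) (im (past theta t)) m n.
Definition qi m (t : R) n := Fi delta (re (past theta t)) (im (past theta t)) m n.

Lemma coef_dist_le m n s t :
  P * S * ((pr m s n - pr m t n) ^+ 2 + (qi m s n - qi m t n) ^+ 2) <=
  energy delta (fun z => past theta s z - past theta t z).
Proof.
have [h1 h2] := past_psq sol s; have [h3 h4] := past_psq sol t.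
rewrite -FrB // -FiB //; have := coef_sqr_energy delta0 m n (psqB h1 h3) (psqB h2 h4).
by rewrite /energy reB imB.
Qed.

Lemma coef_continuous m n t :
  {for t, continuous (fun s => pr m s n)} /\ {for t, continuous (fun s => qi m s n)}.
Proof.
have PS : 0 < P * S by apply: mulr_gt0; [exact: P_gt0|exact: S_gt0].
have near_small (e : R) : 0 < e -> \forall s \near t,
    (pr m t n - pr m s n) ^+ 2 + (qi m t n - qi m s n) ^+ 2 <= e ^+ 2.
  move=> e0; have e2 : 0 < P * S * e ^+ 2 by apply: mulr_gt0 => //; exact: exprn_gt0.
  have := past_continuous sol t e2; apply: filterS => s hs.
  have := le_trans (coef_dist_le m n s t) hs; rewrite ler_pM2l //.
  by rewrite -(sqrrN (pr m s n - _)) -(sqrrN (qi m s n - _)) !opprB.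
split; apply/cvgrPdist_le => e e0; apply: filterS (near_small e e0) => s hs.
- rewrite -(ler_sqr (x := `|_|)) ?nnegrE ?(ltW e0) // real_normK ?num_real //.
  by apply: le_trans hs; rewrite lerDl sqr_ge0.
- rewrite -(ler_sqr (x := `|_|)) ?nnegrE ?(ltW e0) // real_normK ?num_real //.
  by apply: le_trans hs; rewrite lerDr sqr_ge0.
Qed.

Lemma near_past (t : R) : 0 < t -> \forall s \near t, theta s = past theta s.
Proof.
move=> t0; near=> s; rewrite past_ge0 // ltW //.
by near: s; have := @Nlt_nbhsl R t 0; rewrite oppr_lt0 => /(_ t0); apply: filterS => s; rewrite oppr_lt0.
Unshelve. all: by end_near.
Qed.

Lemma coef_derive m n (t : R) : 0 < t ->
  is_derive t 1 (fun s => pr m s n)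
    (alpha delta m * avg (qi m t) n - nu * la delta m n * pr m t n) /\
  is_derive t 1 (fun s => qi m s n)
    (- alpha delta m * avg (pr m t) n - nu * la delta m n * qi m t n).
Proof.
move=> t0; have [_ _ _ hd] := sol; have [dr di] := hd t t0 m n.
have [hr hi] := past_psq sol t; have pt : past theta t = theta t by apply: past_ge0; exact: ltW.
rewrite pt in hr hi.
rewrite rate_re // in dr; rewrite rate_im // in di.
rewrite /pr /qi pt; split; [move: dr|move: di]; apply: near_eq_is_derive.
- by apply: filterS (near_past t0) => s ->; rewrite fourier_Fr.
- by apply: filterS (near_past t0) => s ->; rewrite fourier_Fi.
Qed.

(** The initial condition holds almost everywhere only, which is enough for norms. *)
Lemma energy_initial : energy delta (past theta 0) = energy delta theta_in.
Proof.
have [_ _ h0 _] := sol; have [_ mr mi fin] := in_L2.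
have [hr hi] := psq_of_L2 mr mi fin.
have [kr ki] := past_psq sol 0.
rewrite past_ge0 // in kr ki *.
have h1 : {ae mu2, forall z, (period_cell delta `*` period_cell 1) z -> theta 0 z = theta_in z}.
  by rewrite -cellE; exact: h0.
have mC := measurable_rect delta.
have mm (u : measurableTypeR R * measurableTypeR R -> R) : psq delta u -> measurable_fun (period_cell delta `*` period_cell 1) (fun z => u z * u z).
  by move=> [mu _]; apply: measurable_funTS; exact: measurable_funM.
rewrite /energy; congr (_ + _); apply: (ae_eq_Rintegral mC); try exact: mm.
- by apply: filterS h1 => z hz Cz; rewrite /re hz.
- by apply: filterS h1 => z hz Cz; rewrite /im hz.
Qed.

(** The decay factor of the energies; the factor 2 comes from bounding real and imaginary
parts separately. *)
Definition gain (t : R) : R := 2 * (contr^-1 * expR (ln contr / 33 * nu `^ (2 / 3) * t)).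

Lemma gain_ge0 t : 0 <= gain t.
Proof.
by apply: mulr_ge0 => //; apply: mulr_ge0; [rewrite invr_ge0 ltW // contr_gt0|exact: expR_ge0].
Qed.

Lemma row_decay m N t : m != 0 -> 0 <= t ->
  S * zsum N (fun n => pr m t n ^+ 2 + qi m t n ^+ 2) <=
  gain t * row_energy delta (re (past theta 0)) (im (past theta 0)) m.
Proof.
move=> m0 t0.
have a1 : 1 <= `|alpha delta m|.
  rewrite /alpha normrM normfV (ger0_norm (ltW delta0)) ler_pdivlMr // mul1r.
  apply: le_trans (ltW delta1) _; rewrite -intr_norm ler1z; lia.
have c1 (s : R) n : 0 <= s -> {for s, continuous (fun s => pr m s n)}.
  by move=> _; case: (coef_continuous m n s).
have c2 (s : R) n : 0 <= s -> {for s, continuous (fun s => qi m s n)}.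
  by move=> _; case: (coef_continuous m n s).
have d1 (s : R) n : 0 < s -> is_derive s 1 (fun s => pr m s n)
    (alpha delta m * avg (qi m s) n - nu * la delta m n * pr m s n).
  by move=> s0; case: (coef_derive m n s0).
have d2 (s : R) n : 0 < s -> is_derive s 1 (fun s => qi m s n)
    (- alpha delta m * avg (pr m s) n - nu * la delta m n * qi m s n).
  by move=> s0; case: (coef_derive m n s0).
have bnd T : exists B, forall s K, 0 <= s <= T -> nsq K (pr m s) + nsq K (qi m s) <= B.
  have [B hB] := past_bounded sol T; exists (S^-1 * (P^-1 * B)) => s K sT.
  have [hr hi] := past_psq sol s.
  apply: le_trans (nsq_energy delta0 m K hr hi) _.
  rewrite ler_pM2l ?invr_gt0 ?S_gt0 //; apply: le_trans (row_energy_le delta0 m hr hi) _.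
  by rewrite ler_pM2l ?invr_gt0 ?P_gt0 //; exact: hB.
have [hr hi] := past_psq sol 0.
have init K := nsq_energy delta0 m K hr hi.
have h := mode_decay (la_ge delta m) (la_lip delta m) nu0 nu_eta a1 c1 c2 d1 d2 bnd init N t0.
rewrite -ler_pdivlMl ?S_gt0 //.
have -> : S^-1 * (gain t * row_energy delta (re (past theta 0)) (im (past theta 0)) m) =
  2 * (contr^-1 * expR (ln contr / 33 * nu `^ (2 / 3) * t) *
    (S^-1 * row_energy delta (re (past theta 0)) (im (past theta 0)) m)).
  by rewrite /gain; ring.
apply: le_trans h; rewrite zsumD /nsq.
by apply: lerD; apply: zsum_le => // n; exact: sqr_ge0.
Qed.

(** Bessel's inequality at time 0 bounds the sum of the energies of all
x-frequencies, each non-zero one decays, and the converse inequality at time t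
controls the fluctuation. *)
Lemma neq_energy_decay t : 0 <= t ->
  psq delta (re (neq_part delta (theta t))) /\ psq delta (im (neq_part delta (theta t))) /\
  energy delta (neq_part delta (theta t)) <= gain t * energy delta theta_in.
Proof.
move=> t0; have [hr hi] := past_psq sol t; have pt := past_ge0 theta t0.
have [kr ki] := past_psq sol 0.
have [f1 f2] := psq_fluct delta0 hr hi.
rewrite neq_part_re neq_part_im -pt; split => //; split => //.
rewrite -energy_initial [X in X <= _]/energy neq_part_re neq_part_im; apply: (fluct_parseval_le delta0 hr hi) => M N.
have g0 := gain_ge0 t.
apply: le_trans (_ : gain t * (P * zsum M (row_energy delta (re (past theta 0)) (im (past theta 0)))) <= _); last first.
  by apply: ler_wpM2l => //; exact: row_energy_sum_le.
rewrite [X in _ <= X]mulrCA -[X in X <= _]mulrA ler_pM2l ?P_gt0 // -!zsumZ; apply: ler_zsum => m.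
case: eqVneq => [_|m0]; last exact: row_decay.
by rewrite mulr0 mulr_ge0 // addr_ge0 ?ip_ge0.
Qed.

Lemma neq_L2_decay t : 0 <= t -> (L2norm delta (neq_part delta (theta t)) <=
  (Num.sqrt (2 / contr) * expR (- (- ln contr / 66) * nu `^ (2 / 3) * t))%:E
    * L2norm delta theta_in)%E.
Proof.
move=> t0; have [h1 [h2 h3]] := neq_energy_decay t0.
have [_ mr mi fin] := in_L2; have [hr hi] := psq_of_L2 mr mi fin.
rewrite (L2normE h1 h2) (L2normE hr hi) -EFinM lee_fin.
have -> : Num.sqrt (2 / contr) * expR (- (- ln contr / 66) * nu `^ (2 / 3) * t) = Num.sqrt (gain t).
  have -> : gain t = 2 / contr * expR (- (- ln contr / 66) * nu `^ (2 / 3) * t) ^+ 2.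
    by rewrite /gain -expRM_natl mulrA; congr (_ * expR _); rewrite mulr_natl; field.
  by rewrite [RHS]sqrtrM ?sqrtr_sqr ?(ger0_norm (expR_ge0 _)) // divr_ge0 // ltW // contr_gt0.
by rewrite -sqrtrM ?gain_ge0 //; exact: ler_wsqrtr.
Qed.

End Decay.

Theorem theorem1p2 (R : realType) (delta : R) :
  0 < delta -> delta < 1 ->
  exists nu0 c C : R,
    [/\ 0 < nu0, nu0 <= 1, 0 < c & 1 < C] /\
    forall (nu : R) (theta_in : R * R -> R[i]) (theta : R -> R * R -> R[i]),
      0 < nu -> nu < nu0 ->
      inL2 delta theta_in ->
      solution delta nu theta_in theta ->
      forall t : R, 0 <= t ->
        (L2norm delta (neq_part delta (theta t))
         <= (C * expR (- c * nu `^ (2 / 3) * t))%:E * L2norm delta theta_in)%E.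
Proof.
move=> delta0 delta1.
exists (eta ^+ 3), (- ln contr / 66), (Num.sqrt (2 / contr)).
have k0 := @contr_gt0 R; have k1 := @contr_lt1 R.
split; last first.
  move=> nu theta_in theta nu0 nu1 hin sol t t0.
  exact: (neq_L2_decay delta0 delta1 nu0 (ltW nu1) hin sol t0).
split.
- by apply: exprn_gt0; exact: eta_gt0.
- by apply: exprn_ile1; [exact: ltW (eta_gt0)|exact: eta_le1].
- by apply: divr_gt0 => //; rewrite oppr_gt0 ln_lt0 // k0 k1.
- rewrite -[X in X < _]sqrtr1 ltr_sqrt ?divr_gt0 // ltr_pdivlMr // mul1r.
  by apply: lt_trans k1 _; rewrite ltr1n.
Qed.
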